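(* Let $\alpha=e^{-i\pi/4}$. For $0<\mathrm{Re}(s)<1$ and $z\in\mathbb{R}$ define $$\varphi^{\zeta}_s(z)=e^{i\frac{z^2}{2}}\int_0^\infty\Big(\sum_{n\neq0}e^{(\alpha z-i\sqrt{\pi}nx)^2}-\frac1x\Big)x^{-s}\,dx .$$ Then for every $s$ with $0<\mathrm{Re}(s)<1$: $\varphi^{\zeta}_s(z)=0$ for all $z\in\mathbb{R}$ if and only if $\zeta(s)=0$.
   Context: The sum over $n\neq 0$ runs over all nonzero integers; $\zeta$ is the Riemann zeta function. *)

(* Defs.v *)
(* Stdlib reals with Coquelicot: C is Complex.C throughout. *)
From Stdlib Require Import Reals ZArith.
From Coquelicot Require Import Coquelicot.
Open Scope R_scope.

Definition Cexp (w : C) : C :=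
  (exp (Re w) * cos (Im w), exp (Re w) * sin (Im w)).

(* [RCpow x s] is x^s for x > 0, with the real logarithm of x. *)
Definition RCpow (x : R) (s : C) : C := Cexp (s * RtoC (ln x))%C.

(* Like [RInt_gen], [CSeries] is meaningful only for convergent series
   (Coquelicot's [Series] is restricted to real terms). *)
Definition CSeries (a : nat -> C) : C :=
  @iota (CompleteNormedModule.CompleteSpace C_AbsRing C_CompleteNormedModule)
    (@is_series C_AbsRing C_NormedModule a).

(* The sum over all nonzero integers, as the sum over n >= 1 plus the sum
   over n <= -1, each converging separately. *)
Definition CSeries_nonzero (a : Z -> C) : C :=
  Cplus (CSeries (fun k => a (Z.of_nat (S k))))
        (CSeries (fun k => a (Z.opp (Z.of_nat (S k))))).

Definition C_analytic_at (f : C -> C) (s0 : C) : Prop :=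
  exists (a : nat -> C) (r : R), 0 < r /\
    forall s : C, Cmod (s - s0)%C < r ->
      @is_pseries C_AbsRing C_NormedModule a (s - s0)%C (f s).

(* The Riemann zeta function: the analytic function on C \ {1} that is given
   by the Dirichlet series on Re s > 1.  By the identity theorem this
   determines f everywhere except at the pole 1, where f is unconstrained. *)
Definition is_riemann_zeta (f : C -> C) : Prop :=
  (forall s : C, s <> RtoC 1 -> C_analytic_at f s) /\
  (forall s : C, 1 < Re s ->
     @is_series C_AbsRing C_NormedModule
       (fun k => RCpow (INR (S k)) (- s)%C) (f s)).

Definition alpha : C := Cexp (- Ci * RtoC PI / RtoC 4)%C.

Definition phi_zeta_integrand (s : C) (z x : R) : C :=
  ((CSeries_nonzero (fun n : Z =>
      Cexp ((alpha * RtoC z - Ci * RtoC (sqrt PI) * RtoC (IZR n) * RtoC x) ^ 2))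
    - / RtoC x) * RCpow x (- s))%C.

Definition phi_zeta (s : C) (z : R) : C :=
  (Cexp (Ci * (RtoC z ^ 2 / RtoC 2)) *
   @RInt_gen C_R_CompleteNormedModule (phi_zeta_integrand s z)
     (at_right 0) (Rbar_locally p_infty))%C.

(* Main.v *)
(* Muentz's formula identifies the integral with zeta(1-s) times the Mellin transform at 1-s of
   G_z(u) = g_z(u) + g_z(-u), where g_z(u) = exp((alpha z - i sqrt(pi) u)^2) and int_0^oo G_z = 1.
   In the critical strip zeta is reached through the alternating series eta(w) = (1 - 2^(1-w)) zeta(w),
   by the identity theorem along a segment. At z = 0 the theta functional equation (obtained by Polya's
   argument from a finite identity for binomial sums) makes the integral invariant under s -> 1-s,
   and the Mellin transform of the Gaussian has no zeros, so zeta(s) = 0 iff zeta(1-s) = 0. *)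
Require Import Defs.
From Stdlib Require Import Reals ZArith Lra Lia Psatz.
From Coquelicot Require Import Coquelicot.
Open Scope R_scope.

(** * Complex sequences, series and exponentials *)

(** The statement fixes zeta only through its Dirichlet series and its analyticity off 1. The
    obstacle is to evaluate an integral in the strip, where that series diverges, without continuing
    the integral itself in the exponent. Pairing consecutive terms settles this: all partial sums
    for Theta(x) - 2 Theta(2x) are bounded by one multiple of exp(-x), so integration term by term
    is legitimate at each single point of the strip, and analyticity serves only to compare eta with
    zeta. The factor 1 - 2^(1-w) can be divided out because Re w < 1. Neither the Gamma function nor
    Stirling's formula nor Fourier integrals enter. The finite identity leaves one unknown constant,
    the limit of n (C(2n,n)/4^n)^2, and the fixed point t = PI of t -> PI^2/t determines it. The
    theta equation then also yields the Gaussian integral, since x Theta(x) is a Riemann sum that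
    tends to 1, and an explicit primitive in u carries the value from z = 0 to every real z. *)

Lemma norm_C_R (x : C) : @norm R_AbsRing C_R_NormedModule x = Cmod x.
Proof.
  destruct x as [a b]. unfold Cmod. cbn.
  unfold prod_norm. cbn. f_equal.
  change (Rabs a * (Rabs a * 1) + Rabs b * (Rabs b * 1) = a * (a * 1) + b * (b * 1)).
  replace (Rabs a * (Rabs a * 1)) with (Rabs a ^ 2) by (cbn; ring).
  replace (Rabs b * (Rabs b * 1)) with (Rabs b ^ 2) by (cbn; ring).
  rewrite !pow2_abs. ring.
Qed.

Lemma Clim_eps {T : Type} (F : (T -> Prop) -> Prop) {FF : Filter F} (u : T -> C) (l : C) :
  filterlim u F (@locally C_UniformSpace l) <->
  (forall eps : R, 0 < eps -> F (fun n => Cmod (u n - l)%C < eps)).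
Proof.
  split.
  - intros H eps Heps.
    apply (proj1 (@filterlim_locally_ball_norm C_AbsRing T C_NormedModule F FF u l) H (mkposreal eps Heps)).
  - intros H.
    apply (proj2 (@filterlim_locally_ball_norm C_AbsRing T C_NormedModule F FF u l)).
    intros eps. apply (H eps), cond_pos.
Qed.

Lemma Clim_unique (u : nat -> C) (l l' : C) :
  filterlim u eventually (@locally C_UniformSpace l) ->
  filterlim u eventually (@locally C_UniformSpace l') -> l = l'.
Proof. apply (@filterlim_locally_unique nat C_AbsRing C_NormedModule eventually _ u l l'). Qed.

Notation is_Cseries := (@is_series C_AbsRing C_NormedModule).
Notation Csum := (@sum_n C_NormedModule).

Lemma is_Cseries_unique (a : nat -> C) (l l' : C) :
  is_Cseries a l -> is_Cseries a l' -> l = l'.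
Proof. apply Clim_unique. Qed.

Lemma CSeries_unique (a : nat -> C) (l : C) : is_Cseries a l -> CSeries a = l.
Proof.
  intros H. unfold CSeries.
  apply (@iota_unique C_AbsRing C_CompleteNormedModule); [ | exact H].
  intros y Hy. exact (is_Cseries_unique _ _ _ Hy H).
Qed.

Lemma Cseries_dominated (a : nat -> C) (b : nat -> R) :
  (forall n, Cmod (a n) <= b n) -> ex_series b -> exists l, is_Cseries a l.
Proof.
  intros H Hb.
  destruct (@ex_series_le C_AbsRing C_CompleteNormedModule a b H Hb) as [l Hl].
  exists l. exact Hl.
Qed.

Lemma sum_n_S_R (b : nat -> R) (n : nat) : sum_n b (S n) = sum_n b n + b (S n).
Proof. exact (sum_Sn b n). Qed.

Lemma sum_n_nonneg_incr (b : nat -> R) (n m : nat) :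
  (forall k, 0 <= b k) -> (n <= m)%nat -> sum_n b n <= sum_n b m.
Proof.
  intros Hb. induction 1 as [|m Hm IH]; [lra|].
  rewrite sum_n_S_R. specialize (Hb (S m)). lra.
Qed.

Lemma sum_n_le_series (b : nat -> R) (l : R) (n : nat) :
  (forall k, 0 <= b k) -> is_series b l -> sum_n b n <= l.
Proof.
  intros Hb Hl.
  apply (is_lim_seq_le_loc (fun _ => sum_n b n) (sum_n b) (sum_n b n) l).
  - exists n. intros m Hm. now apply sum_n_nonneg_incr.
  - apply is_lim_seq_const.
  - exact Hl.
Qed.

Lemma ex_series_bounded_nonneg (b : nat -> R) (B : R) :
  (forall k, 0 <= b k) -> (forall n, sum_n b n <= B) -> ex_series b.
Proof.
  intros Hb HB.
  destruct (ex_finite_lim_seq_incr (sum_n b) B) as [l Hl].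
  - intros n. apply sum_n_nonneg_incr; [exact Hb | lia].
  - exact HB.
  - exists l. exact Hl.
Qed.

Lemma norm_sum_n {K : AbsRing} {V : NormedModule K} (a : nat -> V) (b : nat -> R) (n : nat) :
  (forall k, (k <= n)%nat -> norm (a k) <= b k) -> norm (sum_n a n) <= sum_n b n.
Proof.
  induction n as [|n IH]; intros H.
  - rewrite !sum_O. apply H. lia.
  - rewrite !sum_Sn. eapply Rle_trans; [apply norm_triangle|].
    apply Rplus_le_compat; [apply IH; intros; apply H; lia | apply H; lia].
Qed.

Lemma norm_series_le {K : AbsRing} {V : NormedModule K} (a : nat -> V) (b : nat -> R) (l : V) (lb : R) :
  (forall k, norm (a k) <= b k) -> is_series a l -> is_series b lb -> norm l <= lb.
Proof.
  intros H Ha Hb.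
  assert (Hlim : is_lim_seq (fun n => norm (sum_n a n)) (norm l)).
  { eapply filterlim_comp; [exact Ha | apply filterlim_norm]. }
  apply (is_lim_seq_le _ _ (norm l) lb (fun n => norm_sum_n a b n (fun k _ => H k)) Hlim Hb).
Qed.

Lemma plus_minus_cancel {K : AbsRing} {V : NormedModule K} (x y : V) : plus (minus x y) y = x.
Proof. unfold minus. now rewrite <- plus_assoc, plus_opp_l, plus_zero_r. Qed.

Lemma minus_telescope {K : AbsRing} {V : NormedModule K} (x y z t : V) :
  minus x t = plus (plus (minus x y) (minus y z)) (opp (minus t z)).
Proof.
  rewrite opp_minus. unfold minus.
  rewrite <- (plus_assoc x).
  rewrite (plus_assoc (opp y) y), plus_opp_l, plus_zero_l.
  now rewrite <- plus_assoc, (plus_assoc (opp z)), plus_opp_l, plus_zero_l.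
Qed.

Lemma norm_series_tail {K : AbsRing} {V : NormedModule K} (a : nat -> V) (b : nat -> R) (l : V) (lb : R) n :
  (forall k, norm (a k) <= b k) -> is_series a l -> is_series b lb ->
  norm (minus l (sum_n a n)) <= lb - sum_n b n.
Proof.
  intros H Ha Hb.
  apply (norm_series_le (fun k => a (S n + k)%nat) (fun k => b (S n + k)%nat)).
  - intros k. apply H.
  - apply is_series_incr_n; [lia|].
    change (Init.Nat.pred (S n)) with n.
    match goal with |- is_series _ ?x => replace x with l; [exact Ha|] end.
    symmetry. apply plus_minus_cancel.
  - apply (is_series_incr_n b (S n)); [lia|].
    change (Init.Nat.pred (S n)) with n.
    match goal with |- is_series _ ?x => replace x with lb; [exact Hb|] end.
    change (@eq R lb (lb - sum_n b n + sum_n b n)). ring.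
Qed.

(** Dominated convergence for series. Cut at an [N] where the tail of [b] is below eps/4: the head
    of [N + 1] terms converges term by term, and the tails of [a m] and of [l] are both controlled
    by that of [b], since the limits inherit the bound. *)
Lemma tannery {K : AbsRing} {V : NormedModule K}
  (a : nat -> nat -> V) (b : nat -> R) (l : nat -> V) (S : nat -> V) (S0 : V) :
  (forall m n, norm (a m n) <= b n) -> ex_series b ->
  (forall n, filterlim (fun m => a m n) eventually (locally (l n))) ->
  (forall m, is_series (a m) (S m)) -> is_series l S0 ->
  filterlim S eventually (locally S0).
Proof.
  intros Hab [lb Hb] Hl HS HS0.
  assert (Hlb : forall n, norm (l n) <= b n).
  { intros n.
    apply (is_lim_seq_le (fun m => norm (a m n)) (fun _ => b n) (norm (l n)) (b n)).
    - intros m. apply Hab.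
    - eapply filterlim_comp; [apply Hl | apply filterlim_norm].
    - apply is_lim_seq_const. }
  apply filterlim_locally_ball_norm. intros eps.
  assert (He : 0 < eps / 4) by (pose proof (cond_pos eps); lra).
  destruct (proj1 (filterlim_locally_ball_norm (sum_n b) lb) Hb (mkposreal _ He)) as [N HN].
  specialize (HN N (Nat.le_refl N)).   assert (Htail : lb - sum_n b N < eps / 4).
  { change (Rabs (sum_n b N - lb) < eps / 4) in HN. rewrite Rabs_minus_sym in HN.
    apply Rle_lt_trans with (2 := HN), Rle_abs. }
  assert (Hfin : filterlim (fun m => sum_n (a m) N) eventually (locally (sum_n l N))).
  { clear -Hl. induction N as [|N IH].
    - rewrite sum_O. apply (filterlim_ext (fun m => a m 0%nat)); [|apply Hl].
      intros; now rewrite sum_O.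
    - rewrite sum_Sn.
      apply (filterlim_ext (fun m => plus (sum_n (a m) N) (a m (Datatypes.S N)))).
      + intros; now rewrite sum_Sn.
      + eapply filterlim_comp_2; [exact IH | apply Hl | apply filterlim_plus]. }
  destruct (proj1 (filterlim_locally_ball_norm _ _) Hfin (mkposreal _ He)) as [M HM].
  exists M. intros m Hm. specialize (HM m Hm).
  change (norm (minus (sum_n (a m) N) (sum_n l N)) < eps / 4) in HM.
  pose proof (Rle_lt_trans _ _ _ (norm_series_tail (a m) b (S m) lb N (Hab m) (HS m) Hb) Htail) as T1.
  pose proof (Rle_lt_trans _ _ _ (norm_series_tail l b S0 lb N Hlb HS0 Hb) Htail) as T2.
  change (norm (minus (S m) S0) < eps).
  rewrite (minus_telescope (S m) (sum_n (a m) N) (sum_n l N) S0).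
  eapply Rle_lt_trans; [apply norm_triangle|]. rewrite norm_opp.
  eapply Rle_lt_trans; [apply Rplus_le_compat_r, norm_triangle|].
  apply Rlt_trans with (eps / 4 + eps / 4 + eps / 4); [|pose proof (cond_pos eps); lra].
  apply Rplus_lt_compat; [apply Rplus_lt_compat; [exact T1 | exact HM] | exact T2].
Qed.

Lemma sum_n_is_series {K : AbsRing} {V : NormedModule K} (a : nat -> nat -> V) (r : nat -> V) J :
  (forall j, is_series (fun k => a k j) (r j)) ->
  is_series (fun k => sum_n (a k) J) (sum_n r J).
Proof.
  intros H. induction J as [|J IH].
  - rewrite sum_O. apply (is_series_ext (fun k => a k 0%nat)); [|apply H].
    intros; now rewrite sum_O.
  - rewrite sum_Sn. apply (is_series_ext (fun k => plus (sum_n (a k) J) (a k (S J)))).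
    + intros; now rewrite sum_Sn.
    + now apply is_series_plus.
Qed.

(** Interchange of summations, as [tannery] with the column cut-off [J] as parameter; only the
    partial row sums have to be dominated. *)
Lemma double_series {K : AbsRing} {V : NormedModule K}
  (a : nat -> nat -> V) (A : nat -> R) (R C : nat -> V) (T : V) :
  (forall k J, norm (sum_n (a k) J) <= A k) -> ex_series A ->
  (forall k, is_series (a k) (R k)) -> is_series R T ->
  (forall j, is_series (fun k => a k j) (C j)) ->
  is_series C T.
Proof.
  intros HA HAs HR HT HC.
  refine (tannery (fun J k => sum_n (a k) J) A R (sum_n C) T _ HAs _ _ HT).
  - intros J k. apply HA.
  - intros k. apply HR.
  - intros J. now apply sum_n_is_series.
Qed.

(** * The complex exponential and derivatives along real paths *)

Lemma Cexp_plus (z w : C) : Cexp (z + w)%C = (Cexp z * Cexp w)%C.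
Proof.
  destruct z as [a b], w as [c d]. unfold Cexp. cbn.
  rewrite exp_plus, cos_plus, sin_plus. unfold Cmult. cbn. f_equal; ring.
Qed.

Lemma Cexp_0 : Cexp 0 = 1.
Proof. unfold Cexp. cbn. rewrite exp_0, cos_0, sin_0. unfold RtoC. f_equal; ring. Qed.

Lemma Cmod_Cexp (z : C) : Cmod (Cexp z) = exp (Re z).
Proof.
  unfold Cexp, Cmod. cbn [fst snd].
  replace ((exp (Re z) * cos (Im z)) ^ 2 + (exp (Re z) * sin (Im z)) ^ 2)
    with (exp (Re z) ^ 2 * (Rsqr (sin (Im z)) + Rsqr (cos (Im z)))) by (unfold Rsqr; ring).
  rewrite sin2_cos2, Rmult_1_r. apply sqrt_pow2, Rlt_le, exp_pos.
Qed.

Lemma Cexp_neq_0 (z : C) : Cexp z <> 0.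
Proof. apply Cmod_gt_0. rewrite Cmod_Cexp. apply exp_pos. Qed.

Lemma Cexp_RtoC (x : R) : Cexp (RtoC x) = RtoC (exp x).
Proof. unfold Cexp. cbn. rewrite cos_0, sin_0. unfold RtoC. f_equal; ring. Qed.

Lemma Cexp_opp (z : C) : Cexp (- z)%C = (/ Cexp z)%C.
Proof.
  assert (H : (Cexp (- z) * Cexp z = 1)%C).
  { rewrite <- Cexp_plus. replace (- z + z)%C with (RtoC 0) by ring. apply Cexp_0. }
  rewrite <- (Cmult_1_l (/ Cexp z)%C), <- H. field. apply Cexp_neq_0.
Qed.

Lemma is_derive_eq {K : AbsRing} {V : NormedModule K} (f : K -> V) t (l l' : V) :
  l = l' -> is_derive f t l -> is_derive f t l'.
Proof. now intros ->. Qed.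

(** Componentwise, so that product and chain rules reduce to real derivatives although the factors
    and scalars are complex. *)
Definition Cderive (f : R -> C) (t : R) (l : C) : Prop :=
  is_derive (fun u => Re (f u)) t (Re l) /\ is_derive (fun u => Im (f u)) t (Im l).

Lemma Cderive_is_derive (f : R -> C) (t : R) (l : C) :
  Cderive f t l -> @is_derive R_AbsRing C_R_NormedModule f t l.
Proof.
  intros [H1 H2].
  apply (@is_derive_ext R_AbsRing C_R_NormedModule
    (fun u => plus (scal (Re (f u)) ((1, 0) : C_R_NormedModule)) (scal (Im (f u)) ((0, 1) : C_R_NormedModule)))).
  - intros u. destruct (f u) as [a b]. unfold plus, scal. cbn. unfold prod_plus, prod_scal.
    cbn. unfold scal, plus; cbn. unfold mult; cbn. f_equal; ring.
  - replace l with (plus (scal (Re l) ((1, 0) : C_R_NormedModule)) (scal (Im l) ((0, 1) : C_R_NormedModule))).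
    + apply @is_derive_plus; apply @is_derive_scal_l; assumption.
    + destruct l as [a b]. unfold plus, scal. cbn. unfold prod_plus, prod_scal.
    cbn. unfold scal, plus; cbn. unfold mult; cbn. f_equal; ring.
Qed.

Lemma Cderive_continuous (f : R -> C) (t : R) (l : C) :
  Cderive f t l -> @continuous R_UniformSpace C_UniformSpace f t.
Proof.
  intros H. apply (@ex_derive_continuous R_AbsRing C_R_NormedModule f t).
  exists l. now apply Cderive_is_derive.
Qed.

Lemma Cderive_ext_val (f : R -> C) t l l' : l = l' -> Cderive f t l -> Cderive f t l'.
Proof. now intros ->. Qed.

Lemma Cderive_const (c : C) t : Cderive (fun _ => c) t 0.
Proof. split; apply @is_derive_const. Qed.

Lemma Cderive_plus (f g : R -> C) t l m :
  Cderive f t l -> Cderive g t m -> Cderive (fun u => f u + g u)%C t (l + m)%C.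
Proof.
  intros [H1 H2] [H3 H4]. split.
  - exact (@is_derive_plus R_AbsRing R_NormedModule _ _ t _ _ H1 H3).
  - exact (@is_derive_plus R_AbsRing R_NormedModule _ _ t _ _ H2 H4).
Qed.

Lemma Cderive_mult (f g : R -> C) t l m :
  Cderive f t l -> Cderive g t m -> Cderive (fun u => f u * g u)%C t (l * g t + f t * m)%C.
Proof.
  intros [H1 H2] [H3 H4].
  pose proof (is_derive_mult _ _ t _ _ H1 H3 Rmult_comm) as A1.
  pose proof (is_derive_mult _ _ t _ _ H2 H4 Rmult_comm) as A2.
  pose proof (is_derive_mult _ _ t _ _ H1 H4 Rmult_comm) as A3.
  pose proof (is_derive_mult _ _ t _ _ H2 H3 Rmult_comm) as A4.
  split.
  - eapply is_derive_ext; [|eapply is_derive_eq;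
      [|exact (@is_derive_minus R_AbsRing R_NormedModule _ _ t _ _ A1 A2)]].
    + intros u. reflexivity.
    + cbn. unfold minus, plus, opp, mult; cbn. unfold Re, Im. ring.
  - eapply is_derive_ext; [|eapply is_derive_eq;
      [|exact (@is_derive_plus R_AbsRing R_NormedModule _ _ t _ _ A3 A4)]].
    + intros u. reflexivity.
    + cbn. unfold minus, plus, opp, mult; cbn. unfold Re, Im. ring.
Qed.

Lemma Cderive_opp (f : R -> C) t l : Cderive f t l -> Cderive (fun u => - f u)%C t (- l)%C.
Proof.
  intros [H1 H2]. split.
  - exact (@is_derive_opp R_AbsRing R_NormedModule _ t _ H1).
  - exact (@is_derive_opp R_AbsRing R_NormedModule _ t _ H2).
Qed.

Lemma Cderive_RtoC (f : R -> R) (t l : R) : is_derive f t l -> Cderive (fun u => RtoC (f u)) t (RtoC l).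
Proof. intros H. split; [exact H | exact (@is_derive_const R_AbsRing R_NormedModule 0 t)]. Qed.

Lemma Cderive_Cexp (f : R -> C) t l :
  Cderive f t l -> Cderive (fun u => Cexp (f u)) t (l * Cexp (f t))%C.
Proof.
  intros [H1 H2]. unfold Cexp. split; cbn [Re Im fst snd].
  - evar_last.
    + apply (is_derive_mult (fun u => exp (Re (f u))) (fun u => cos (Im (f u))));
        [ apply (is_derive_comp exp); [apply is_derive_exp | exact H1]
        | apply (is_derive_comp cos); [apply is_derive_cos | exact H2]
        | apply Rmult_comm ].
    + cbn. unfold minus, plus, opp, mult, scal; cbn. unfold mult; cbn. unfold Re, Im. ring.
  - evar_last.
    + apply (is_derive_mult (fun u => exp (Re (f u))) (fun u => sin (Im (f u))));
        [ apply (is_derive_comp exp); [apply is_derive_exp | exact H1]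
        | apply (is_derive_comp sin); [apply is_derive_sin | exact H2]
        | apply Rmult_comm ].
    + cbn. unfold minus, plus, opp, mult, scal; cbn. unfold mult; cbn. unfold Re, Im. ring.
Qed.

(* Project onto the direction of [f b - f a]: the real function so obtained grows at most as fast as [g]. *)
Lemma Cmean_value (f f' : R -> C) (g g' : R -> R) (a b : R) :
  a <= b ->
  (forall t, a <= t <= b -> Cderive f t (f' t)) ->
  (forall t, a <= t <= b -> is_derive g t (g' t)) ->
  (forall t, a <= t <= b -> Cmod (f' t) <= g' t) ->
  Cmod (f b - f a)%C <= g b - g a.
Proof.
  intros Hab Hf Hg Hle.
  destruct (Req_dec (Cmod (f b - f a)%C) 0) as [H0|H0].
  - rewrite H0. destruct Hab as [Hab|Hab]; [|subst b; lra].
    destruct (MVT_gen g a b g') as [c [Hc E]].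
    + intros x Hx. rewrite Rmin_left, Rmax_right in Hx by lra. apply Hg. lra.
    + intros x Hx. rewrite Rmin_left, Rmax_right in Hx by lra.
      apply continuity_pt_filterlim, (ex_derive_continuous g). exists (g' x). apply Hg. lra.
    + rewrite Rmin_left, Rmax_right in Hc by lra. rewrite E.
      apply Rmult_le_pos; [|lra]. apply Rle_trans with (2 := Hle c Hc). apply Cmod_ge_0.
  - set (D := (f b - f a)%C) in *.
    set (th := (Cconj D / RtoC (Cmod D))%C).
    assert (HD : 0 < Cmod D) by (pose proof (Cmod_ge_0 D); lra).
    assert (Hth : Cmod th = 1).
    { unfold th. rewrite Cmod_div.
      - rewrite Cmod_conj, Cmod_R, Rabs_pos_eq by lra. field. lra.
      - intros E. apply RtoC_inj in E. lra. }
    assert (HthD : (th * D)%C = RtoC (Cmod D)).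
    { unfold th. replace (Cconj D / Cmod D * D)%C with (D * Cconj D / Cmod D)%C.
      - rewrite <- Cmod2_conj, RtoC_pow. field. intros E. apply RtoC_inj in E. lra.
      - field. intros E. apply RtoC_inj in E. lra. }
    set (h := fun t => Re (th * f t)%C - g t).
    assert (Hh : forall t, a <= t <= b -> is_derive h t (Re (th * f' t)%C - g' t)).
    { intros t Ht. apply @is_derive_minus; [|now apply Hg].
      pose proof (Cderive_mult _ _ t _ _ (Cderive_const th t) (Hf t Ht)) as [K _].
      eapply is_derive_eq; [|exact K]. cbn. unfold Re, Im. cbn. ring. }
    assert (Hmain : h b <= h a).
    { destruct Hab as [Hab|Hab]; [|subst b; lra].
      destruct (MVT_gen h a b (fun t => Re (th * f' t)%C - g' t)) as [c [Hc E]].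
      + intros x Hx. rewrite Rmin_left, Rmax_right in Hx by lra. apply Hh. lra.
      + intros x Hx. rewrite Rmin_left, Rmax_right in Hx by lra.
        apply continuity_pt_filterlim, (ex_derive_continuous h). eexists. apply Hh. lra.
      + rewrite Rmin_left, Rmax_right in Hc by lra.
        enough (0 <= - ((Re (th * f' c)%C - g' c) * (b - a))) by lra.
        rewrite Ropp_mult_distr_l. apply Rmult_le_pos; [|lra].
        pose proof (re_le_Cmod (th * f' c)%C) as K. rewrite Cmod_mult, Hth, Rmult_1_l in K.
        pose proof (Rle_abs (Re (th * f' c)%C)). specialize (Hle c Hc). lra. }
    unfold h in Hmain.
    assert (E : Re (th * f b)%C - Re (th * f a)%C = Cmod D).
    { rewrite <- (re_RtoC (Cmod D)), <- HthD. unfold D. unfold Re. cbn. ring. }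
    lra.
Qed.

Lemma RtoC_neq_0 (x : R) : x <> 0 -> RtoC x <> 0.
Proof. intros H E. apply H. now apply RtoC_inj. Qed.

(** Only degrees below [n] occur, so that differentiating along a ray lowers the index by exactly
    one. *)
Fixpoint Cexp_taylor (n : nat) (z : C) : C :=
  match n with
  | O => 0
  | S k => (Cexp_taylor k z + z ^ k / RtoC (INR (fact k)))%C
  end.

Lemma Cderive_pow_scal (z : C) (k : nat) (t : R) :
  Cderive (fun u => (RtoC u * z) ^ (S k) / RtoC (INR (fact (S k))))%C t
    (z * ((RtoC t * z) ^ k / RtoC (INR (fact k))))%C.
Proof.
  assert (HF : forall n, RtoC (INR (fact n)) <> 0).
  { intros n. apply RtoC_neq_0, INR_fact_neq_0. }
  assert (Hp : forall n, Cderive (fun u => (RtoC u * z) ^ (S n))%C t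
     (RtoC (INR (S n)) * z * (RtoC t * z) ^ n)%C).
  { induction n as [|n IH].
    - eapply Cderive_ext_val; [|exact (Cderive_mult _ _ t _ _ (Cderive_mult _ _ t _ _
        (Cderive_RtoC _ t 1 (is_derive_id t)) (Cderive_const z t)) (Cderive_const 1 t))].
      cbn. ring.
    - eapply Cderive_ext_val; [|exact (Cderive_mult _ _ t _ _ (Cderive_mult _ _ t _ _
        (Cderive_RtoC _ t 1 (is_derive_id t)) (Cderive_const z t)) IH)].
      rewrite (S_INR (S n)), RtoC_plus. rewrite !Cpow_S. ring. }
  eapply Cderive_ext_val; [|exact (Cderive_mult _ _ t _ _ (Hp k) (Cderive_const _ t))].
  change (fact (S k)) with (S k * fact k)%nat. rewrite mult_INR, RtoC_mult.
  field. split; [apply HF | apply RtoC_neq_0, not_0_INR; lia].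
Qed.

Lemma Cderive_taylor (z : C) (n : nat) (t : R) :
  Cderive (fun u => Cexp_taylor (S n) (RtoC u * z)) t (z * Cexp_taylor n (RtoC t * z))%C.
Proof.
  induction n as [|n IH].
  - eapply Cderive_ext_val; [|apply (Cderive_const (0 + 1 / 1)%C)]. cbn. ring.
  - eapply Cderive_ext_val; [|exact (Cderive_plus _ _ t _ _ IH (Cderive_pow_scal z n t))].
    cbn [Cexp_taylor]. ring.
Qed.

Lemma is_derive_monomial (c : R) (n : nat) (t : R) :
  is_derive (fun u => c * u ^ (S n)) t (c * (INR (S n) * t ^ n)).
Proof.
  apply is_derive_scal.
  replace (INR (S n) * t ^ n) with (INR (S n) * 1 * t ^ (Init.Nat.pred (S n)))
    by (change (Init.Nat.pred (S n)) with n; ring).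
  exact (is_derive_pow (fun u => u) (S n) t 1 (is_derive_id t)).
Qed.

(** Along the ray [u * z] the remainder of index [n + 1] has derivative [z] times the remainder of
    index [n]. The mean value inequality against [c * u ^ (n + 1)] therefore carries the bound from
    [n] to [n + 1]; the base case is Re z <= |z|. *)
Lemma Cexp_taylor_remainder (n : nat) (z : C) :
  Cmod (Cexp z - Cexp_taylor n z)%C <= Cmod z ^ n / INR (fact n) * exp (Cmod z).
Proof.
  revert z. induction n as [|n IH]; intros z.
  - cbn. replace (Cexp z - 0)%C with (Cexp z) by ring. rewrite Cmod_Cexp.
    replace (1 / 1 * exp (Cmod z)) with (exp (Cmod z)) by field.
    destruct (Rle_lt_or_eq_dec (Re z) (Cmod z)) as [H|H].
    + apply Rle_trans with (Rabs (Re z)); [apply Rle_abs | apply re_le_Cmod].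
    + now apply Rlt_le, exp_increasing.
    + rewrite H. lra.
  - set (f := fun u : R => (Cexp (RtoC u * z) + - Cexp_taylor (S n) (RtoC u * z))%C).
    set (c := Cmod z ^ (S n) / INR (fact (S n)) * exp (Cmod z)).
    assert (HF := INR_fact_lt_0 n).
    assert (Hn : 0 < INR (S n)) by (apply lt_0_INR; lia).
    assert (H : Cmod (f 1 - f 0)%C <= c * 1 ^ (S n) - c * 0 ^ (S n)).
    { apply (Cmean_value f (fun t => z * Cexp (RtoC t * z) + - (z * Cexp_taylor n (RtoC t * z)))%C
        (fun t => c * t ^ (S n)) (fun t => c * (INR (S n) * t ^ n))); [lra| | |].
      - intros t _. apply Cderive_plus.
        + eapply Cderive_ext_val; [|exact (Cderive_Cexp _ t _ (Cderive_mult _ _ t _ _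
            (Cderive_RtoC _ t 1 (is_derive_id t)) (Cderive_const z t)))]. cbv beta; ring.
        + apply Cderive_opp, Cderive_taylor.
      - intros t _. apply is_derive_monomial.
      - intros t Ht.
        replace (z * Cexp (t * z) + - (z * Cexp_taylor n (t * z)))%C
          with (z * (Cexp (t * z) - Cexp_taylor n (t * z)))%C by ring.
        rewrite Cmod_mult.
        eapply Rle_trans; [apply Rmult_le_compat_l; [apply Cmod_ge_0 | apply IH]|].
        rewrite Cmod_mult, Cmod_R, Rabs_pos_eq by lra.
        unfold c. change (fact (S n)) with (S n * fact n)%nat. rewrite mult_INR, Rpow_mult_distr.
        replace (Cmod z * (t ^ n * Cmod z ^ n / INR (fact n) * exp (t * Cmod z)))
          with (t ^ n * Cmod z ^ (S n) / INR (fact n) * exp (t * Cmod z)) by (cbn; field; lra).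
        replace (Cmod z ^ S n / (INR (S n) * INR (fact n)) * exp (Cmod z) * (INR (S n) * t ^ n))
          with (t ^ n * Cmod z ^ (S n) / INR (fact n) * exp (Cmod z)) by (field; lra).
        apply Rmult_le_compat_l.
        + apply Rmult_le_pos; [|left; now apply Rinv_0_lt_compat].
          apply Rmult_le_pos; apply pow_le; [lra | apply Cmod_ge_0].
        + destruct (Rle_lt_or_eq_dec (t * Cmod z) (Cmod z)) as [H|H].
          * pose proof (Cmod_ge_0 z). nra.
          * now apply Rlt_le, exp_increasing.
          * rewrite H. lra. }
    rewrite pow1, pow_i in H by lia.
    replace (c * 1 - c * 0) with c in H by ring.
    unfold f in H. rewrite !Cmult_1_l, Cmult_0_l, Cexp_0 in H.
    assert (T0 : Cexp_taylor (S n) 0 = 1).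
    { clear. induction n as [|n IH]; [cbn; field|].
      cbn [Cexp_taylor] in *. rewrite IH. rewrite (Cpow_S _ n).
      field. apply RtoC_neq_0, INR_fact_neq_0. }
    rewrite T0 in H.
    replace (Cexp z - Cexp_taylor (S n) z)%C with (Cexp z + - Cexp_taylor (S n) z - (1 + - (1)))%C by ring.
    exact H.
Qed.

Lemma is_series_exp (x : R) : is_series (fun n => x ^ n / INR (fact n)) (exp x).
Proof.
  eapply is_series_ext; [|exact (is_exp_Reals x)].
  intros n. cbn. unfold scal; cbn. unfold mult; cbn. rewrite pow_n_pow. unfold Rdiv. ring.
Qed.

Lemma is_Cseries_exp (z : C) : is_Cseries (fun n => z ^ n / RtoC (INR (fact n)))%C (Cexp z).
Proof.
  unfold is_series. apply Clim_eps; [apply eventually_filter|].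
  assert (H : is_lim_seq (fun n => Cmod z ^ n / INR (fact n) * exp (Cmod z)) 0).
  { replace (Finite 0) with (Rbar_mult 0 (exp (Cmod z))) by (cbn; f_equal; ring).
    apply is_lim_seq_scal_r. apply ex_series_lim_0. eexists. apply is_series_exp. }
  intros eps Heps.
  destruct (proj2 (is_lim_seq_spec _ _) H (mkposreal _ Heps)) as [N HN]. cbn beta iota in HN.
  exists N. intros n Hn.
  assert (E : forall k, Csum (fun n => z ^ n / RtoC (INR (fact n)))%C k = Cexp_taylor (S k) z).
  { clear. induction k as [|k IH]; [rewrite sum_O; cbn; ring|].
    rewrite sum_Sn, IH. reflexivity. }
  rewrite E.
  replace (Cexp_taylor (S n) z - Cexp z)%C with (- (Cexp z - Cexp_taylor (S n) z))%C by ring.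
  rewrite Cmod_opp.
  eapply Rle_lt_trans; [apply Cexp_taylor_remainder|].
  specialize (HN (S n) (Nat.le_trans _ _ _ Hn (Nat.le_succ_diag_r n))).
  rewrite Rminus_0_r in HN. eapply Rle_lt_trans; [apply Rle_abs | exact HN].
Qed.

(** * Analytic functions of one complex variable *)

Lemma pow_n_Cpow (w : C) (k : nat) : @pow_n C_Ring w k = (w ^ k)%C.
Proof. induction k as [|k IH]; [reflexivity|]. cbn [pow_n]. now rewrite IH. Qed.

Lemma is_series_shift {K : AbsRing} {V : NormedModule K} (u : nat -> V) (l : V) (k : nat) :
  (forall j, (j < k)%nat -> u j = zero) ->
  is_series u l <-> is_series (fun j => u (k + j)%nat) l.
Proof.
  revert u. induction k as [|k IH]; intros u H; [reflexivity|].
  assert (E : is_series u l <-> is_series (fun j => u (S j)) l).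
  { split; intros Hl.
    - apply is_series_incr_1. rewrite H by lia.
      match goal with |- is_series _ ?x => replace x with l; [exact Hl|] end.
      symmetry. apply plus_zero_r.
    - apply is_series_decr_1. rewrite H by lia.
      match goal with |- is_series _ ?x => replace x with l; [exact Hl|] end.
      symmetry. apply (minus_zero_r l). }
  rewrite E, (IH (fun j => u (S j))); [reflexivity|].
  intros j Hj. apply H. lia.
Qed.

Lemma is_series_finite {K : AbsRing} {V : NormedModule K} (u : nat -> V) (k : nat) :
  (forall j, (k < j)%nat -> u j = zero) -> is_series u (sum_n u k).
Proof.
  intros H. apply filterlim_ext_loc with (f := fun _ => sum_n u k); [|apply filterlim_const].
  exists k. intros n Hn. induction Hn as [|n Hn IH]; [reflexivity|].
  rewrite sum_Sn, <- IH, H by lia. now rewrite plus_zero_r.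
Qed.

Lemma is_Cseries_scal (c : C) (u : nat -> C) (l : C) :
  is_Cseries u l -> is_Cseries (fun k => c * u k)%C (c * l)%C.
Proof. apply (@is_series_scal C_AbsRing C_NormedModule c u l). Qed.

Lemma is_Cseries_minus (u v : nat -> C) (l m : C) :
  is_Cseries u l -> is_Cseries v m -> is_Cseries (fun k => u k - v k)%C (l - m)%C.
Proof. apply (@is_series_minus C_AbsRing C_NormedModule u v l m). Qed.

Lemma is_Cseries_ext (u v : nat -> C) (l : C) :
  (forall n, u n = v n) -> is_Cseries u l -> is_Cseries v l.
Proof. apply is_series_ext. Qed.

Lemma analytic_of_expansion (f : C -> C) (s0 : C) (a : nat -> C) (r : R) :
  0 < r ->
  (forall w, Cmod w < r -> is_Cseries (fun k => a k * w ^ k)%C (f (s0 + w)%C)) ->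
  C_analytic_at f s0.
Proof.
  intros Hr H. exists a, r. split; [exact Hr|]. intros s Hs.
  unfold is_pseries.
  apply (is_Cseries_ext (fun k => a k * (s - s0) ^ k)%C).
  - intros n. rewrite <- pow_n_Cpow. exact (Cmult_comm _ _).
  - specialize (H _ Hs). now replace (s0 + (s - s0))%C with s in H by ring.
Qed.

Lemma Cterm_bounded (u : nat -> C) (l : C) :
  is_Cseries u l -> exists M, forall n, Cmod (u n) <= M.
Proof.
  intros H.
  assert (H0 : forall eps : R, 0 < eps -> eventually (fun n => Cmod (Csum u n - l)%C < eps)).
  { apply Clim_eps; [apply eventually_filter | exact H]. }
  destruct (H0 1 Rlt_0_1) as [N HN].
  assert (HF : forall n, exists M, 0 <= M /\ forall k, (k <= n)%nat -> Cmod (u k) <= M).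
  { induction n as [|n [M [HM IH]]].
    - exists (Cmod (u 0%nat)). split; [apply Cmod_ge_0|]. intros k Hk. replace k with 0%nat by lia. lra.
    - exists (Rmax M (Cmod (u (S n)))). split; [apply Rle_trans with (1 := HM), Rmax_l|].
      intros k Hk. destruct (Nat.eq_dec k (S n)) as [->|Hne]; [apply Rmax_r|].
      apply Rle_trans with M; [apply IH; lia | apply Rmax_l]. }
  destruct (HF N) as [M [HM HFN]].
  exists (M + 2). intros n. destruct (le_lt_dec n N) as [Hn|Hn].
  - specialize (HFN n Hn). lra.
  - destruct n as [|n]; [lia|].
    assert (E : u (S n) = ((Csum u (S n) - l) + - (Csum u n - l))%C).
    { rewrite sum_Sn. change plus with Cplus. ring. }
    rewrite E. eapply Rle_trans; [apply Cmod_triangle|]. rewrite Cmod_opp.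
    pose proof (HN (S n) ltac:(lia)). pose proof (HN n ltac:(lia)). lra.
Qed.

(** Abel's lemma: at radius r/2 the terms are bounded because the series converges there, so at
    radius r/4 they are dominated by a geometric series of ratio 1/2. This buys absolute convergence
    on a closed disc. *)
Lemma analytic_expansion (f : C -> C) (s0 : C) :
  C_analytic_at f s0 ->
  exists (a : nat -> C) (r : R), 0 < r /\ ex_series (fun k => Cmod (a k) * r ^ k) /\
    forall w, Cmod w <= r -> is_Cseries (fun k => a k * w ^ k)%C (f (s0 + w)%C).
Proof.
  intros [a [r [Hr H]]].
  assert (H' : forall w, Cmod w < r -> is_Cseries (fun k => a k * w ^ k)%C (f (s0 + w)%C)).
  { intros w Hw. specialize (H (s0 + w)%C).
    replace (s0 + w - s0)%C with w in H by ring. specialize (H Hw). unfold is_pseries in H.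
    revert H. apply is_Cseries_ext. intros n. rewrite <- pow_n_Cpow. exact (Cmult_comm _ _). }
  exists a, (r / 4). split; [lra|]. split.
  - destruct (Cterm_bounded _ _ (H' (RtoC (r / 2)) ltac:(rewrite Cmod_R, Rabs_pos_eq; lra))) as [M HM].
    apply (@ex_series_le R_AbsRing R_CompleteNormedModule _ (fun k => (1 / 2) ^ k * M)).
    + intros k. change norm with Rabs.
      rewrite Rabs_pos_eq by (apply Rmult_le_pos; [apply Cmod_ge_0 | apply pow_le; lra]).
      specialize (HM k). rewrite Cmod_mult, Cmod_pow, Cmod_R, Rabs_pos_eq in HM by lra.
      replace (r / 4) with (1 / 2 * (r / 2)) by field. rewrite Rpow_mult_distr.
      assert (0 < (1 / 2) ^ k) by (apply pow_lt; lra). nra.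
    + apply ex_series_scal_r, ex_series_geom. rewrite Rabs_pos_eq; lra.
  - intros w Hw. apply H'. lra.
Qed.

Lemma analytic_minus (f g : C -> C) (s0 : C) :
  C_analytic_at f s0 -> C_analytic_at g s0 -> C_analytic_at (fun s => f s - g s)%C s0.
Proof.
  intros Hf Hg.
  destruct (analytic_expansion _ _ Hf) as [a [r [Hr [_ Ha]]]].
  destruct (analytic_expansion _ _ Hg) as [b [q [Hq [_ Hb]]]].
  apply (analytic_of_expansion _ _ (fun k => a k - b k)%C (Rmin r q)); [now apply Rmin_pos|].
  intros w Hw.
  pose proof (Rmin_l r q). pose proof (Rmin_r r q).
  apply (is_Cseries_ext (fun k => a k * w ^ k - b k * w ^ k)%C); [intros; ring|].
  apply is_Cseries_minus; [apply Ha | apply Hb]; lra.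
Qed.

Lemma Csum_mult_r (u : nat -> C) (c : C) n : Csum (fun k => u k * c)%C n = (Csum u n * c)%C.
Proof. apply (@sum_n_mult_r C_Ring c u n). Qed.

(* The Cauchy product, as a double series whose (i, k) entry is the contribution of a_i to the coefficient of w^k. *)
Lemma analytic_mult (f g : C -> C) (s0 : C) :
  C_analytic_at f s0 -> C_analytic_at g s0 -> C_analytic_at (fun s => f s * g s)%C s0.
Proof.
  intros Hf Hg.
  destruct (analytic_expansion _ _ Hf) as [a [r [Hr [[la Ala] Ha]]]].
  destruct (analytic_expansion _ _ Hg) as [b [q [Hq [[lb Alb] Hb]]]].
  apply (analytic_of_expansion _ _ (fun k => Csum (fun i => a i * b (k - i)%nat)%C k) (Rmin r q));
    [now apply Rmin_pos|].
  intros w Hw.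
  pose proof (Rmin_l r q). pose proof (Rmin_r r q).
  pose proof (Cmod_ge_0 w) as Hw0.
  set (M := fun i k => if (i <=? k)%nat then (a i * b (k - i)%nat * w ^ k)%C else RtoC 0).
  assert (Hrow0 : forall i j, (j < i)%nat -> M i j = 0).
  { intros i j Hj. unfold M. now rewrite (proj2 (Nat.leb_gt i j) Hj). }
  assert (Hrow1 : forall i j, M i (i + j)%nat = (a i * w ^ i * (b j * w ^ j))%C).
  { intros i j. unfold M. rewrite (proj2 (Nat.leb_le i (i + j)) (Nat.le_add_r i j)).
    replace (i + j - i)%nat with j by lia. rewrite Cpow_add_r. ring. }
  assert (Hmod : forall i, is_series (fun k => Cmod (M i k)) (Cmod (a i) * Cmod w ^ i *
      Series (fun j => Cmod (b j) * Cmod w ^ j))).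
  { intros i. apply (is_series_shift (V := R_NormedModule) _ _ i).
    - intros j Hj. rewrite Hrow0, Cmod_0 by exact Hj. reflexivity.
    - apply (is_series_ext (V := R_NormedModule) (fun j => scal (Cmod (a i) * Cmod w ^ i) (Cmod (b j) * Cmod w ^ j))).
      + intros j. rewrite Hrow1, !Cmod_mult, !Cmod_pow. reflexivity.
      + apply (is_series_scal (V := R_NormedModule)). apply Series_correct.
        apply (@ex_series_le R_AbsRing R_CompleteNormedModule _ (fun k => Cmod (b k) * q ^ k)).
        * intros k. change norm with Rabs.
          rewrite Rabs_pos_eq by (apply Rmult_le_pos; [apply Cmod_ge_0 | now apply pow_le]).
          apply Rmult_le_compat_l; [apply Cmod_ge_0|]. apply pow_incr. lra.
        * now exists lb. }
  set (B := Series (fun j => Cmod (b j) * Cmod w ^ j)) in *.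
  apply (double_series (V := C_NormedModule) M (fun i => Cmod (a i) * Cmod w ^ i * B)
           (fun i => a i * w ^ i * g (s0 + w))%C).
  - intros i J.
    apply Rle_trans with (sum_n (fun k => Cmod (M i k)) J).
    + apply norm_sum_n. intros k _. apply Rle_refl.
    + apply sum_n_le_series; [intros; apply Cmod_ge_0 | apply Hmod].
  - apply ex_series_scal_r.
    apply (@ex_series_le R_AbsRing R_CompleteNormedModule _ (fun k => Cmod (a k) * r ^ k)).
    + intros k. change norm with Rabs.
      rewrite Rabs_pos_eq by (apply Rmult_le_pos; [apply Cmod_ge_0 | now apply pow_le]).
      apply Rmult_le_compat_l; [apply Cmod_ge_0|]. apply pow_incr. lra.
    + now exists la.
  - intros i. apply (is_series_shift (V := C_NormedModule) _ _ i); [apply Hrow0|].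
    apply (is_Cseries_ext (fun j => a i * w ^ i * (b j * w ^ j))%C).
    + intros j. now rewrite Hrow1.
    + apply is_Cseries_scal, Hb. lra.
  - apply (is_Cseries_ext (fun i => g (s0 + w) * (a i * w ^ i))%C); [intros; ring|].
    rewrite (Cmult_comm (f (s0 + w)%C)). apply is_Cseries_scal, Ha. lra.
  - intros k.
    replace (Csum (fun i => a i * b (k - i)%nat)%C k * w ^ k)%C with (Csum (fun i => M i k) k).
    + apply (is_series_finite (V := C_NormedModule)). intros j Hj. now apply Hrow0.
    + rewrite <- Csum_mult_r. apply sum_n_ext_loc. intros i Hi. unfold M.
      now rewrite (proj2 (Nat.leb_le i k) Hi).
Qed.

Lemma analytic_const (c s0 : C) : C_analytic_at (fun _ => c) s0.
Proof.
  apply (analytic_of_expansion _ _ (fun k => match k with O => c | S _ => RtoC 0 end) 1); [lra|].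
  intros w _.
  set (u := fun k => (match k with O => c | S _ => RtoC 0 end * w ^ k)%C).
  assert (E : Csum u 0 = c) by (rewrite sum_O; unfold u; cbn; ring).
  pose proof (is_series_finite (V := C_NormedModule) u 0) as K. rewrite E in K. apply K.
  intros [|j] Hj; [lia|]. apply Cmult_0_l.
Qed.

Lemma Cexp_expansion (L : R) (s0 w : C) :
  is_Cseries (fun j => RtoC ((- L) ^ j / INR (fact j)) * Cexp (- s0 * RtoC L) * w ^ j)%C
    (Cexp (- (s0 + w) * RtoC L)).
Proof.
  replace (- (s0 + w) * RtoC L)%C with (- s0 * RtoC L + RtoC (- L) * w)%C
    by (rewrite RtoC_opp; ring).
  rewrite Cexp_plus.
  apply (is_Cseries_ext (fun j => Cexp (- s0 * RtoC L) * ((RtoC (- L) * w) ^ j / RtoC (INR (fact j))))%C).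
  - intros j. rewrite Cpow_mult_l, RtoC_div by apply INR_fact_neq_0. rewrite RtoC_pow.
    field. apply RtoC_neq_0, INR_fact_neq_0.
  - apply is_Cseries_scal, is_Cseries_exp.
Qed.

Lemma analytic_Cexp (L : R) (s0 : C) : C_analytic_at (fun s => Cexp (- s * RtoC L)) s0.
Proof.
  eapply (analytic_of_expansion _ _ _ 1 Rlt_0_1). intros w _. apply Cexp_expansion.
Qed.

(** If the series that starts at [a k] vanishes at [w], then [a k] is minus the sum of its other
    terms, all of which contain the factor [w]. Letting [w] tend to 0 will force [a k = 0]. *)
Lemma Cpow_series_tail_bound (a : nat -> C) (r S : R) (w : C) (k : nat) :
  0 < r -> Cmod w <= r -> is_series (fun j => Cmod (a j) * r ^ j) S ->
  is_Cseries (fun j => a (k + j)%nat * w ^ j)%C (RtoC 0) ->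
  Cmod (a k) <= Cmod w * (S / r ^ (k + 1)).
Proof.
  intros Hr Hw HS H0.
  assert (H1 : is_Cseries (fun j => a (k + Datatypes.S j)%nat * w ^ (Datatypes.S j))%C (- a k)%C).
  { apply (is_series_incr_1 (V := C_NormedModule) (fun j => a (k + j)%nat * w ^ j)%C).
    match goal with |- is_series _ ?x => replace x with (RtoC 0); [exact H0|] end.
    change (RtoC 0 = - a k + a (k + 0)%nat * 1)%C. rewrite Nat.add_0_r. ring. }
  assert (Hpos : forall j, 0 <= Cmod (a j) * r ^ j).
  { intros j. apply Rmult_le_pos; [apply Cmod_ge_0 | apply pow_le; lra]. }
  assert (H2 : is_series (fun j => Cmod (a (k + 1 + j)%nat) * r ^ (k + 1 + j)) (S - sum_n (fun j => Cmod (a j) * r ^ j) k)).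
  { apply (is_series_incr_n (fun j => Cmod (a j) * r ^ j) (k + 1)); [lia|].
    replace (Init.Nat.pred (k + 1)) with k by lia.
    match goal with |- is_series _ ?x => replace x with S; [exact HS|] end.
    change (@eq R S (S - sum_n (fun j => Cmod (a j) * r ^ j) k + sum_n (fun j => Cmod (a j) * r ^ j) k)). ring. }
  set (S' := S - sum_n (fun j => Cmod (a j) * r ^ j) k) in *.
  assert (HS' : S' <= S).
  { unfold S'. pose proof (sum_n_nonneg_incr _ 0 k Hpos (Nat.le_0_l k)) as K. rewrite sum_O in K.
    specialize (Hpos 0%nat). lra. }
  assert (Hrk : 0 < r ^ (k + 1)) by now apply pow_lt.
  rewrite <- Cmod_opp.
  apply Rle_trans with (Cmod w / r ^ (k + 1) * S').
  - apply (norm_series_le (V := C_NormedModule) _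
      (fun j => Cmod w / r ^ (k + 1) * (Cmod (a (k + 1 + j)%nat) * r ^ (k + 1 + j))) _ _) with (2 := H1).
    + intros j. change norm with Cmod. rewrite Cmod_mult, Cmod_pow.
      replace (k + Datatypes.S j)%nat with (k + 1 + j)%nat by lia.
      rewrite (pow_add r (k + 1) j). change (Cmod w ^ Datatypes.S j) with (Cmod w * Cmod w ^ j).
      replace (Cmod w / r ^ (k + 1) * (Cmod (a (k + 1 + j)%nat) * (r ^ (k + 1) * r ^ j)))
        with (Cmod (a (k + 1 + j)%nat) * (Cmod w * r ^ j)) by (field; lra).
      apply Rmult_le_compat_l; [apply Cmod_ge_0|].
      apply Rmult_le_compat_l; [apply Cmod_ge_0|]. apply pow_incr. split; [apply Cmod_ge_0 | exact Hw].
    + apply (is_series_scal (V := R_NormedModule)), H2.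
  - replace (Cmod w * (S / r ^ (k + 1))) with (Cmod w / r ^ (k + 1) * S) by (field; lra).
    apply Rmult_le_compat_l; [|exact HS'].
    apply Rmult_le_pos; [apply Cmod_ge_0 | now apply Rlt_le, Rinv_0_lt_compat].
Qed.

Lemma Rle_0_of_small (x K e : R) : 0 < e -> (forall v, 0 < v < e -> x <= v * K) -> x <= 0.
Proof.
  intros He H. destruct (Rle_lt_dec x 0) as [|Hx]; [assumption|exfalso].
  assert (HK : 0 < K).
  { specialize (H (e / 2) ltac:(lra)). nra. }
  set (v := Rmin (e / 2) (x / (2 * K))).
  assert (Hv : 0 < v) by (apply Rmin_pos; [lra | apply Rdiv_lt_0_compat; lra]).
  specialize (H v ltac:(split; [exact Hv | apply Rle_lt_trans with (1 := Rmin_l _ _); lra])).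
  assert (v * K <= x / (2 * K) * K) by (apply Rmult_le_compat_r; [lra | apply Rmin_r]).
  replace (x / (2 * K) * K) with (x / 2) in H0 by (field; lra). lra.
Qed.

(** Coefficients vanish in increasing order: once the lower ones are gone, dividing by [w ^ k]
    leaves the situation of [Cpow_series_tail_bound]. Zeros on one half-line are enough, and that is
    all the segment argument can supply. *)
Lemma pseries_zero_on_ray (a : nat -> C) (r e : R) (d : C) :
  0 < r -> 0 < e -> d <> 0 ->
  ex_series (fun k => Cmod (a k) * r ^ k) ->
  (forall v, 0 < v < e -> is_Cseries (fun k => a k * (RtoC v * d) ^ k)%C (RtoC 0)) ->
  forall k, a k = 0.
Proof.
  intros Hr He Hd [S HS] H k.
  assert (Hd0 : 0 < Cmod d) by now apply Cmod_gt_0.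
  induction k as [k IH] using lt_wf_ind.
  apply Cmod_eq_0. apply Rle_antisym; [|apply Cmod_ge_0].
  apply Rle_0_of_small with (K := Cmod d * (S / r ^ (k + 1))) (e := Rmin e (r / Cmod d)).
  - apply Rmin_pos; [exact He | now apply Rdiv_lt_0_compat].
  - intros v [Hv0 Hv].
    pose proof (Rlt_le_trans _ _ _ Hv (Rmin_l _ _)) as Hv1.
    pose proof (Rlt_le_trans _ _ _ Hv (Rmin_r _ _)) as Hv2.
    assert (Ew : Cmod (RtoC v * d)%C = v * Cmod d) by (rewrite Cmod_mult, Cmod_R, Rabs_pos_eq; lra).
    rewrite <- Rmult_assoc, <- Ew.
    apply Cpow_series_tail_bound; [exact Hr| |exact HS|].
    + rewrite Ew. apply Rmult_lt_compat_r with (r := Cmod d) in Hv2; [|exact Hd0].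
      replace (r / Cmod d * Cmod d) with r in Hv2 by (field; lra). lra.
    + specialize (H v (conj Hv0 Hv1)).
      assert (Hw : (RtoC v * d)%C <> 0).
      { apply Cmod_gt_0. rewrite Ew. now apply Rmult_lt_0_compat. }
      set (w := (RtoC v * d)%C) in *.
      apply (is_series_shift (V := C_NormedModule) _ _ k) in H.
      * apply (is_Cseries_scal (/ w ^ k)%C) in H.
        rewrite Cmult_0_r in H. revert H. apply is_Cseries_ext. intros j.
        rewrite Cpow_add_r. field. now apply Cpow_nz.
      * intros j Hj. rewrite (IH j Hj). apply Cmult_0_l.
Qed.

(** Continuity method. Let [T] be the supremum of the times up to which [f] vanishes. The expansion
    at time [T] vanishes on the part of the segment already covered, hence identically, so [f] also
    vanishes a little beyond [T]. This excludes [T < 1] and gives the value at the endpoint when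
    [T = 1]. *)
Lemma analytic_zero_on_segment (f : C -> C) (p d : C) (e : R) :
  0 < e -> d <> 0 ->
  (forall t, 0 <= t <= 1 -> C_analytic_at f (p + RtoC t * d)%C) ->
  (forall t, 0 <= t < e -> f (p + RtoC t * d)%C = 0) ->
  f (p + d)%C = 0.
Proof.
  intros He Hd Han Hz.
  set (E := fun t => 0 <= t <= 1 /\ forall u, 0 <= u < t -> f (p + RtoC u * d)%C = 0).
  assert (Hb : bound E) by (exists 1; intros t [Ht _]; lra).
  assert (Hex : exists t, E t) by (exists 0; split; [lra | intros; lra]).
  destruct (completeness E Hb Hex) as [T [HT1 HT2]].
  assert (HTle : T <= 1) by (apply HT2; intros t [Ht _]; lra).
  assert (HTe : Rmin e 1 <= T).
  { apply HT1. split.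
    - split; [apply Rlt_le, Rmin_pos; lra | apply Rmin_r].
    - intros u Hu. apply Hz. pose proof (Rmin_l e 1). lra. }
  assert (HT0 : 0 < T) by (apply Rlt_le_trans with (2 := HTe), Rmin_pos; lra).
  assert (HTz : forall u, 0 <= u < T -> f (p + RtoC u * d)%C = 0).
  { intros u Hu.
    destruct (Classical_Prop.classic (exists t, E t /\ u < t)) as [[t [[_ Ht] Hut]]|Hno].
    - apply Ht. lra.
    - exfalso. apply (Rlt_not_le T u); [lra|]. apply HT2. intros t Ht.
      apply Rnot_lt_le. intros Hlt. apply Hno. now exists t. }
  destruct (analytic_expansion _ _ (Han T ltac:(lra))) as [a [r [Hr [Ha Hexp]]]].
  assert (Hd0 : 0 < Cmod d) by now apply Cmod_gt_0.
  assert (Hrd : 0 < r / Cmod d) by now apply Rdiv_lt_0_compat.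
  assert (Hmul : forall v, 0 <= v <= r / Cmod d -> v * Cmod d <= r).
  { intros v Hv. replace r with (r / Cmod d * Cmod d) by (field; lra).
    apply Rmult_le_compat_r; lra. }
  assert (Ha0 : forall k, a k = 0).
  (* The direction is [- d] because the known zeros lie behind [T]. *)
  { apply (pseries_zero_on_ray a r (Rmin T (r / Cmod d)) (- d)%C); trivial.
    - now apply Rmin_pos.
    - intros E0. apply Hd. replace d with (- - d)%C by ring. rewrite E0. ring.
    - intros v Hv. pose proof (Rmin_l T (r / Cmod d)). pose proof (Rmin_r T (r / Cmod d)).
      assert (Hm : Cmod (RtoC v * - d)%C <= r).
      { rewrite Cmod_mult, Cmod_opp, Cmod_R, Rabs_pos_eq by lra. apply Hmul. lra. }
      specialize (Hexp _ Hm).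
      replace (p + RtoC T * d + RtoC v * - d)%C with (p + RtoC (T - v) * d)%C in Hexp
        by (rewrite RtoC_minus; ring).
      rewrite HTz in Hexp by lra. exact Hexp. }
  assert (Hafter : forall v, 0 <= v <= r / Cmod d -> f (p + RtoC (T + v) * d)%C = 0).
  { intros v Hv.
    assert (Hm : Cmod (RtoC v * d)%C <= r).
    { rewrite Cmod_mult, Cmod_R, Rabs_pos_eq by lra. apply Hmul. lra. }
    specialize (Hexp _ Hm).
    replace (p + RtoC T * d + RtoC v * d)%C with (p + RtoC (T + v) * d)%C in Hexp
      by (rewrite RtoC_plus; ring).
    apply (is_Cseries_unique _ _ _ Hexp).
    apply (is_Cseries_ext (fun _ => RtoC 0)).
    - intros n. rewrite Ha0. ring.
    - pose proof (is_series_finite (V := C_NormedModule) (fun _ => RtoC 0) 0) as K.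
      rewrite sum_O in K. now apply K. }
  destruct (Rle_lt_or_eq_dec T 1 HTle) as [HT|HT].
  - exfalso. set (t := Rmin 1 (T + r / Cmod d)).
    assert (Ht : T < t) by (apply Rmin_glb_lt; lra).
    apply (Rlt_not_le t T Ht). apply HT1. split.
    + split; [lra | apply Rmin_l].
    + intros u Hu. destruct (Rlt_le_dec u T) as [H|H]; [apply HTz; lra|].
      replace u with (T + (u - T)) by ring. apply Hafter.
      pose proof (Rmin_r 1 (T + r / Cmod d)). fold t in H0. lra.
  - specialize (Hafter 0 ltac:(lra)). rewrite HT, Rplus_0_r, Cmult_1_l in Hafter. exact Hafter.
Qed.

(** * The alternating zeta function *)

(** Consecutive terms of the alternating series are paired, which makes the convergence absolute for
    [Re s > 0]. *)
Definition eta_term (s : C) (k : nat) : C :=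
  (Cexp (- s * RtoC (ln (INR (2 * k + 1)))) - Cexp (- s * RtoC (ln (INR (2 * k + 2)))))%C.

Definition eta (s : C) : C := CSeries (eta_term s).

Lemma ln_le_compat (x y : R) : 0 < x -> x <= y -> ln x <= ln y.
Proof.
  intros Hx [H| ->]; [|lra]. now apply Rlt_le, ln_increasing.
Qed.

Lemma ln_INR_nonneg (n : nat) : (1 <= n)%nat -> 0 <= ln (INR n).
Proof.
  intros H. rewrite <- ln_1. apply ln_le_compat; [lra|]. apply (le_INR 1), H.
Qed.

Lemma ln_INR_incr (n m : nat) : (1 <= n <= m)%nat -> ln (INR n) <= ln (INR m).
Proof.
  intros H. apply ln_le_compat; [apply lt_0_INR; lia | apply le_INR; lia].
Qed.

Lemma ln_INR_gap (n : nat) : (1 <= n)%nat -> ln (INR (S n)) - ln (INR n) <= 1.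
Proof.
  intros H.
  assert (Hn : 1 <= INR n) by apply (le_INR 1), H.
  enough (ln (INR (S n)) <= ln (exp 1 * INR n)) by (rewrite ln_mult, ln_exp in H0; [lra | apply exp_pos | lra]).
  apply ln_le_compat; [apply lt_0_INR; lia|].
  rewrite S_INR. pose proof (exp_ineq1_le 1). nra.
Qed.

Lemma exp_le_compat (x y : R) : x <= y -> exp x <= exp y.
Proof. intros [H| ->]; [now apply Rlt_le, exp_increasing | lra]. Qed.

Lemma exp_pow_INR (x : R) (n : nat) : exp x ^ n = exp (INR n * x).
Proof.
  induction n as [|n IH]; [cbn; now rewrite Rmult_0_l, exp_0|].
  cbn [pow]. rewrite IH, S_INR, <- exp_plus. f_equal. ring.
Qed.

Lemma Cexp_diff_bound (s : C) (A B : R) :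
  0 <= Re s -> A <= B ->
  Cmod (Cexp (- s * RtoC A) - Cexp (- s * RtoC B))%C <= Cmod s * exp (- Re s * A) * (B - A).
Proof.
  intros Hs HAB.
  replace (Cexp (- s * RtoC A) - Cexp (- s * RtoC B))%C with
    (- (Cexp (- s * RtoC B) - Cexp (- s * RtoC A)))%C by ring.
  rewrite Cmod_opp. set (c := Cmod s * exp (- Re s * A)).
  replace (c * (B - A)) with (c * B - c * A) by ring.
  apply (Cmean_value (fun y => Cexp (- s * RtoC y)) (fun y => - s * Cexp (- s * RtoC y))%C
    (fun y => c * y) (fun _ => c)); [exact HAB| | |].
  - intros t _.
    eapply Cderive_ext_val; [|exact (Cderive_Cexp _ t _ (Cderive_mult _ _ t _ _
      (Cderive_const (- s)%C t) (Cderive_RtoC _ t 1 (is_derive_id t))))]. cbv beta. ring.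
  - intros t _. auto_derive; [easy|]. apply Rmult_1_r.
  - intros t Ht. rewrite Cmod_mult, Cmod_opp, Cmod_Cexp. unfold c.
    apply Rmult_le_compat_l; [apply Cmod_ge_0|]. apply exp_le_compat.
    unfold Re. cbn. unfold Re in Hs. nra.
Qed.

(** The Taylor coefficient of degree [j], at [s], of the [k]-th paired term. *)
Definition eta_coef (s : C) (k j : nat) : C :=
  (RtoC ((- ln (INR (2 * k + 1))) ^ j / INR (fact j)) * Cexp (- s * RtoC (ln (INR (2 * k + 1))))
   - RtoC ((- ln (INR (2 * k + 2))) ^ j / INR (fact j)) * Cexp (- s * RtoC (ln (INR (2 * k + 2)))))%C.

(** Up to a constant this is (2k+1)^(-r) - (2k+2)^(-r), whose sum over [k] is controlled by
    telescoping; [r] is at the same time the radius of the disc on which the expansions at [s] are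
    summed. *)
Definition eta_bound (s : C) (k : nat) : R :=
  let r := Re s / 2 in
  (r + Cmod s) * exp (2 * r) / r *
  (exp (- r * ln (INR (2 * k + 1))) - exp (- r * ln (INR (2 * k + 2)))).

Lemma exp_partial_diff (A B r : R) (J : nat) :
  0 <= A <= B -> 0 <= r ->
  sum_n (fun j => (B ^ j - A ^ j) * r ^ j / INR (fact j)) J <= exp (r * B) - exp (r * A).
Proof.
  intros HAB Hr.
  apply sum_n_le_series.
  - intros k. apply Rmult_le_pos; [|apply Rlt_le, Rinv_0_lt_compat, INR_fact_lt_0].
    apply Rmult_le_pos; [|now apply pow_le].
    pose proof (pow_incr A B k HAB). lra.
  - apply (is_series_ext (V := R_NormedModule) (fun j => plus ((r * B) ^ j / INR (fact j)) (opp ((r * A) ^ j / INR (fact j))))).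
    + intros j. rewrite !Rpow_mult_distr.
      change (@eq R (r ^ j * B ^ j / INR (fact j) + - (r ^ j * A ^ j / INR (fact j)))
        ((B ^ j - A ^ j) * r ^ j / INR (fact j))). unfold Rdiv. ring.
    + apply (is_series_minus (V := R_NormedModule)); apply is_series_exp.
Qed.

Lemma Cexp_coef_diff (s : C) (A B : R) (j : nat) :
  0 <= A <= B ->
  Cmod (RtoC ((- A) ^ j / INR (fact j)) * Cexp (- s * RtoC A)
     - RtoC ((- B) ^ j / INR (fact j)) * Cexp (- s * RtoC B))%C <=
  (B ^ j - A ^ j) / INR (fact j) * exp (- Re s * A) +
  B ^ j / INR (fact j) * Cmod (Cexp (- s * RtoC A) - Cexp (- s * RtoC B))%C.
Proof.
  intros HAB.
  pose proof (INR_fact_lt_0 j) as HF.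
  assert (HF' : 0 < / INR (fact j)) by now apply Rinv_0_lt_compat.
  replace (RtoC ((- A) ^ j / INR (fact j)) * Cexp (- s * RtoC A)
     - RtoC ((- B) ^ j / INR (fact j)) * Cexp (- s * RtoC B))%C
   with (RtoC ((-1) ^ j) * (RtoC (- ((B ^ j - A ^ j) / INR (fact j))) * Cexp (- s * RtoC A)
     + RtoC (B ^ j / INR (fact j)) * (Cexp (- s * RtoC A) - Cexp (- s * RtoC B))))%C.
  - rewrite Cmod_mult, Cmod_R, <- RPow_abs, Rabs_m1, pow1, Rmult_1_l.
    eapply Rle_trans; [apply Cmod_triangle|]. rewrite !Cmod_mult, !Cmod_R, Rabs_Ropp, Cmod_Cexp.
    pose proof (pow_incr A B j HAB). pose proof (pow_le A j (proj1 HAB)).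
    rewrite !Rabs_pos_eq by (apply Rmult_le_pos; lra).
    replace (Re (- s * RtoC A)%C) with (- Re s * A) by (unfold Re; cbn; ring). apply Rle_refl.
  - replace (- A) with (-1 * A) by ring. replace (- B) with (-1 * B) by ring.
    rewrite !Rpow_mult_distr. unfold Rdiv. rewrite Ropp_mult_distr_l.
    replace (- (B ^ j - A ^ j)) with (A ^ j - B ^ j) by ring.
    rewrite !RtoC_mult, RtoC_minus. ring.
Qed.

(** At radius [r = Re s / 2] the powers of the logarithms add up to [exp (r * B)], which uses up
    half of the decay [exp (- Re s * A)]. The gap [B - A] that remains as a factor is turned into
    the difference in [eta_bound] by convexity of the exponential. *)
Lemma eta_coef_bound (s : C) (k J : nat) :
  0 < Re s ->
  sum_n (fun j => Cmod (eta_coef s k j) * (Re s / 2) ^ j) J <= eta_bound s k.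
Proof.
  intros Hs. unfold eta_coef, eta_bound.
  set (A := ln (INR (2 * k + 1))). set (B := ln (INR (2 * k + 2))). set (r := Re s / 2).
  assert (HA : 0 <= A) by (apply ln_INR_nonneg; lia).
  assert (HAB : A <= B) by (apply ln_INR_incr; lia).
  assert (HBA : B - A <= 1).
  { unfold A, B. replace (2 * k + 2)%nat with (S (2 * k + 1)) by lia. apply ln_INR_gap. lia. }
  assert (Hr : 0 < r) by (unfold r; lra).
  set (D := Cmod (Cexp (- s * RtoC A) - Cexp (- s * RtoC B))%C).
  assert (HD : D <= Cmod s * exp (- Re s * A) * (B - A)) by (apply Cexp_diff_bound; lra).
  assert (HD0 : 0 <= D) by apply Cmod_ge_0.
  apply Rle_trans with (exp (- Re s * A) * (exp (r * B) - exp (r * A)) + D * exp (r * B)).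
  - apply Rle_trans with
      (sum_n (fun j => exp (- Re s * A) * ((B ^ j - A ^ j) * r ^ j / INR (fact j))
         + D * ((r * B) ^ j / INR (fact j))) J).
    + apply sum_n_m_le. intros j.
      apply Rle_trans with (((B ^ j - A ^ j) / INR (fact j) * exp (- Re s * A) + B ^ j / INR (fact j) * D) * r ^ j).
      * apply Rmult_le_compat_r; [apply pow_le; lra|]. now apply Cexp_coef_diff.
      * rewrite Rpow_mult_distr. apply Req_le. unfold Rdiv. ring.
    + rewrite (sum_n_plus (G := R_AbelianMonoid)).
      rewrite !(sum_n_mult_l (K := R_Ring)).
      apply Rplus_le_compat; apply Rmult_le_compat_l; trivial.
      * apply Rlt_le, exp_pos.
      * apply exp_partial_diff; lra.
      * apply sum_n_le_series; [|apply is_series_exp].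
        intros j. apply Rmult_le_pos; [|apply Rlt_le, Rinv_0_lt_compat, INR_fact_lt_0].
        apply pow_le. apply Rmult_le_pos; lra.
  - assert (E1 : exp (r * B) - exp (r * A) <= r * (B - A) * exp (r * B)).
    { replace (exp (r * A)) with (exp (r * B) * exp (- (r * (B - A)))) by (rewrite <- exp_plus; f_equal; ring).
      pose proof (exp_pos (r * B)). pose proof (exp_ineq1_le (- (r * (B - A)))). nra. }
    (* Exchanging [A] and [B] in an exponent costs a factor [exp r], as [B - A <= 1]. This happens
       here and again in [E3], whence [exp (2 * r)] in [eta_bound]. *)
    assert (E2 : exp (- Re s * A) * exp (r * B) <= exp (- r * A) * exp r).
    { rewrite <- !exp_plus. apply exp_le_compat. unfold r. unfold r in Hr. nra. }
    assert (E3 : (B - A) * exp (- r * A) <= exp r / r * (exp (- r * A) - exp (- r * B))).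
    { assert (K1 : exp (- r * A) <= exp (- r * B) * exp r).
      { rewrite <- exp_plus. apply exp_le_compat. nra. }
      assert (K2 : exp (- r * B) * (r * (B - A)) <= exp (- r * A) - exp (- r * B)).
      { replace (exp (- r * A)) with (exp (- r * B) * exp (r * (B - A))) by (rewrite <- exp_plus; f_equal; ring).
        pose proof (exp_pos (- r * B)). pose proof (exp_ineq1_le (r * (B - A))). nra. }
      apply Rle_trans with ((B - A) * (exp (- r * B) * exp r)).
      - apply Rmult_le_compat_l; lra.
      - replace ((B - A) * (exp (- r * B) * exp r)) with (exp r / r * (exp (- r * B) * (r * (B - A)))) by (field; lra).
        apply Rmult_le_compat_l; [|exact K2].
        apply Rmult_le_pos; [apply Rlt_le, exp_pos | now apply Rlt_le, Rinv_0_lt_compat]. }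
    pose proof (exp_pos (- Re s * A)) as P1. pose proof (exp_pos (r * B)) as P2.
    pose proof (Cmod_ge_0 s) as P3.
    apply Rle_trans with ((r + Cmod s) * (B - A) * (exp (- Re s * A) * exp (r * B))).
    + assert (exp (- Re s * A) * (exp (r * B) - exp (r * A)) <= exp (- Re s * A) * (r * (B - A) * exp (r * B)))
        by (apply Rmult_le_compat_l; lra).
      assert (D * exp (r * B) <= Cmod s * exp (- Re s * A) * (B - A) * exp (r * B))
        by (apply Rmult_le_compat_r; lra).
      nra.
    + apply Rle_trans with ((r + Cmod s) * (B - A) * (exp (- r * A) * exp r)).
      * apply Rmult_le_compat_l; [|exact E2]. apply Rmult_le_pos; lra.
      * replace (exp (2 * r)) with (exp r * exp r) by (rewrite <- exp_plus; f_equal; ring).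
        replace ((r + Cmod s) * (B - A) * (exp (- r * A) * exp r))
          with ((r + Cmod s) * exp r * ((B - A) * exp (- r * A))) by ring.
        replace ((r + Cmod s) * (exp r * exp r) / r * (exp (- r * A) - exp (- r * B)))
          with ((r + Cmod s) * exp r * (exp r / r * (exp (- r * A) - exp (- r * B)))) by (field; lra).
        apply Rmult_le_compat_l; [|exact E3].
        apply Rmult_le_pos; [lra | apply Rlt_le, exp_pos].
Qed.

(** The terms are drops of a decreasing sequence over disjoint steps, so their sum is at most its
    first value, 1. *)
Lemma ex_series_eta_bound (s : C) : 0 < Re s -> ex_series (eta_bound s).
Proof.
  intros Hs. unfold eta_bound. set (r := Re s / 2).
  assert (Hr : 0 < r) by (unfold r; lra).
  apply (ex_series_scal (V := R_NormedModule)).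
  set (E := fun n => exp (- r * ln (INR n))).
  assert (HE : forall n m, (1 <= n <= m)%nat -> E m <= E n).
  { intros n m H. apply exp_le_compat. pose proof (ln_INR_incr n m H). nra. }
  apply (ex_series_bounded_nonneg _ 1).
  - intros k. pose proof (HE (2 * k + 1)%nat (2 * k + 2)%nat ltac:(lia)). unfold E in *. lra.
  - intros n.
    assert (H : sum_n (fun k => E (2 * k + 1)%nat - E (2 * k + 2)%nat) n <= 1 - E (2 * n + 2)%nat).
    { induction n as [|n IH].
      - rewrite sum_O. unfold E at 1. change (INR (2 * 0 + 1)) with 1. rewrite ln_1, Rmult_0_r, exp_0. lra.
      - rewrite sum_n_S_R. pose proof (HE (2 * n + 2)%nat (2 * S n + 1)%nat ltac:(lia)). lra. }
    pose proof (exp_pos (- r * ln (INR (2 * n + 2)))). unfold E in *. lra.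
Qed.

Lemma eta_term_expansion (s w : C) (k : nat) :
  is_Cseries (fun j => eta_coef s k j * w ^ j)%C (eta_term (s + w) k).
Proof.
  unfold eta_term, eta_coef.
  eapply is_Cseries_ext; [|apply is_Cseries_minus; apply Cexp_expansion].
  intros j. cbv beta. ring.
Qed.

Lemma Cmod_eta_term (s w : C) (k : nat) :
  0 < Re s -> Cmod w <= Re s / 2 ->
  (forall J, Cmod (Csum (fun j => eta_coef s k j * w ^ j)%C J) <= eta_bound s k) /\
  Cmod (eta_term (s + w) k) <= eta_bound s k.
Proof.
  intros Hs Hw.
  assert (H : forall J, Cmod (Csum (fun j => eta_coef s k j * w ^ j)%C J) <= eta_bound s k).
  { intros J. eapply Rle_trans; [|apply (eta_coef_bound s k J Hs)].
    apply (norm_sum_n (V := C_NormedModule)). intros j _. change norm with Cmod.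
    rewrite Cmod_mult, Cmod_pow. apply Rmult_le_compat_l; [apply Cmod_ge_0|].
    apply pow_incr. split; [apply Cmod_ge_0 | exact Hw]. }
  split; [exact H|].
  apply (is_lim_seq_le (fun J => Cmod (Csum (fun j => eta_coef s k j * w ^ j)%C J))
    (fun _ => eta_bound s k) (Cmod (eta_term (s + w) k)) (eta_bound s k)).
  - exact H.
  - eapply filterlim_comp; [apply eta_term_expansion | apply (filterlim_norm (V := C_NormedModule))].
  - apply is_lim_seq_const.
Qed.

Lemma eta_correct (s w : C) :
  0 < Re s -> Cmod w <= Re s / 2 -> is_Cseries (eta_term (s + w)) (eta (s + w)).
Proof.
  intros Hs Hw.
  destruct (Cseries_dominated (eta_term (s + w)) (eta_bound s)) as [l Hl].
  - intros k. now apply Cmod_eta_term.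
  - now apply ex_series_eta_bound.
  - unfold eta. now rewrite (CSeries_unique _ _ Hl).
Qed.

(** Rearrangement by powers of [w]: the rows are the expansions of the paired terms, the columns are
    the coefficients of eta at [s]. *)
Lemma analytic_eta (s : C) : 0 < Re s -> C_analytic_at eta s.
Proof.
  intros Hs.
  assert (Hr : 0 < Re s / 2) by lra.
  apply (analytic_of_expansion eta s (fun j => CSeries (fun k => eta_coef s k j)) (Re s / 2) Hr).
  intros w Hw.
  apply (double_series (V := C_NormedModule) (fun k j => eta_coef s k j * w ^ j)%C (eta_bound s) (eta_term (s + w))).
  - intros k J. apply (proj1 (Cmod_eta_term s w k Hs (Rlt_le _ _ Hw))).
  - now apply ex_series_eta_bound.
  - intros k. apply eta_term_expansion.
  - apply eta_correct; [exact Hs | lra].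
  - intros j.
    destruct (Cseries_dominated (fun k => eta_coef s k j) (fun k => eta_bound s k * / (Re s / 2) ^ j)) as [l Hl].
    + intros k.
      assert (Hp : 0 < (Re s / 2) ^ j) by now apply pow_lt.
      apply Rmult_le_reg_r with ((Re s / 2) ^ j); [exact Hp|].
      rewrite Rmult_assoc, Rinv_l, Rmult_1_r by lra.
      eapply Rle_trans; [|apply (eta_coef_bound s k j Hs)].
      assert (Hnn : forall i, 0 <= Cmod (eta_coef s k i) * (Re s / 2) ^ i).
      { intros i. apply Rmult_le_pos; [apply Cmod_ge_0 | apply pow_le; lra]. }
      destruct j as [|j]; [rewrite sum_O; apply Rle_refl|].
      rewrite sum_n_S_R.
      pose proof (sum_n_nonneg_incr _ 0 j Hnn (Nat.le_0_l j)) as K. rewrite sum_O in K.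
      specialize (Hnn 0%nat). lra.
    + apply ex_series_scal_r. now apply ex_series_eta_bound.
    + rewrite (CSeries_unique _ _ Hl).
      apply (is_Cseries_ext (fun k => w ^ j * eta_coef s k j)%C); [intros; ring|].
      rewrite Cmult_comm. now apply is_Cseries_scal.
Qed.

(** Removing every second term twice turns the full sum into the alternating one. The same
    bookkeeping serves the Dirichlet series and the theta series. *)
Lemma Csum_alternating (u v t : nat -> C) (N : nat) :
  (forall k, u (S (2 * k)) = v k) -> (forall k, t k = u (2 * k)%nat - v k)%C ->
  Csum t N = (Csum u (S (2 * N)) - 2 * Csum v N)%C.
Proof.
  intros Hu Et. induction N as [|N IH].
  - rewrite sum_Sn, !sum_O, Et. rewrite (Hu 0%nat).
    change (@eq C (u 0%nat - v 0%nat) (u 0%nat + v 0%nat - 2 * v 0%nat))%C. ring.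
  - replace (S (2 * S N)) with (S (S (S (2 * N)))) by lia.
    rewrite !(sum_Sn (G := C_NormedModule)). rewrite IH, Et.
    replace (S (S (S (2 * N)))) with (S (2 * S N)) by lia. rewrite Hu.
    replace (S (S (2 * N))) with (2 * S N)%nat by lia.
    rewrite (sum_Sn (G := C_NormedModule) u (2 * N)).
    generalize (Csum u (2 * N)), (Csum v N). intros x y.
    rewrite !Hu.
    change (@eq C (x + v N - 2 * y + (u (2 * S N)%nat - v (S N)))
      (x + v N + u (2 * S N)%nat + v (S N) - 2 * (y + v (S N))))%C. ring.
Qed.

Definition eta_factor (s : C) : C := (1 - 2 * Cexp (- s * RtoC (ln 2)))%C.

Lemma eta_zeta_half_plane (s z : C) :
  0 < Re s ->
  is_Cseries (fun k => RCpow (INR (S k)) (- s)%C) z -> (eta s - eta_factor s * z)%C = 0.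
Proof.
  intros Hs Hz. unfold RCpow in Hz.
  assert (He : is_Cseries (eta_term s) (eta s)).
  { replace s with (s + 0)%C by ring. apply eta_correct; [exact Hs|]. rewrite Cmod_0. lra. }
  set (u := fun k => Cexp (- s * RtoC (ln (INR (S k))))) in *.
  set (q := Cexp (- s * RtoC (ln 2))).
  assert (Hu : forall k, u (S (2 * k)) = (q * u k)%C).
  { intros k. unfold u, q. rewrite <- Cexp_plus. f_equal.
    replace (S (S (2 * k))) with (2 * S k)%nat by lia.
    rewrite mult_INR, ln_mult by (apply lt_0_INR; lia).
    change (INR 2) with (1 + 1). rewrite RtoC_plus. replace (1 + 1) with 2 by ring. ring. }
  assert (Hsum : forall N, Csum (eta_term s) N = (Csum u (S (2 * N)) - 2 * q * Csum u N)%C).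
  { intros N. rewrite (Csum_alternating u (fun k => q * u k)%C (eta_term s) N Hu).
    - replace (Csum (fun k => q * u k)%C N) with (q * Csum u N)%C
        by (symmetry; exact (sum_n_mult_l (K := C_Ring) q u N)).
      generalize (Csum u (S (2 * N))), (Csum u N). intros x y. change (@eq C (x - 2 * (q * y)) (x - 2 * q * y))%C. ring.
    - intros k. rewrite <- Hu. unfold eta_term, u.
      now replace (S (2 * k)) with (2 * k + 1)%nat by lia;
          replace (S (2 * k + 1)) with (2 * k + 2)%nat by lia. }
  assert (L1 : filterlim (fun N => Csum u (S (2 * N))) eventually (@locally C_UniformSpace z)).
  { refine (filterlim_comp _ _ _ (fun N => S (2 * N)) (Csum u) _ eventually _ _ Hz).
    apply eventually_subseq. intros n. lia. }
  assert (L2 : filterlim (Csum (eta_term s)) eventually (@locally C_UniformSpace (z + (- (2 * q)) * z)%C)).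
  { apply (filterlim_ext (fun N => plus (Csum u (S (2 * N))) (scal (- (2 * q))%C (Csum u N)))).
    - intros N. rewrite Hsum. generalize (Csum u (S (2 * N))), (Csum u N). intros x y.
      change (@eq C (x + (- (2 * q)) * y) (x - 2 * q * y))%C. ring.
    - eapply filterlim_comp_2; [exact L1 | | apply (filterlim_plus (V := C_NormedModule))].
      eapply filterlim_comp; [exact Hz | apply (filterlim_scal_r (V := C_NormedModule))]. }
  rewrite (Clim_unique _ _ _ He L2). unfold eta_factor. fold q. ring.
Qed.

Lemma eta_zeta (zeta : C -> C) (s : C) :
  is_riemann_zeta zeta -> 0 < Re s < 1 -> eta s = (eta_factor s * zeta s)%C.
Proof.
  intros [Han Hser] Hs.
  set (h := fun s => (eta s - eta_factor s * zeta s)%C).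
  assert (Hhan : forall s, 0 < Re s -> s <> 1 -> C_analytic_at h s).
  { intros u Hu Hu1. apply analytic_minus; [now apply analytic_eta|].
    apply analytic_mult; [|now apply Han].
    apply analytic_minus; [apply analytic_const|].
    apply analytic_mult; [apply analytic_const | apply analytic_Cexp]. }
  assert (Hh0 : forall s, 1 < Re s -> h s = 0).
  { intros u Hu. exact (eta_zeta_half_plane u (zeta u) ltac:(lra) (Hser u Hu)). }
  (* The segment from 2 + i y0 to s avoids the pole. *)
  set (y0 := if Rle_dec 0 (Im s) then 1 else -1).
  set (p := ((2, y0) : C)). set (d := (s - p)%C).
  assert (Hre : forall t, Re (p + RtoC t * d)%C = 2 + t * (Re s - 2)) by (intros; unfold d, p, Re; cbn; ring).
  assert (Him : forall t, Im (p + RtoC t * d)%C = y0 + t * (Im s - y0)) by (intros; unfold d, p, Im; cbn; ring).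
  assert (Hmain : h (p + d)%C = 0).
  (* The real part starts at 2 and loses less than 2 along the whole segment, so it exceeds 1 for
     [t < 1 / 4]. *)
  { apply (analytic_zero_on_segment h p d (1 / 4)); [lra| | |].
    - intros E. assert (K : Re d = 0) by now rewrite E. unfold d, p, Re in K. cbn in K.
      unfold Re in Hs. lra.
    - intros t Ht. apply Hhan.
      + rewrite Hre. nra.
      (* [y0] has the sign of [Im s], so the imaginary part can vanish only at [t = 1], where the
         real part is [Re s < 1]. *)
      + intros E. destruct (Req_dec t 1) as [->|Ht1].
        * assert (K : Re (p + RtoC 1 * d)%C = 1) by now rewrite E. rewrite Hre in K. lra.
        * assert (K : Im (p + RtoC t * d)%C = 0) by now rewrite E. rewrite Him in K.
          revert K. unfold y0. destruct (Rle_dec 0 (Im s)); nra.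
    - intros t Ht. apply Hh0. rewrite Hre. nra. }
  replace (p + d)%C with s in Hmain by (unfold d; ring).
  unfold h in Hmain. replace (eta s) with (eta s - eta_factor s * zeta s + eta_factor s * zeta s)%C by ring.
  rewrite Hmain. ring.
Qed.

Lemma eta_factor_neq_0 (s : C) : Re s < 1 -> eta_factor s <> 0.
Proof.
  intros Hs E. unfold eta_factor in E.
  assert (K : (2 * Cexp (- s * RtoC (ln 2)))%C = 1).
  { replace (2 * Cexp (- s * RtoC (ln 2)))%C with (1 - (1 - 2 * Cexp (- s * RtoC (ln 2))))%C by ring.
    rewrite E. ring. }
  apply (f_equal Cmod) in K. rewrite Cmod_mult, Cmod_Cexp, !Cmod_R, Rabs_R1, Rabs_pos_eq in K by lra.
  replace 2 with (exp (ln 2)) in K at 1 by (apply exp_ln; lra).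
  rewrite <- exp_plus, <- exp_0 in K. apply exp_inv in K.
  replace (Re (- s * RtoC (ln 2))%C) with (- Re s * ln 2) in K by (unfold Re; cbn; ring).
  pose proof ln_lt_2. nra.
Qed.

(** * Improper integrals over the positive half-line *)

Notation is_CRInt := (@is_RInt C_R_NormedModule).
Notation CRInt := (@RInt C_R_CompleteNormedModule).
Notation Ccontinuous := (@continuous R_UniformSpace C_UniformSpace).

Definition is_CI (f : R -> C) (l : C) : Prop :=
  @is_RInt_gen C_R_NormedModule f (at_right 0) (Rbar_locally p_infty) l.

Lemma is_CI_eps (f : R -> C) (l : C) :
  is_CI f l <->
  (forall eps, 0 < eps -> exists d M, 0 < d <= 1 /\ 1 <= M /\ forall a b, 0 < a < d -> M < b ->
    exists y, is_CRInt f a b y /\ Cmod (y - l)%C < eps).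
Proof.
  split.
  - intros H eps Heps.
    assert (HP : @locally C_UniformSpace l (fun y => Cmod (y - l)%C < eps)).
    { apply (@locally_le_locally_norm C_AbsRing C_NormedModule l).
      exists (mkposreal _ Heps). intros y Hy. exact Hy. }
    destruct (H _ HP) as [Q1 Q2 [[d Hd] HQ1] [M HQ2] HQ].
    exists (Rmin d 1), (Rmax M 1).
    split; [split; [apply Rmin_pos; lra | apply Rmin_r]|]. split; [apply Rmax_r|].
    intros a b [Ha1 Ha2] Hb. apply (HQ a b).
    + apply HQ1; [|exact Ha1]. change (Rabs (a - 0) < d). rewrite Rminus_0_r, Rabs_pos_eq by lra.
      apply Rlt_le_trans with (1 := Ha2), Rmin_l.
    + apply HQ2. apply Rle_lt_trans with (2 := Hb), Rmax_l.
  - intros H P HP.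
    apply (@locally_norm_le_locally C_AbsRing C_NormedModule l) in HP.
    destruct HP as [eps HP]. destruct (H eps (cond_pos eps)) as [d [M [Hd [HM HdM]]]].
    apply (Filter_prod _ _ _ (fun a => 0 < a < d) (fun b => M < b)).
    + exists (mkposreal d (proj1 Hd)). intros y Hy Hy0. split; [exact Hy0|].
      change (Rabs (y - 0) < d) in Hy. rewrite Rminus_0_r in Hy.
      apply Rle_lt_trans with (2 := Hy), Rle_abs.
    + exists M. intros x Hx. exact Hx.
    + intros a b Ha Hb. destruct (HdM a b Ha Hb) as [y [Hy1 Hy2]].
      exists y. split; [exact Hy1|]. apply HP. exact Hy2.
Qed.

Lemma is_CI_unique (f : R -> C) (l : C) :
  is_CI f l -> @RInt_gen C_R_CompleteNormedModule f (at_right 0) (Rbar_locally p_infty) = l.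
Proof.
  intros H.
  apply (@is_RInt_gen_unique C_R_CompleteNormedModule (at_right 0) (Rbar_locally p_infty) _ _ f l H).
Qed.

Lemma is_CI_eq (f : R -> C) (l l' : C) : is_CI f l -> is_CI f l' -> l = l'.
Proof. intros H1 H2. now rewrite <- (is_CI_unique f l H1), (is_CI_unique f l' H2). Qed.

Lemma is_CI_ext (f g : R -> C) (l : C) :
  (forall x, 0 < x -> f x = g x) -> is_CI f l -> is_CI g l.
Proof.
  intros E H. apply is_CI_eps. intros eps Heps.
  destruct (proj1 (is_CI_eps f l) H eps Heps) as [d [M [Hd [HM K]]]].
  exists d, M. split; [exact Hd|]. split; [exact HM|]. intros a b Ha Hb.
  destruct (K a b Ha Hb) as [y [Hy1 Hy2]]. exists y. split; [|exact Hy2].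
  eapply is_RInt_ext; [|exact Hy1]. intros x Hx. apply E.
  rewrite Rmin_left in Hx by lra. lra.
Qed.

Lemma is_CI_plus (f g : R -> C) (l m : C) :
  is_CI f l -> is_CI g m -> is_CI (fun x => f x + g x)%C (l + m)%C.
Proof. intros H1 H2. exact (@is_RInt_gen_plus C_R_NormedModule _ _ _ _ f g l m H1 H2). Qed.

Lemma is_CI_minus (f g : R -> C) (l m : C) :
  is_CI f l -> is_CI g m -> is_CI (fun x => f x - g x)%C (l - m)%C.
Proof. intros H1 H2. exact (@is_RInt_gen_minus C_R_NormedModule _ _ _ _ f g l m H1 H2). Qed.

Lemma is_CRInt_ext_pair (f : R -> C) (a b : R) (l : C) :
  is_RInt (fun x => Re (f x)) a b (Re l) -> is_RInt (fun x => Im (f x)) a b (Im l) -> is_CRInt f a b l.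
Proof.
  intros H1 H2. destruct l as [u v].
  exact (@is_RInt_fct_extend_pair R_NormedModule R_NormedModule f a b u v H1 H2).
Qed.

Lemma is_CRInt_Re (f : R -> C) (a b : R) (l : C) :
  is_CRInt f a b l -> is_RInt (fun x => Re (f x)) a b (Re l).
Proof. exact (@is_RInt_fct_extend_fst R_NormedModule R_NormedModule f a b l). Qed.

Lemma is_CRInt_Im (f : R -> C) (a b : R) (l : C) :
  is_CRInt f a b l -> is_RInt (fun x => Im (f x)) a b (Im l).
Proof. exact (@is_RInt_fct_extend_snd R_NormedModule R_NormedModule f a b l). Qed.

(** The integral lives in a module over the reals, so a complex factor has to be moved through the
    real and imaginary parts. *)
Lemma is_CRInt_scal (f : R -> C) (a b : R) (l c : C) :
  is_CRInt f a b l -> is_CRInt (fun x => c * f x)%C a b (c * l)%C.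
Proof.
  intros H. pose proof (is_CRInt_Re _ _ _ _ H) as H1. pose proof (is_CRInt_Im _ _ _ _ H) as H2.
  apply is_CRInt_ext_pair.
  - exact (@is_RInt_minus R_NormedModule _ _ a b _ _ (@is_RInt_scal R_NormedModule _ a b (Re c) _ H1) (@is_RInt_scal R_NormedModule _ a b (Im c) _ H2)).
  - exact (@is_RInt_plus R_NormedModule _ _ a b _ _ (@is_RInt_scal R_NormedModule _ a b (Re c) _ H2) (@is_RInt_scal R_NormedModule _ a b (Im c) _ H1)).
Qed.

Lemma is_CI_scal (f : R -> C) (l c : C) : is_CI f l -> is_CI (fun x => c * f x)%C (c * l)%C.
Proof.
  intros H. apply is_CI_eps. intros eps Heps.
  pose proof (Cmod_ge_0 c) as Hc.
  destruct (proj1 (is_CI_eps f l) H (eps / (Cmod c + 1)) ltac:(apply Rdiv_lt_0_compat; lra)) as [d [M [Hd [HM K]]]].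
  exists d, M. split; [exact Hd|]. split; [exact HM|]. intros a b Ha Hb.
  destruct (K a b Ha Hb) as [y [Hy1 Hy2]]. exists (c * y)%C. split; [now apply is_CRInt_scal|].
  replace (c * y - c * l)%C with (c * (y - l))%C by ring. rewrite Cmod_mult.
  apply Rle_lt_trans with (Cmod c * (eps / (Cmod c + 1))); [apply Rmult_le_compat_l; lra|].
  replace (Cmod c * (eps / (Cmod c + 1))) with (eps * (Cmod c / (Cmod c + 1))) by (field; lra).
  rewrite <- (Rmult_1_r eps) at 2. apply Rmult_lt_compat_l; [exact Heps|].
  apply Rmult_lt_reg_r with (Cmod c + 1); [lra|]. unfold Rdiv. rewrite Rmult_assoc, Rinv_l; lra.
Qed.

Lemma is_CRInt_comp_scale (f : R -> C) (c a b : R) (l : C) :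
  0 < c -> is_CRInt f (c * a) (c * b) l -> is_CRInt (fun x => f (c * x)) a b (RtoC (/ c) * l)%C.
Proof.
  intros Hc H.
  assert (H' : is_CRInt (fun y => scal c (f (c * y + 0))) a b l).
  { apply (@is_RInt_comp_lin C_R_NormedModule). now rewrite !Rplus_0_r. }
  apply (is_CRInt_scal _ _ _ _ (RtoC (/ c))) in H'.
  eapply is_RInt_ext; [|exact H']. intros x _.
  cbv beta. rewrite Rplus_0_r. rewrite scal_R_Cmult, Cmult_assoc, <- RtoC_mult, Rinv_l by lra. apply Cmult_1_l.
Qed.

Lemma is_CI_comp_scale (f : R -> C) (l : C) (c : R) :
  0 < c -> is_CI f l -> is_CI (fun x => f (c * x)) (RtoC (/ c) * l)%C.
Proof.
  intros Hc H. apply is_CI_eps. intros eps Heps.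
  destruct (proj1 (is_CI_eps f l) H (eps * c) ltac:(now apply Rmult_lt_0_compat)) as [d [M [Hd [HM K]]]].
  assert (Hic : 0 < / c) by now apply Rinv_0_lt_compat.
  exists (Rmin (d * / c) 1), (Rmax (M * / c) 1).
  split; [split; [apply Rmin_pos; [apply Rmult_lt_0_compat; lra | lra] | apply Rmin_r]|].
  split; [apply Rmax_r|].
  intros a b [Ha1 Ha2] Hb.
  assert (A1 : a < d * / c) by (apply Rlt_le_trans with (1 := Ha2), Rmin_l).
  assert (A2 : M * / c < b) by (apply Rle_lt_trans with (2 := Hb), Rmax_l).
  destruct (K (c * a) (c * b)) as [y [Hy1 Hy2]].
  - split; [now apply Rmult_lt_0_compat|].
    apply Rmult_lt_compat_l with (r := c) in A1; [|exact Hc].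
    replace (c * (d * / c)) with d in A1 by (field; lra). exact A1.
  - apply Rmult_lt_compat_l with (r := c) in A2; [|exact Hc].
    replace (c * (M * / c)) with M in A2 by (field; lra). exact A2.
  - exists (RtoC (/ c) * y)%C. split; [now apply is_CRInt_comp_scale|].
    replace (RtoC (/ c) * y - RtoC (/ c) * l)%C with (RtoC (/ c) * (y - l))%C by ring.
    rewrite Cmod_mult, Cmod_R, Rabs_pos_eq by lra.
    apply Rmult_lt_reg_l with c; [exact Hc|]. rewrite <- Rmult_assoc, Rinv_r, Rmult_1_l; lra.
Qed.

Lemma ex_CRInt_cont (f : R -> C) (a b : R) :
  (forall x, 0 < x -> Ccontinuous f x) -> 0 < a -> 0 < b -> is_CRInt f a b (CRInt f a b).
Proof.
  intros Hf Ha Hb. apply (@RInt_correct C_R_CompleteNormedModule).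
  apply (@ex_RInt_continuous C_R_CompleteNormedModule). intros z Hz. apply Hf.
  apply Rlt_le_trans with (2 := proj1 Hz). now apply Rmin_pos.
Qed.

Lemma is_CI_comp_inv (f : R -> C) (l : C) :
  (forall x, 0 < x -> Ccontinuous f x) -> is_CI f l -> is_CI (fun x => RtoC (/ x ^ 2) * f (/ x)%R)%C l.
Proof.
  intros Hf H. apply is_CI_eps. intros eps Heps.
  destruct (proj1 (is_CI_eps f l) H eps Heps) as [d [M [Hd [HM K]]]].
  (* Inversion swaps the two ends: the cut-off at infinity becomes the one at 0 and conversely. *)
  exists (/ M), (/ d).
  split; [split; [apply Rinv_0_lt_compat; lra | rewrite <- Rinv_1; apply Rinv_le_contravar; lra]|].
  split; [rewrite <- Rinv_1; apply Rinv_le_contravar; lra|].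
  intros a b [Ha1 Ha2] Hb.
  assert (Hb0 : 0 < b) by (apply Rlt_trans with (2 := Hb), Rinv_0_lt_compat; lra).
  assert (A1 : M < / a).
  { rewrite <- (Rinv_inv M). apply Rinv_lt_contravar; [|exact Ha2].
    apply Rmult_lt_0_compat; [exact Ha1 | apply Rinv_0_lt_compat; lra]. }
  assert (A2 : 0 < / b < d).
  { split; [now apply Rinv_0_lt_compat|]. rewrite <- (Rinv_inv d). apply Rinv_lt_contravar; [|exact Hb].
    apply Rmult_lt_0_compat; [apply Rinv_0_lt_compat; lra | exact Hb0]. }
  destruct (K (/ b) (/ a) A2 A1) as [y [Hy1 Hy2]].
  exists y. split; [|exact Hy2].
  assert (Hia : 0 < / a) by lra.
  assert (Hc : is_CRInt (fun x => scal (- / x ^ 2) (f (/ x))) a b (CRInt f (/ a) (/ b))).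
  { apply (@is_RInt_comp C_R_CompleteNormedModule f (fun x => / x) (fun x => - / x ^ 2) a b).
    - intros x Hx. apply Hf, Rinv_0_lt_compat, Rlt_le_trans with (2 := proj1 Hx). now apply Rmin_pos.
    - intros x Hx.
      assert (Hx0 : 0 < x) by (apply Rlt_le_trans with (2 := proj1 Hx); now apply Rmin_pos).
      split.
      + auto_derive; [lra|]. field. lra.
      + apply (ex_derive_continuous (fun x => - / x ^ 2)). auto_derive. nra. }
  assert (Ey : opp (CRInt f (/ a) (/ b)) = y).
  { apply (@is_RInt_unique C_R_CompleteNormedModule) in Hy1. rewrite <- Hy1.
    apply (@opp_RInt_swap C_R_CompleteNormedModule). eexists. apply ex_CRInt_cont; [exact Hf | lra | lra]. }
  rewrite <- Ey. apply (@is_RInt_opp C_R_NormedModule) in Hc.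
  eapply is_RInt_ext; [|exact Hc]. intros x _. cbv beta. rewrite scal_R_Cmult.
  change (- (RtoC (- / x ^ 2) * f (/ x)%R) = RtoC (/ x ^ 2) * f (/ x)%R)%C. rewrite RtoC_opp. ring.
Qed.

(* [dom_kernel d] is comparable to min(x^(d-1), x^(-d-1)) and, unlike it, has an elementary primitive. *)
Definition dom_kernel (d x : R) : R := / (x * (2 + exp (d * ln x) + exp (- (d * ln x)))).
Definition dom_primitive (d x : R) : R := - / (1 + exp (d * ln x)).

Lemma dom_kernel_pos (d x : R) : 0 < x -> 0 < dom_kernel d x.
Proof.
  intros Hx. apply Rinv_0_lt_compat, Rmult_lt_0_compat; [exact Hx|].
  pose proof (exp_pos (d * ln x)). pose proof (exp_pos (- (d * ln x))). lra.
Qed.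

Lemma dom_primitive_derive (d x : R) :
  0 < x -> is_derive (dom_primitive d) x (d * dom_kernel d x).
Proof.
  intros Hx. unfold dom_primitive, dom_kernel.
  pose proof (exp_pos (d * ln x)) as He.
  auto_derive; [split; lra|].
  rewrite exp_Ropp. field. repeat split; nra.
Qed.

Lemma continuous_dom_kernel (d x : R) : 0 < x -> continuous (dom_kernel d) x.
Proof.
  intros Hx. apply (ex_derive_continuous (dom_kernel d)). unfold dom_kernel. auto_derive.
  repeat split; try lra. apply Rmult_integral_contrapositive. split; [lra|].
  pose proof (exp_pos (d * ln x)). pose proof (exp_pos (- (d * ln x))). lra.
Qed.

Lemma RInt_dom_kernel (d a b : R) :
  0 < d -> 0 < a -> 0 < b ->
  is_RInt (dom_kernel d) a b ((dom_primitive d b - dom_primitive d a) / d).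
Proof.
  intros Hd Ha Hb.
  assert (H : is_RInt (fun x => d * dom_kernel d x) a b (dom_primitive d b - dom_primitive d a)).
  { apply (@is_RInt_derive R_CompleteNormedModule (dom_primitive d) (fun x => d * dom_kernel d x)).
    - intros x Hx. apply dom_primitive_derive, Rlt_le_trans with (2 := proj1 Hx). now apply Rmin_pos.
    - intros x Hx. apply (@continuous_scal_r R_UniformSpace R_AbsRing R_NormedModule d).
      apply continuous_dom_kernel, Rlt_le_trans with (2 := proj1 Hx). now apply Rmin_pos. }
  apply (@is_RInt_scal R_NormedModule _ _ _ (/ d)) in H.
  eapply is_RInt_ext; [|replace ((dom_primitive d b - dom_primitive d a) / d) with (/ d * (dom_primitive d b - dom_primitive d a)) by (unfold Rdiv; ring); exact H].
  intros x _. change (@eq R (/ d * (d * dom_kernel d x)) (dom_kernel d x)). field. lra.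
Qed.

Lemma dom_primitive_bounds (d x : R) : -1 < dom_primitive d x < 0.
Proof.
  unfold dom_primitive. pose proof (exp_pos (d * ln x)) as He.
  assert (0 < / (1 + exp (d * ln x))) by (apply Rinv_0_lt_compat; lra).
  assert (/ (1 + exp (d * ln x)) < 1) by (rewrite <- Rinv_1; apply Rinv_lt_contravar; lra).
  lra.
Qed.

Lemma dom_primitive_at_0 (d eps : R) :
  0 < d -> 0 < eps -> exists h, 0 < h <= 1 /\ forall x, 0 < x < h -> dom_primitive d x + 1 < eps.
Proof.
  intros Hd He. exists (Rmin (exp (ln eps / d)) 1).
  split; [split; [apply Rmin_pos; [apply exp_pos | lra] | apply Rmin_r]|].
  intros x [Hx1 Hx2].
  assert (H : exp (d * ln x) < eps).
  { rewrite <- (exp_ln eps He). apply exp_increasing.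
    assert (K : ln x < ln eps / d).
    { rewrite <- (ln_exp (ln eps / d)). apply ln_increasing; [exact Hx1|].
      apply Rlt_le_trans with (1 := Hx2), Rmin_l. }
    apply Rmult_lt_compat_l with (r := d) in K; [|exact Hd].
    replace (d * (ln eps / d)) with (ln eps) in K by (field; lra). exact K. }
  unfold dom_primitive. pose proof (exp_pos (d * ln x)) as Hp.
  replace (- / (1 + exp (d * ln x)) + 1) with (exp (d * ln x) / (1 + exp (d * ln x))) by (field; lra).
  apply Rle_lt_trans with (2 := H).
  apply Rmult_le_reg_r with (1 + exp (d * ln x)); [lra|].
  unfold Rdiv. rewrite Rmult_assoc, Rinv_l by lra. nra.
Qed.

Lemma dom_primitive_at_infty (d eps : R) :
  0 < d -> 0 < eps -> exists M, 1 <= M /\ forall x, M < x -> - dom_primitive d x < eps.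
Proof.
  intros Hd He. exists (Rmax (exp (ln (/ eps) / d)) 1).
  split; [apply Rmax_r|]. intros x Hx.
  assert (Hie : 0 < / eps) by now apply Rinv_0_lt_compat.
  assert (H : / eps < exp (d * ln x)).
  { rewrite <- (exp_ln (/ eps) Hie) at 1. apply exp_increasing.
    assert (K : ln (/ eps) / d < ln x).
    { rewrite <- (ln_exp (ln (/ eps) / d)). apply ln_increasing; [apply exp_pos|].
      apply Rle_lt_trans with (2 := Hx), Rmax_l. }
    apply Rmult_lt_compat_l with (r := d) in K; [|exact Hd].
    replace (d * (ln (/ eps) / d)) with (ln (/ eps)) in K by (field; lra). exact K. }
  unfold dom_primitive. rewrite Ropp_involutive, <- (Rinv_inv eps).
  apply Rinv_lt_contravar; [apply Rmult_lt_0_compat; lra | lra].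
Qed.

(** Continuity together with one majorant whose tails are explicit stands in for Lebesgue theory: it
    yields both existence of the improper integral and dominated convergence. *)
Definition dominated (f : R -> C) (K d : R) : Prop :=
  0 < d /\ (forall x, 0 < x -> Ccontinuous f x) /\ (forall x, 0 < x -> Cmod (f x) <= K * dom_kernel d x).

Lemma dominated_nonneg f K d : dominated f K d -> 0 <= K.
Proof.
  intros [_ [_ H]]. specialize (H 1 Rlt_0_1). pose proof (Cmod_ge_0 (f 1)).
  pose proof (dom_kernel_pos d 1 Rlt_0_1). nra.
Qed.

Lemma dominated_RInt_le (f : R -> C) (K d a b : R) (y : C) :
  dominated f K d -> 0 < a <= b -> is_CRInt f a b y ->
  Cmod y <= K / d * (dom_primitive d b - dom_primitive d a).
Proof.
  intros [Hd [Hc Hf]] Hab Hy. rewrite <- norm_C_R.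
  apply (@norm_RInt_le C_R_NormedModule f (fun x => K * dom_kernel d x) a b y); [lra | | exact Hy | ].
  - intros x Hx. rewrite norm_C_R. apply Hf. lra.
  - replace (K / d * (dom_primitive d b - dom_primitive d a))
      with (scal K ((dom_primitive d b - dom_primitive d a) / d) : R).
    + apply (@is_RInt_scal R_NormedModule), RInt_dom_kernel; lra.
    + change (@eq R (K * ((dom_primitive d b - dom_primitive d a) / d)) (K / d * (dom_primitive d b - dom_primitive d a))).
      field. lra.
Qed.

Lemma is_CRInt_Chasles (f : R -> C) (a b c : R) (l m : C) :
  is_CRInt f a b l -> is_CRInt f b c m -> is_CRInt f a c (l + m)%C.
Proof. intros H1 H2. exact (@is_RInt_Chasles C_R_NormedModule f a b c l m H1 H2). Qed.

Lemma dominated_RInt_diff (f : R -> C) (K d a b a' b' : R) (y y' : C) :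
  dominated f K d -> 0 < a' <= a -> a <= b -> b <= b' ->
  is_CRInt f a b y -> is_CRInt f a' b' y' ->
  Cmod (y' - y)%C <= K / d * ((dom_primitive d a + 1) + (- dom_primitive d b)).
Proof.
  intros HD Ha Hab Hb Hy Hy'.
  pose proof (proj1 (proj2 HD)) as Hc. pose proof (proj1 HD) as Hd.
  pose proof (ex_CRInt_cont f a' a Hc ltac:(lra) ltac:(lra)) as I1.
  pose proof (ex_CRInt_cont f b b' Hc ltac:(lra) ltac:(lra)) as I2.
  pose proof (is_CRInt_Chasles _ _ _ _ _ _ (is_CRInt_Chasles _ _ _ _ _ _ I1 Hy) I2) as I3.
  assert (E : y' = (CRInt f a' a + y + CRInt f b b')%C).
  { rewrite <- (@is_RInt_unique C_R_CompleteNormedModule _ _ _ _ Hy').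
    exact (@is_RInt_unique C_R_CompleteNormedModule _ _ _ _ I3). }
  replace (y' - y)%C with (CRInt f a' a + CRInt f b b')%C.
  2: { rewrite E. generalize (CRInt f a' a), (CRInt f b b'). intros u v. ring. }
  pose proof (dominated_RInt_le f K d a' a _ HD ltac:(lra) I1) as B1.
  pose proof (dominated_RInt_le f K d b b' _ HD ltac:(lra) I2) as B2.
  eapply Rle_trans; [apply Cmod_triangle|].
  pose proof (dom_primitive_bounds d a'). pose proof (dom_primitive_bounds d b').
  assert (HK : 0 <= K / d).
  { apply Rmult_le_pos; [now apply (dominated_nonneg f K d) | apply Rlt_le, Rinv_0_lt_compat; lra]. }
  nra.
Qed.

Lemma dominated_small (d K eps : R) : 0 < d -> 0 <= K -> 0 < eps ->
  exists h M, 0 < h <= 1 /\ 1 <= M /\ forall a b, 0 < a < h -> M < b ->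
    K / d * ((dom_primitive d a + 1) + (- dom_primitive d b)) < eps.
Proof.
  intros Hd HK He.
  assert (HK' : 0 <= K / d) by (apply Rmult_le_pos; [exact HK | apply Rlt_le, Rinv_0_lt_compat; lra]).
  set (e := eps / (2 * (K / d + 1))).
  assert (He' : 0 < e) by (apply Rdiv_lt_0_compat; lra).
  destruct (dom_primitive_at_0 d e Hd He') as [h [Hh H1]].
  destruct (dom_primitive_at_infty d e Hd He') as [M [HM H2]].
  exists h, M. split; [exact Hh|]. split; [exact HM|]. intros a b Ha Hb.
  specialize (H1 a Ha). specialize (H2 b Hb).
  assert (E : (K / d + 1) * (2 * e) = eps) by (unfold e; field; lra).
  pose proof (dom_primitive_bounds d a). nra.
Qed.

(** Cauchy criterion: integrals over larger intervals all lie within eps/2 of the one over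
    [[h / 2, M + 1]]. *)
Lemma dominated_is_CI (f : R -> C) (K d : R) : dominated f K d -> exists l, is_CI f l.
Proof.
  intros HD. pose proof (proj1 HD) as Hd. pose proof (dominated_nonneg f K d HD) as HK.
  destruct HD as [_ [Hc Hf]]. assert (HD : dominated f K d) by (split; [|split]; assumption).
  apply (@filterlimi_locally_cauchy (R * R) C_R_CompleteNormedModule
    (filter_prod (at_right 0) (Rbar_locally p_infty)) _ (fun ab => is_CRInt f (fst ab) (snd ab))).
  - apply (Filter_prod _ _ _ (fun a => 0 < a) (fun b => 0 < b)).
    + exists (mkposreal 1 Rlt_0_1). intros y _ Hy. exact Hy.
    + now exists 0.
    + intros a b Ha Hb. split.
      * exists (CRInt f a b). now apply ex_CRInt_cont.
      * intros y1 y2 H1 H2.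
        now rewrite <- (@is_RInt_unique C_R_CompleteNormedModule _ _ _ _ H1),
                    <- (@is_RInt_unique C_R_CompleteNormedModule _ _ _ _ H2).
  - intros eps.
    destruct (dominated_small d K (eps / 2) Hd HK ltac:(pose proof (cond_pos eps); lra)) as [h [M [Hh [HM H]]]].
    exists (fun ab => 0 < fst ab < h / 2 /\ M + 1 < snd ab).
    split.
    + apply (Filter_prod _ _ _ (fun a => 0 < a < h / 2) (fun b => M + 1 < b)).
      * assert (Hh2 : 0 < h / 2) by lra.
        exists (mkposreal (h / 2) Hh2). intros y Hy Hy0. split; [exact Hy0|].
        change (Rabs (y - 0) < h / 2) in Hy. rewrite Rminus_0_r in Hy.
        apply Rle_lt_trans with (2 := Hy), Rle_abs.
      * now exists (M + 1).
      * intros a b Ha Hb. now split.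
    + intros [a b] [a' b'] [Ha Hb] [Ha' Hb'] y y' Hy Hy'. cbn [fst snd] in *.
      apply C_NormedModule_mixin_compat1.
      assert (I : is_CRInt f (h / 2) (M + 1) (CRInt f (h / 2) (M + 1))) by (apply ex_CRInt_cont; trivial; lra).
      specialize (H (h / 2) (M + 1) ltac:(lra) ltac:(lra)).
      pose proof (dominated_RInt_diff f K d (h / 2) (M + 1) a b _ y HD ltac:(lra) ltac:(lra) ltac:(lra) I Hy) as B1.
      pose proof (dominated_RInt_diff f K d (h / 2) (M + 1) a' b' _ y' HD ltac:(lra) ltac:(lra) ltac:(lra) I Hy') as B2.
      revert B1 B2. generalize (CRInt f (h / 2) (M + 1)). intros x B1 B2.
      change (Cmod (y' - y)%C < eps).
      replace (y' - y)%C with ((y' - x) + - (y - x))%C by ring.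
      eapply Rle_lt_trans; [apply Cmod_triangle|]. rewrite Cmod_opp. lra.
Qed.

Lemma dominated_CI_tail (f : R -> C) (K d a b : R) (y l : C) :
  dominated f K d -> is_CI f l -> 0 < a -> a <= b -> is_CRInt f a b y ->
  Cmod (l - y)%C <= K / d * ((dom_primitive d a + 1) + (- dom_primitive d b)).
Proof.
  intros HD Hl Ha Hab Hy. apply Rnot_lt_le. intros Hlt.
  set (B := K / d * ((dom_primitive d a + 1) + (- dom_primitive d b))) in *.
  destruct (proj1 (is_CI_eps f l) Hl (Cmod (l - y)%C - B) ltac:(lra)) as [h [M [Hh [HM H]]]].
  set (a' := Rmin a (h / 2)). set (b' := Rmax b (M + 1)).
  assert (Ha' : 0 < a') by (apply Rmin_pos; lra).
  destruct (H a' b') as [y' [Hy' Hc]].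
  - split; [exact Ha'|]. apply Rle_lt_trans with (h / 2); [apply Rmin_r | lra].
  - apply Rlt_le_trans with (M + 1); [lra | apply Rmax_r].
  - pose proof (dominated_RInt_diff f K d a b a' b' y y' HD (conj Ha' (Rmin_l _ _)) Hab (Rmax_l _ _) Hy Hy') as K1.
    fold B in K1.
    replace (l - y)%C with (- (y' - l) + (y' - y))%C in Hc, Hlt by ring.
    pose proof (Cmod_triangle (- (y' - l))%C (y' - y)%C) as T. rewrite Cmod_opp in T.
    replace (- (y' - l) + (y' - y))%C with (l - y)%C in * by ring. lra.
Qed.

(** The common majorant makes the tails uniformly small, so uniform convergence on compact intervals
    is enough. *)
Lemma CI_dominated_convergence (F : nat -> R -> C) (f : R -> C) (K d : R) (L : nat -> C) (l : C) :
  (forall n, dominated (F n) K d) -> dominated f K d ->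
  (forall n, is_CI (F n) (L n)) -> is_CI f l ->
  (forall a b eps, 0 < a -> 0 < eps -> eventually (fun n => forall x, a <= x <= b -> Cmod (F n x - f x)%C <= eps)) ->
  filterlim L eventually (@locally C_UniformSpace l).
Proof.
  intros HF Hf HL Hl Hu. apply Clim_eps; [apply eventually_filter|]. intros eps Heps.
  pose proof (proj1 Hf) as Hd. pose proof (dominated_nonneg f K d Hf) as HK.
  destruct (dominated_small d K (eps / 4) Hd HK ltac:(lra)) as [h [M [Hh [HM H]]]].
  set (a := h / 2). set (b := M + 1).
  assert (Ha : 0 < a < h) by (unfold a; lra). assert (Hb : M < b) by (unfold b; lra).
  assert (Hab : 0 < b - a) by (unfold a, b; lra).
  specialize (H a b Ha Hb).
  destruct (Hu a b (eps / 4 / (b - a)) (proj1 Ha) ltac:(apply Rdiv_lt_0_compat; lra)) as [N HN].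
  exists N. intros n Hn. specialize (HN n Hn).
  pose proof (ex_CRInt_cont (F n) a b (proj1 (proj2 (HF n))) ltac:(lra) ltac:(lra)) as I1.
  pose proof (ex_CRInt_cont f a b (proj1 (proj2 Hf)) ltac:(lra) ltac:(lra)) as I2.
  pose proof (dominated_CI_tail (F n) K d a b _ _ (HF n) (HL n) ltac:(lra) ltac:(lra) I1) as T1.
  pose proof (dominated_CI_tail f K d a b _ _ Hf Hl ltac:(lra) ltac:(lra) I2) as T2.
  assert (T3 : Cmod (CRInt (F n) a b - CRInt f a b)%C <= eps / 4).
  { pose proof (@is_RInt_minus C_R_NormedModule _ _ a b _ _ I1 I2) as I3.
    pose proof (@norm_RInt_le_const C_R_NormedModule _ a b _ (eps / 4 / (b - a)) ltac:(lra)
      (fun x Hx => eq_ind_r (fun t => t <= _) (HN x Hx) (norm_C_R _)) I3) as B.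
    rewrite norm_C_R in B.
    replace ((b - a) * (eps / 4 / (b - a))) with (eps / 4) in B by (field; lra). exact B. }
  revert T1 T2 T3. generalize (CRInt (F n) a b), (CRInt f a b). intros x y T1 T2 T3.
  replace (L n - l)%C with ((L n - x) + (x - y) + - (l - y))%C by ring.
  eapply Rle_lt_trans; [apply Cmod_triangle|]. rewrite Cmod_opp.
  pose proof (Cmod_triangle (L n - x)%C (x - y)%C). lra.
Qed.

(** The lower bound [c] on one interval of length 1 makes strict positivity of an integral
    accessible, besides nonnegativity. *)
Lemma is_CI_Re_ge (f : R -> C) (l : C) (c : R) :
  (forall x, 0 < x -> Ccontinuous f x) ->
  (forall x, 0 < x -> 0 <= Re (f x)) -> (forall x, 1 <= x <= 2 -> c <= Re (f x)) ->
  is_CI f l -> c <= Re l.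
Proof.
  intros Hc H0 H1 Hl. apply Rnot_lt_le. intros Hlt.
  destruct (proj1 (is_CI_eps f l) Hl (c - Re l) ltac:(lra)) as [h [M [Hh [HM H]]]].
  destruct (H (h / 2) (M + 2) ltac:(lra) ltac:(lra)) as [y [Hy1 Hy2]].
  assert (Hy : c <= Re y).
  { pose proof (is_CRInt_Re _ _ _ _ (ex_CRInt_cont f (h / 2) 1 Hc ltac:(lra) ltac:(lra))) as I1.
    pose proof (is_CRInt_Re _ _ _ _ (ex_CRInt_cont f 1 2 Hc ltac:(lra) ltac:(lra))) as I2.
    pose proof (is_CRInt_Re _ _ _ _ (ex_CRInt_cont f 2 (M + 2) Hc ltac:(lra) ltac:(lra))) as I3.
    pose proof (@is_RInt_Chasles R_NormedModule _ _ _ _ _ _ (@is_RInt_Chasles R_NormedModule _ _ _ _ _ _ I1 I2) I3) as I4.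
    apply is_CRInt_Re in Hy1.
    apply (@is_RInt_unique R_CompleteNormedModule) in Hy1. apply (@is_RInt_unique R_CompleteNormedModule) in I4.
    rewrite Hy1 in I4. rewrite I4.
    assert (Z : forall u v, u <= v -> is_RInt (fun _ : R => 0) u v 0).
    { intros u v _. eapply is_RInt_ext; [|replace 0 with (scal (v - u) 0 : R); [apply @is_RInt_const|]].
      - reflexivity.
      - change (@eq R ((v - u) * 0) 0). ring. }
    assert (B1 : 0 <= Re (CRInt f (h / 2) 1)) by (apply (is_RInt_le _ _ (h / 2) 1 _ _ ltac:(lra) (Z (h / 2) 1 ltac:(lra)) I1); intros; apply H0; lra).
    assert (B3 : 0 <= Re (CRInt f 2 (M + 2))) by (apply (is_RInt_le _ _ 2 (M + 2) _ _ ltac:(lra) (Z 2 (M + 2) ltac:(lra)) I3); intros; apply H0; lra).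
    assert (B2 : (2 - 1) * c <= Re (CRInt f 1 2)) by (apply (is_RInt_le _ _ 1 2 _ _ ltac:(lra) (@is_RInt_const R_NormedModule 1 2 c) I2); intros; apply H1; lra).
    change (c <= Re (CRInt f (h / 2) 1) + Re (CRInt f 1 2) + Re (CRInt f 2 (M + 2))). lra. }
  pose proof (re_le_Cmod (y - l)%C) as K.
  assert (E : Re (y - l)%C = Re y - Re l) by (unfold Re; cbn; ring).
  rewrite E in K. pose proof (Rle_abs (Re y - Re l)). lra.
Qed.

(** * Mellin transforms of theta series *)

Definition mellin_kernel (w : C) (x : R) : C := Cexp ((w - 1) * RtoC (ln x)).

Lemma Cmod_mellin_kernel (w : C) (x : R) : Cmod (mellin_kernel w x) = exp ((Re w - 1) * ln x).
Proof. unfold mellin_kernel. rewrite Cmod_Cexp. f_equal. unfold Re. cbn. ring. Qed.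

Lemma mellin_kernel_scale (w : C) (c x : R) :
  0 < c -> 0 < x -> mellin_kernel w (c * x) = (mellin_kernel w c * mellin_kernel w x)%C.
Proof.
  intros Hc Hx. unfold mellin_kernel. rewrite ln_mult, <- Cexp_plus by assumption.
  f_equal. rewrite RtoC_plus. ring.
Qed.

Lemma Cderive_mellin_kernel (w : C) (x : R) :
  0 < x -> Cderive (mellin_kernel w) x ((w - 1) * RtoC (/ x) * mellin_kernel w x)%C.
Proof.
  intros Hx. unfold mellin_kernel.
  eapply Cderive_ext_val; [|exact (Cderive_Cexp _ x _ (Cderive_mult _ _ x _ _
      (Cderive_const (w - 1)%C x) (Cderive_RtoC _ x (/ x) (is_derive_ln x Hx))))]. cbv beta. ring.
Qed.

Lemma Ccontinuous_mellin_kernel (w : C) (x : R) : 0 < x -> Ccontinuous (mellin_kernel w) x.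
Proof. intros Hx. eapply Cderive_continuous, Cderive_mellin_kernel, Hx. Qed.

Lemma Ccontinuous_eps (f : R -> C) (x : R) :
  Ccontinuous f x <-> (forall eps, 0 < eps -> locally x (fun y => Cmod (f y - f x)%C < eps)).
Proof. apply Clim_eps. apply (locally_filter x). Qed.

Lemma Ccontinuous_mult (f g : R -> C) (x : R) :
  Ccontinuous f x -> Ccontinuous g x -> Ccontinuous (fun y => f y * g y)%C x.
Proof.
  intros Hf Hg.
  rewrite Ccontinuous_eps in *. intros eps Heps.
  pose proof (Cmod_ge_0 (f x)) as P1. pose proof (Cmod_ge_0 (g x)) as P2.
  set (e1 := Rmin 1 (eps / (2 * (Cmod (g x) + 1)))).
  set (e2 := Rmin 1 (eps / (2 * (Cmod (f x) + 1)))).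
  assert (H1 : 0 < e1) by (apply Rmin_pos; [lra | apply Rdiv_lt_0_compat; lra]).
  assert (H2 : 0 < e2) by (apply Rmin_pos; [lra | apply Rdiv_lt_0_compat; lra]).
  generalize (filter_and _ _ (Hf e1 H1) (Hg e2 H2)). apply filter_imp. intros y [K1 K2].
  replace (f y * g y - f x * g x)%C with ((f y - f x) * (g y - g x) + (f y - f x) * g x + f x * (g y - g x))%C by ring.
  eapply Rle_lt_trans; [apply Cmod_triangle|].
  eapply Rle_lt_trans; [apply Rplus_le_compat_r, Cmod_triangle|]. rewrite !Cmod_mult.
  pose proof (Cmod_ge_0 (f y - f x)%C). pose proof (Cmod_ge_0 (g y - g x)%C).
  assert (B1 : e1 * (Cmod (g x) + 1) <= eps / 2).
  { replace (eps / 2) with (eps / (2 * (Cmod (g x) + 1)) * (Cmod (g x) + 1)) by (field; lra).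
    apply Rmult_le_compat_r; [lra | apply Rmin_r]. }
  assert (B2 : e2 * (Cmod (f x) + 1) <= eps / 2).
  { replace (eps / 2) with (eps / (2 * (Cmod (f x) + 1)) * (Cmod (f x) + 1)) by (field; lra).
    apply Rmult_le_compat_r; [lra | apply Rmin_r]. }
  pose proof (Rmin_l 1 (eps / (2 * (Cmod (f x) + 1)))). fold e2 in H3.
  assert (Cmod (f y - f x)%C * Cmod (g y - g x)%C <= e1) by nra.
  assert (Cmod (f y - f x)%C * Cmod (g x) <= e1 * Cmod (g x)) by (apply Rmult_le_compat_r; lra).
  assert (Cmod (f x) * Cmod (g y - g x)%C <= Cmod (f x) * e2) by (apply Rmult_le_compat_l; lra).
  nra.
Qed.

Lemma Ccontinuous_plus (f g : R -> C) (x : R) :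
  Ccontinuous f x -> Ccontinuous g x -> Ccontinuous (fun y => f y + g y)%C x.
Proof. exact (@continuous_plus R_UniformSpace C_AbsRing C_NormedModule f g x). Qed.

Lemma Ccontinuous_minus (f g : R -> C) (x : R) :
  Ccontinuous f x -> Ccontinuous g x -> Ccontinuous (fun y => f y - g y)%C x.
Proof. exact (@continuous_minus R_UniformSpace C_AbsRing C_NormedModule f g x). Qed.

Lemma Ccontinuous_comp_scale (f : R -> C) (c x : R) :
  Ccontinuous f (c * x) -> Ccontinuous (fun y => f (c * y)) x.
Proof.
  intros H. apply (@continuous_comp R_UniformSpace R_UniformSpace C_UniformSpace (fun y => c * y) f x); [|exact H].
  apply (ex_derive_continuous (fun y => c * y)). auto_derive. easy.
Qed.

Lemma Ccontinuous_of_modulus (f : R -> C) (F : R -> R) (C x : R) :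
  0 <= C -> continuous F x ->
  locally x (fun y => Cmod (f y - f x)%C <= C * Rabs (F y - F x)) -> Ccontinuous f x.
Proof.
  intros HC HF H. apply Ccontinuous_eps. intros eps Heps.
  assert (He : 0 < eps / (C + 1)) by (apply Rdiv_lt_0_compat; lra).
  pose proof (proj1 (filterlim_locally F (F x)) HF (mkposreal _ He)) as K.
  generalize (filter_and _ _ H K). apply filter_imp. intros y [H1 H2].
  change (Rabs (F y - F x) < eps / (C + 1)) in H2.
  apply Rle_lt_trans with (1 := H1).
  apply Rle_lt_trans with (C * (eps / (C + 1))); [apply Rmult_le_compat_l; lra|].
  replace (C * (eps / (C + 1))) with (eps - eps / (C + 1)) by (field; lra). lra.
Qed.

(** The origin of the Dirichlet terms: replacing [x] by [n * x] multiplies the Mellin transform by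
    n^(-w). *)
Lemma is_CI_mellin_scale (F : R -> C) (w J : C) (c : R) :
  0 < c -> is_CI (fun x => F x * mellin_kernel w x)%C J ->
  is_CI (fun x => F (c * x)%R * mellin_kernel w x)%C (Cexp (- w * RtoC (ln c)) * J)%C.
Proof.
  intros Hc H. apply (is_CI_comp_scale _ _ c Hc) in H.
  apply (is_CI_scal _ _ (/ mellin_kernel w c)%C) in H.
  replace (Cexp (- w * RtoC (ln c)) * J)%C with (/ mellin_kernel w c * (RtoC (/ c) * J))%C.
  - eapply is_CI_ext; [|exact H]. intros x Hx. cbv beta.
    rewrite mellin_kernel_scale by assumption. field. apply Cexp_neq_0.
  - unfold mellin_kernel. rewrite <- Cexp_opp.
    rewrite <- (exp_ln c Hc) at 2. rewrite <- exp_Ropp, <- Cexp_RtoC, Cmult_assoc, <- Cexp_plus.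
    f_equal. f_equal. rewrite RtoC_opp. ring.
Qed.

Lemma dominated_of_bounds (f : R -> C) (K d p q : R) :
  0 < d -> d <= p -> d <= q -> 0 <= K ->
  (forall x, 0 < x -> Ccontinuous f x) ->
  (forall x, 0 < x <= 1 -> Cmod (f x) <= K * exp ((p - 1) * ln x)) ->
  (forall x, 1 <= x -> Cmod (f x) <= K * exp ((- q - 1) * ln x)) ->
  dominated f (K * 4) d.
Proof.
  intros Hd Hp Hq HK Hc H0 H1. split; [exact Hd|]. split; [exact Hc|].
  (* Here [e] is [p] near 0 and [- q] near infinity. The conditions say that x^e, x^(e+d) and
     x^(e-d) are at most 1, and the constant is 2 + 1 + 1. *)
  assert (Hgen : forall x e, 0 < x -> e * ln x <= 0 -> (e + d) * ln x <= 0 -> (e - d) * ln x <= 0 ->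
    exp ((e - 1) * ln x) <= 4 * dom_kernel d x).
  { intros x e Hx E1 E2 E3. unfold dom_kernel.
    pose proof (exp_pos (d * ln x)) as P1. pose proof (exp_pos (- (d * ln x))) as P2.
    assert (P3 : 0 < x * (2 + exp (d * ln x) + exp (- (d * ln x)))) by (apply Rmult_lt_0_compat; lra).
    apply Rmult_le_reg_r with (x * (2 + exp (d * ln x) + exp (- (d * ln x)))); [exact P3|].
    rewrite Rmult_assoc, Rinv_l by lra.
    replace (exp ((e - 1) * ln x)) with (exp (e * ln x) * / x).
    - replace (exp (e * ln x) * / x * (x * (2 + exp (d * ln x) + exp (- (d * ln x)))))
        with (2 * exp (e * ln x) + exp (e * ln x) * exp (d * ln x) + exp (e * ln x) * exp (- (d * ln x))) by (field; lra).
      rewrite <- !exp_plus.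
      assert (forall t, t <= 0 -> exp t <= 1) as L by (intros t Ht; rewrite <- exp_0; now apply exp_le_compat).
      pose proof (L (e * ln x) E1).
      pose proof (L (e * ln x + d * ln x) ltac:(lra)).
      pose proof (L (e * ln x + - (d * ln x)) ltac:(lra)). lra.
    - rewrite <- (exp_ln x Hx) at 2. rewrite <- exp_Ropp, <- exp_plus. f_equal. ring. }
  intros x Hx.
  destruct (Rle_lt_dec x 1) as [Hx1|Hx1].
  - assert (HL : ln x <= 0) by (rewrite <- ln_1; now apply ln_le_compat).
    apply Rle_trans with (1 := H0 x (conj Hx Hx1)).
    rewrite Rmult_assoc. apply Rmult_le_compat_l; [exact HK|]. apply Hgen; trivial; nra.
  - assert (HL : 0 <= ln x) by (rewrite <- ln_1; apply ln_le_compat; lra).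
    apply Rle_trans with (1 := H1 x (Rlt_le _ _ Hx1)).
    rewrite Rmult_assoc. apply Rmult_le_compat_l; [exact HK|]. apply Hgen; trivial; nra.
Qed.

(** The middle clause bounds the variation of [G] by that of a decreasing function. Alternating
    sums, Riemann sums and differences of theta series are all estimated by telescoping through
    it. *)
Definition decaying (G : R -> C) (C : R) : Prop :=
  (forall x, Ccontinuous G x) /\
  (forall a b, 0 <= a <= b -> Cmod (G a - G b)%C <= C * (exp (- a) - exp (- b))) /\
  (forall a, 0 <= a -> Cmod (G a) <= C * exp (- a)).

Lemma decaying_nonneg G C : decaying G C -> 0 <= C.
Proof.
  intros [_ [_ H]]. specialize (H 0 (Rle_refl 0)). rewrite Ropp_0, exp_0, Rmult_1_r in H.
  apply Rle_trans with (2 := H), Cmod_ge_0.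
Qed.

Lemma exp_ge_monomial (m : nat) (x : R) : 0 <= x -> x ^ m <= INR (fact m) * exp x.
Proof.
  intros Hx.
  assert (Hnn : forall k, 0 <= x ^ k / INR (fact k)).
  { intros k. apply Rmult_le_pos; [now apply pow_le | apply Rlt_le, Rinv_0_lt_compat, INR_fact_lt_0]. }
  assert (H : x ^ m / INR (fact m) <= exp x).
  { apply Rle_trans with (sum_n (fun n => x ^ n / INR (fact n)) m).
    - destruct m as [|m]; [rewrite sum_O; apply Rle_refl|].
      rewrite sum_n_S_R. pose proof (sum_n_nonneg_incr _ 0 m Hnn (Nat.le_0_l m)) as K.
      rewrite sum_O in K. specialize (Hnn 0%nat). lra.
    - apply sum_n_le_series; [exact Hnn | apply is_series_exp]. }
  pose proof (INR_fact_lt_0 m).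
  replace (x ^ m) with (INR (fact m) * (x ^ m / INR (fact m))) by (field; lra).
  apply Rmult_le_compat_l; lra.
Qed.

(** [K] depends on [w] alone, so all partial sums of the alternating theta series obtain the same
    majorant. It comes from x^n exp(-x) <= n! with an integer n >= Re w + 1. *)
Lemma decaying_mellin_dominated (w : C) :
  0 < Re w -> exists K, 0 <= K /\ forall (F : R -> C) (C d : R),
    0 <= C -> 0 < d -> d <= Re w -> d <= 1 ->
    (forall x, 0 < x -> Ccontinuous F x) ->
    (forall x, 0 < x -> Cmod (F x) <= C * exp (- x)) ->
    dominated (fun x => F x * mellin_kernel w x)%C (C * K) d.
Proof.
  intros Hw.
  destruct (nfloor_ex (Re w + 1) ltac:(lra)) as [m [_ Hm]].
  set (n := S m). assert (Hn : Re w + 1 <= INR n) by (unfold n; rewrite S_INR; lra).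
  set (K := INR (fact n) + 1).
  assert (HK : 1 <= K) by (unfold K; pose proof (INR_fact_lt_0 n); lra).
  exists (K * 4). split; [lra|]. intros F C d HC Hd Hd1 Hd2 Hc HF.
  rewrite <- Rmult_assoc.
  apply (dominated_of_bounds _ (C * K) d (Re w) 1); trivial.
  - apply Rmult_le_pos; lra.
  - intros x Hx. apply Ccontinuous_mult; [now apply Hc | now apply Ccontinuous_mellin_kernel].
  - intros x Hx. rewrite Cmod_mult, Cmod_mellin_kernel.
    apply Rmult_le_compat_r; [apply Rlt_le, exp_pos|].
    apply Rle_trans with (1 := HF x (proj1 Hx)).
    apply Rmult_le_compat_l; [exact HC|]. apply Rle_trans with 1; [|exact HK].
    rewrite <- exp_0. apply exp_le_compat. lra.
  - intros x Hx. rewrite Cmod_mult, Cmod_mellin_kernel.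
    assert (HL : 0 <= ln x) by (rewrite <- ln_1; apply ln_le_compat; lra).
    apply Rle_trans with (C * exp (- x) * exp ((Re w - 1) * ln x)).
    + apply Rmult_le_compat_r; [apply Rlt_le, exp_pos|]. apply HF. lra.
    + rewrite !Rmult_assoc. apply Rmult_le_compat_l; [exact HC|].
      replace (exp ((Re w - 1) * ln x)) with (exp ((- 1 - 1) * ln x) * exp ((Re w + 1) * ln x))
        by (rewrite <- exp_plus; f_equal; ring).
      rewrite (Rmult_comm K), Rmult_comm, Rmult_assoc.
      apply Rmult_le_compat_l; [apply Rlt_le, exp_pos|].
      apply Rle_trans with (x ^ n * exp (- x)).
      * apply Rmult_le_compat_r; [apply Rlt_le, exp_pos|].
        rewrite <- (exp_ln (x ^ n)) by (apply pow_lt; lra).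
        rewrite ln_pow by lra. apply exp_le_compat. nra.
      * apply Rle_trans with (INR (fact n) * exp x * exp (- x)).
        -- apply Rmult_le_compat_r; [apply Rlt_le, exp_pos|]. apply exp_ge_monomial. lra.
        -- rewrite Rmult_assoc, <- exp_plus, Rplus_opp_r, exp_0. unfold K. lra.
Qed.

Definition theta_sum (G : R -> C) (x : R) : C := CSeries (fun n => G (INR (S n) * x)).

Lemma is_series_exp_geom (x : R) : 0 < x ->
  is_series (fun n => exp (- (INR (S n) * x))) (/ (exp x - 1)).
Proof.
  intros Hx.
  assert (H1 : 1 < exp x) by (rewrite <- exp_0; now apply exp_increasing).
  assert (Hq : 0 < exp (- x) < 1).
  { split; [apply exp_pos|]. rewrite <- exp_0. apply exp_increasing. lra. }
  apply (is_series_ext (V := R_NormedModule) (fun n => scal (exp (- x)) (exp (- x) ^ n))).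
  - intros n. change (@eq R (exp (- x) * exp (- x) ^ n) (exp (- (INR (S n) * x)))).
    change (exp (- x) * exp (- x) ^ n) with (exp (- x) ^ (S n)).
    rewrite exp_pow_INR. f_equal. ring.
  - replace (/ (exp x - 1)) with (scal (exp (- x)) (/ (1 - exp (- x))) : R).
    + apply (is_series_scal (V := R_NormedModule)), is_series_geom. rewrite Rabs_pos_eq; lra.
    + change (@eq R (exp (- x) * / (1 - exp (- x))) (/ (exp x - 1))).
      rewrite exp_Ropp. field. split; lra.
Qed.

(** * Theta series of a decaying function and their alternating form *)

Section Muntz.

Variables (G : R -> C) (A : R).
Hypothesis HG : decaying G A.

Let HA : 0 <= A := decaying_nonneg G A HG.

Lemma theta_sum_correct (x : R) : 0 < x ->
  is_Cseries (fun n => G (INR (S n) * x)) (theta_sum G x).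
Proof.
  intros Hx.
  destruct (Cseries_dominated (fun n => G (INR (S n) * x)) (fun n => A * exp (- (INR (S n) * x)))) as [l Hl].
  - intros n. apply HG. apply Rmult_le_pos; [apply pos_INR | lra].
  - apply (ex_series_scal (V := R_NormedModule)). eexists. now apply is_series_exp_geom.
  - unfold theta_sum. now rewrite (CSeries_unique _ _ Hl).
Qed.

Lemma theta_sum_bound (x : R) : 0 < x -> Cmod (theta_sum G x) <= A * / (exp x - 1).
Proof.
  intros Hx.
  apply (norm_series_le (V := C_NormedModule) _ (fun n => A * exp (- (INR (S n) * x))) _ _) with (2 := theta_sum_correct x Hx).
  - intros n. apply HG. apply Rmult_le_pos; [apply pos_INR | lra].
  - apply (is_series_scal (V := R_NormedModule)), is_series_exp_geom, Hx.
Qed.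

Lemma theta_sum_diff (x y : R) : 0 < x <= y ->
  Cmod (theta_sum G x - theta_sum G y)%C <= A * (/ (exp x - 1) - / (exp y - 1)).
Proof.
  intros Hxy.
  apply (norm_series_le (V := C_NormedModule) (fun n => G (INR (S n) * x) - G (INR (S n) * y))%C
    (fun n => A * (exp (- (INR (S n) * x)) - exp (- (INR (S n) * y))))).
  - intros n. apply HG. pose proof (pos_INR (S n)). nra.
  - apply is_Cseries_minus; apply theta_sum_correct; lra.
  - apply (is_series_scal (V := R_NormedModule)).
    apply (is_series_minus (V := R_NormedModule)); apply is_series_exp_geom; lra.
Qed.

(** The majorant of the differences sums in closed form to 1/(exp x - 1), whose continuity is
    inherited. *)
Lemma Ccontinuous_theta_sum (x : R) : 0 < x -> Ccontinuous (theta_sum G) x.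
Proof.
  intros Hx.
  apply (Ccontinuous_of_modulus _ (fun y => / (exp y - 1)) A).
  - exact HA.
  - apply (ex_derive_continuous (fun y => / (exp y - 1))). auto_derive.
    assert (1 < exp x) by (rewrite <- exp_0; now apply exp_increasing). lra.
  - exists (mkposreal x Hx). intros y Hy. change (Rabs (y - x) < x) in Hy.
    apply Rabs_def2 in Hy. destruct (Rle_lt_dec y x) as [H|H].
    + eapply Rle_trans; [apply theta_sum_diff; lra|].
      apply Rmult_le_compat_l; [exact HA | apply Rle_abs].
    + rewrite <- Cmod_opp.
      replace (- (theta_sum G y - theta_sum G x))%C with (theta_sum G x - theta_sum G y)%C by ring.
      eapply Rle_trans; [apply theta_sum_diff; lra|].
      apply Rmult_le_compat_l; [exact HA|]. rewrite Rabs_minus_sym. apply Rle_abs.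
Qed.

Lemma ex_CRInt_everywhere (a b : R) : is_CRInt G a b (CRInt G a b).
Proof.
  apply (@RInt_correct C_R_CompleteNormedModule).
  apply (@ex_RInt_continuous C_R_CompleteNormedModule). intros z _. apply HG.
Qed.

(** On each cell the error is at most [x] times the variation bound, and these bounds telescope; the
    total stays below [x * A] for every number of cells. *)
Lemma riemann_sum_error (x : R) (N : nat) : 0 < x ->
  Cmod (RtoC x * Csum (fun n => G (INR (S n) * x)) N - CRInt G 0 (INR (S N) * x))%C
    <= x * (A * (1 - exp (- (INR (S N) * x)))).
Proof.
  intros Hx.
  assert (Hstep : forall n, Cmod (RtoC x * G (INR (S n) * x) - CRInt G (INR n * x) (INR (S n) * x))%C
    <= x * (A * (exp (- (INR n * x)) - exp (- (INR (S n) * x))))).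
  { intros n. pose proof (pos_INR n) as Hn.
    pose proof (@is_RInt_const C_R_NormedModule (INR n * x) (INR (S n) * x) (G (INR (S n) * x))) as I1.
    rewrite scal_R_Cmult in I1.
    pose proof (@is_RInt_minus C_R_NormedModule _ _ _ _ _ _ I1 (ex_CRInt_everywhere (INR n * x) (INR (S n) * x))) as I2.
    assert (Ed : INR (S n) * x - INR n * x = x) by (rewrite S_INR; ring).
    apply (@norm_RInt_le_const C_R_NormedModule _ _ _ _ (A * (exp (- (INR n * x)) - exp (- (INR (S n) * x))))) in I2.
    - rewrite norm_C_R, Ed in I2. exact I2.
    - rewrite S_INR. nra.
    - intros u Hu. rewrite norm_C_R.
      change (Cmod (G (INR (S n) * x) - G u)%C <= A * (exp (- (INR n * x)) - exp (- (INR (S n) * x)))).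
      rewrite <- Cmod_opp. replace (- (G (INR (S n) * x) - G u))%C with (G u - G (INR (S n) * x))%C by ring.
      eapply Rle_trans; [apply HG; split; [nra | apply Hu]|].
      apply Rmult_le_compat_l; [exact HA|].
      apply Rplus_le_compat_r. apply exp_le_compat. lra. }
  induction N as [|N IH].
  - rewrite sum_O. specialize (Hstep 0%nat). cbn [INR] in *. rewrite Rmult_0_l, Ropp_0, exp_0 in Hstep. exact Hstep.
  - specialize (Hstep (S N)).
    rewrite (sum_Sn (G := C_NormedModule)).
    assert (E : CRInt G 0 (INR (S (S N)) * x) = (CRInt G 0 (INR (S N) * x) + CRInt G (INR (S N) * x) (INR (S (S N)) * x))%C).
    { apply (@is_RInt_unique C_R_CompleteNormedModule).
      apply (is_CRInt_Chasles G 0 (INR (S N) * x)); apply ex_CRInt_everywhere. }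
    rewrite E. revert IH Hstep.
    generalize (Csum (fun n => G (INR (S n) * x)) N), (CRInt G 0 (INR (S N) * x)), (CRInt G (INR (S N) * x) (INR (S (S N)) * x)).
    intros u v t H1 H2.
    change (plus u (G (INR (S (S N)) * x))) with (u + G (INR (S (S N)) * x))%C.
    replace (RtoC x * (u + G (INR (S (S N)) * x)) - (v + t))%C
      with ((RtoC x * u - v) + (RtoC x * G (INR (S (S N)) * x) - t))%C by ring.
    eapply Rle_trans; [apply Cmod_triangle|]. lra.
Qed.

Variable I : C.
Hypothesis HI : filterlim (fun b => CRInt G 0 b) (Rbar_locally p_infty) (@locally C_UniformSpace I).

(** The Riemann sum estimate in the limit of infinitely many cells, divided by the mesh [x]. Near 0
    the theta series is thus I/x up to a bounded term. *)
Lemma theta_sum_near_integral (x : R) : 0 < x -> Cmod (theta_sum G x - I / RtoC x)%C <= A.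
Proof.
  intros Hx.
  assert (H : Cmod (RtoC x * theta_sum G x - I)%C <= x * A).
  { apply le_epsilon. intros eps Heps.
    assert (H1 : forall eps, 0 < eps -> Rbar_locally p_infty (fun b => Cmod (CRInt G 0 b - I)%C < eps)).
    { apply Clim_eps; [apply Rbar_locally_filter | exact HI]. }
    destruct (H1 (eps / 2) ltac:(lra)) as [B HB].
    assert (H2 : forall eps, 0 < eps -> eventually (fun N => Cmod (Csum (fun n => G (INR (S n) * x)) N - theta_sum G x)%C < eps)).
    { apply Clim_eps; [apply eventually_filter | now apply theta_sum_correct]. }
    destruct (H2 (eps / 2 / x) ltac:(apply Rdiv_lt_0_compat; lra)) as [N1 HN1].
    destruct (nfloor_ex (Rmax 0 (B / x)) (Rmax_l _ _)) as [N2 [_ HN2]].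
    set (N := max N1 N2).
    specialize (HN1 N (Nat.le_max_l _ _)).
    assert (HBN : B < INR (S N) * x).
    { apply Rmult_lt_reg_r with (/ x); [now apply Rinv_0_lt_compat|].
      rewrite Rmult_assoc, Rinv_r, Rmult_1_r by lra.
      apply Rle_lt_trans with (1 := Rmax_r 0 (B / x)). apply Rlt_le_trans with (1 := HN2).
      rewrite S_INR. apply Rplus_le_compat_r, le_INR, Nat.le_max_r. }
    specialize (HB _ HBN).
    pose proof (riemann_sum_error x N Hx) as HR.
    revert HN1 HB HR. generalize (Csum (fun n => G (INR (S n) * x)) N), (CRInt G 0 (INR (S N) * x)).
    intros u v HN1 HB HR.
    replace (RtoC x * theta_sum G x - I)%C
      with (- (RtoC x * (u - theta_sum G x)) + (RtoC x * u - v) + (v - I))%C by ring.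
    eapply Rle_trans; [apply Cmod_triangle|].
    eapply Rle_trans; [apply Rplus_le_compat_r, Cmod_triangle|].
    rewrite Cmod_opp, Cmod_mult, Cmod_R, Rabs_pos_eq by lra.
    assert (x * Cmod (u - theta_sum G x)%C <= eps / 2).
    { replace (eps / 2) with (x * (eps / 2 / x)) by (field; lra). apply Rmult_le_compat_l; lra. }
    assert (x * (A * (1 - exp (- (INR (S N) * x)))) <= x * A).
    { apply Rmult_le_compat_l; [lra|]. pose proof (exp_pos (- (INR (S N) * x))). nra. }
    lra. }
  replace (theta_sum G x - I / RtoC x)%C with (RtoC (/ x) * (RtoC x * theta_sum G x - I))%C.
  - rewrite Cmod_mult, Cmod_R, Rabs_pos_eq by (apply Rlt_le, Rinv_0_lt_compat, Hx).
    apply Rmult_le_reg_l with x; [exact Hx|]. rewrite <- Rmult_assoc, Rinv_r, Rmult_1_l by lra. exact H.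
  - rewrite RtoC_inv by lra. field. apply RtoC_neq_0. lra.
Qed.

Definition theta_reduced (x : R) : C := (theta_sum G x - I / RtoC x)%C.

(** The strip appears here: boundedness near 0 needs [Re w > 0], and the term I/x that survives at
    infinity needs [Re w < 1]. *)
Lemma theta_reduced_dominated (w : C) :
  0 < Re w < 1 -> dominated (fun x => theta_reduced x * mellin_kernel w x)%C ((A + Cmod I) * 4) (Rmin (Re w) (1 - Re w)).
Proof.
  intros Hw. pose proof (Cmod_ge_0 I) as HI0.
  apply (dominated_of_bounds _ _ _ (Re w) (1 - Re w)).
  - apply Rmin_pos; lra.
  - apply Rmin_l.
  - apply Rmin_r.
  - lra.
  - intros x Hx. apply Ccontinuous_mult; [|now apply Ccontinuous_mellin_kernel].
    apply Ccontinuous_minus; [now apply Ccontinuous_theta_sum|].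
    apply (@continuous_ext_loc R_UniformSpace C_UniformSpace (fun y => I / RtoC y)%C (fun y => I * RtoC (/ y)%R)%C x).
    + exists (mkposreal x Hx). intros y Hy. change (Rabs (y - x) < x) in Hy.
      apply Rabs_def2 in Hy. rewrite RtoC_inv by lra. reflexivity.
    + eapply Cderive_continuous. apply Cderive_mult; [apply Cderive_const|].
      apply (Cderive_RtoC (fun y => / y) x (- / x ^ 2)). auto_derive; [lra|]. field. lra.
  - intros x Hx. rewrite Cmod_mult, Cmod_mellin_kernel.
    apply Rmult_le_compat_r; [apply Rlt_le, exp_pos|].
    apply Rle_trans with A; [now apply theta_sum_near_integral | lra].
  - intros x Hx. rewrite Cmod_mult, Cmod_mellin_kernel.
    replace ((- (1 - Re w) - 1) * ln x) with (- ln x + (Re w - 1) * ln x) by ring.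
    rewrite exp_plus, <- Rmult_assoc.
    apply Rmult_le_compat_r; [apply Rlt_le, exp_pos|].
    rewrite exp_Ropp, exp_ln by lra.
    unfold theta_reduced. replace (theta_sum G x - I / RtoC x)%C with (theta_sum G x + - (I / RtoC x))%C by ring.
    eapply Rle_trans; [apply Cmod_triangle|].
    rewrite Cmod_opp, Cmod_div, Cmod_R, Rabs_pos_eq by (try lra; apply RtoC_neq_0; lra).
    rewrite Rmult_plus_distr_r. apply Rplus_le_compat_r.
    apply Rle_trans with (1 := theta_sum_bound x ltac:(lra)).
    apply Rmult_le_compat_l; [exact HA|].
    pose proof (exp_ineq1_le x). apply Rinv_le_contravar; lra.
Qed.

Lemma is_CI_Csum (f : nat -> R -> C) (L : nat -> C) (N : nat) :
  (forall k, is_CI (f k) (L k)) -> is_CI (fun x => Csum (fun k => f k x) N) (Csum L N).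
Proof.
  intros H. induction N as [|N IH].
  - rewrite sum_O. eapply is_CI_ext; [|apply H]. intros x _. now rewrite sum_O.
  - rewrite sum_Sn. eapply is_CI_ext; [|exact (is_CI_plus _ _ _ _ IH (H (S N)))].
    intros x _. now rewrite sum_Sn.
Qed.

Lemma Ccontinuous_Csum (f : nat -> R -> C) (N : nat) (x : R) :
  (forall k, Ccontinuous (f k) x) -> Ccontinuous (fun y => Csum (fun k => f k y) N) x.
Proof.
  intros H. induction N as [|N IH].
  - apply (@continuous_ext R_UniformSpace C_UniformSpace (f 0%nat)); [|apply H]. intros y. now rewrite sum_O.
  - apply (@continuous_ext R_UniformSpace C_UniformSpace (fun y => Csum (fun k => f k y) N + f (S N) y)%C).
    + intros y. now rewrite sum_Sn.
    + apply Ccontinuous_plus; [exact IH | apply H].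
Qed.

Definition alt_theta_term (k : nat) (x : R) : C :=
  (G (INR (2 * k + 1) * x) - G (INR (2 * k + 2) * x))%C.

Lemma alt_theta_partial (K : nat) (x : R) :
  0 < x ->
  Csum (fun k => alt_theta_term k x) K =
  (Csum (fun n => G (INR (S n) * x)) (S (2 * K)) - 2 * Csum (fun n => G (INR (S n) * (2 * x))) K)%C.
Proof.
  intros Hx.
  apply (Csum_alternating (fun n => G (INR (S n) * x)) (fun n => G (INR (S n) * (2 * x)))).
  - intros k. f_equal. replace (S (S (2 * k))) with (2 * S k)%nat by lia. rewrite mult_INR. change (INR 2) with (1 + 1). ring.
  - intros k. unfold alt_theta_term. f_equal.
    + now replace (2 * k + 1)%nat with (S (2 * k)) by lia.
    + f_equal. replace (2 * k + 2)%nat with (2 * S k)%nat by lia. rewrite mult_INR. change (INR 2) with (1 + 1). ring.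
Qed.

(** The variation bounds over the intervals from (2k+1)x to (2k+2)x are disjoint, so the estimate is
    uniform in [K] and finite down to [x = 0]. The plain partial sums, which approach I/x near 0,
    have no such bound. *)
Lemma alt_theta_bound (K : nat) (x : R) :
  0 < x -> Cmod (Csum (fun k => alt_theta_term k x) K) <= A * exp (- x).
Proof.
  intros Hx.
  assert (H : sum_n (fun k => A * (exp (- (INR (2 * k + 1) * x)) - exp (- (INR (2 * k + 2) * x)))) K
     <= A * (exp (- x) - exp (- (INR (2 * K + 2) * x)))).
  { induction K as [|K IH].
    - rewrite sum_O. change (INR (2 * 0 + 1)) with 1. rewrite Rmult_1_l. apply Rle_refl.
    - rewrite sum_n_S_R. apply Rle_trans with (1 := Rplus_le_compat_r _ _ _ IH).
      rewrite <- Rmult_plus_distr_l. apply Rmult_le_compat_l; [exact HA|].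
      assert (exp (- (INR (2 * S K + 1) * x)) <= exp (- (INR (2 * K + 2) * x))).
      { apply exp_le_compat.
        assert (INR (2 * K + 2) <= INR (2 * S K + 1)) by (apply le_INR; lia). nra. }
      lra. }
  apply Rle_trans with (sum_n (fun k => A * (exp (- (INR (2 * k + 1) * x)) - exp (- (INR (2 * k + 2) * x)))) K).
  - apply (norm_sum_n (V := C_NormedModule)). intros k _. apply HG.
    assert (INR (2 * k + 1) <= INR (2 * k + 2)) by (apply le_INR; lia).
    pose proof (pos_INR (2 * k + 1)). split; [apply Rmult_le_pos | apply Rmult_le_compat_r]; lra.
  - apply Rle_trans with (1 := H). apply Rmult_le_compat_l; [exact HA|].
    pose proof (exp_pos (- (INR (2 * K + 2) * x))). lra.
Qed.

Definition alt_theta (x : R) : C := (theta_sum G x - 2 * theta_sum G (2 * x))%C.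

Lemma theta_sum_tail (x : R) (N : nat) : 0 < x ->
  Cmod (theta_sum G x - Csum (fun n => G (INR (S n) * x)) N)%C <= A * (exp (- (INR (S N) * x)) / (exp x - 1)).
Proof.
  intros Hx.
  assert (H1 : 1 < exp x) by (rewrite <- exp_0; now apply exp_increasing).
  eapply Rle_trans.
  - apply (norm_series_tail (V := C_NormedModule) _ (fun n => A * exp (- (INR (S n) * x))) _ (A * / (exp x - 1)) N)
      with (2 := theta_sum_correct x Hx).
    + intros n. apply HG. apply Rmult_le_pos; [apply pos_INR | lra].
    + apply (is_series_scal (V := R_NormedModule)), is_series_exp_geom, Hx.
  - apply Req_le. induction N as [|N IH].
    + rewrite sum_O. change (INR 1) with 1. rewrite Rmult_1_l, exp_Ropp. field. split; lra.
    + rewrite sum_n_S_R.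
      replace (A * / (exp x - 1) - (sum_n (fun n => A * exp (- (INR (S n) * x))) N + A * exp (- (INR (S (S N)) * x))))
        with (A * / (exp x - 1) - sum_n (fun n => A * exp (- (INR (S n) * x))) N - A * exp (- (INR (S (S N)) * x))) by ring.
      rewrite IH. rewrite (S_INR (S N)).
      replace (- (INR (S N) * x)) with (- ((INR (S N) + 1) * x) + x) by ring. rewrite exp_plus. field. lra.
Qed.

(** The factor 3 collects one theta tail at [x] and twice one at [2 * x]. *)
Lemma alt_theta_error (K : nat) (x : R) : 0 < x ->
  Cmod (Csum (fun k => alt_theta_term k x) K - alt_theta x)%C <= 3 * A / (exp x - 1) * exp (- (INR (2 * K + 2) * x)).
Proof.
  intros Hx. rewrite alt_theta_partial by exact Hx. unfold alt_theta.
  assert (H1 : 1 < exp x) by (rewrite <- exp_0; now apply exp_increasing).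
  assert (H2 : exp x <= exp (2 * x)) by (apply exp_le_compat; lra).
  pose proof (theta_sum_tail x (S (2 * K)) Hx) as T1.
  pose proof (theta_sum_tail (2 * x) K ltac:(lra)) as T2.
  replace (INR (S (S (2 * K))) * x) with (INR (2 * K + 2) * x) in T1 by (now replace (2 * K + 2)%nat with (S (S (2 * K))) by lia).
  replace (INR (S K) * (2 * x)) with (INR (2 * K + 2) * x) in T2
    by (replace (2 * K + 2)%nat with (2 * S K)%nat by lia; rewrite mult_INR; change (INR 2) with (1 + 1); ring).
  revert T1 T2. generalize (Csum (fun n => G (INR (S n) * x)) (S (2 * K))), (Csum (fun n => G (INR (S n) * (2 * x))) K).
  intros u v T1 T2.
  replace (u - 2 * v - (theta_sum G x - 2 * theta_sum G (2 * x)))%C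
    with (- (theta_sum G x - u) + 2 * (theta_sum G (2 * x) - v))%C by ring.
  eapply Rle_trans; [apply Cmod_triangle|]. rewrite Cmod_opp, Cmod_mult, Cmod_R, Rabs_pos_eq by lra.
  set (E := exp (- (INR (2 * K + 2) * x))) in *.
  assert (HE : 0 < E) by apply exp_pos.
  assert (H3 : A * (E / (exp (2 * x) - 1)) <= A * (E / (exp x - 1))).
  { apply Rmult_le_compat_l; [exact HA|]. apply Rmult_le_compat_l; [lra|]. apply Rinv_le_contravar; lra. }
  replace (3 * A / (exp x - 1) * E) with (3 * (A * (E / (exp x - 1)))) by (field; lra). lra.
Qed.

Lemma alt_theta_error_uniform (a eps : R) : 0 < a -> 0 < eps ->
  eventually (fun K => forall x, a <= x -> Cmod (Csum (fun k => alt_theta_term k x) K - alt_theta x)%C <= eps).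
Proof.
  intros Ha Heps.
  assert (H1 : 1 < exp a) by (rewrite <- exp_0; now apply exp_increasing).
  set (B := 3 * A / (exp a - 1)).
  assert (HB : 0 <= B) by (apply Rmult_le_pos; [lra | apply Rlt_le, Rinv_0_lt_compat; lra]).
  destruct (nfloor_ex (Rmax 0 (B / (eps * a))) (Rmax_l _ _)) as [N [_ HN]].
  exists N. intros K HK x Hx.
  eapply Rle_trans; [apply alt_theta_error; lra|].
  assert (H2 : exp a <= exp x) by now apply exp_le_compat.
  assert (HNK : INR N + 1 <= INR (2 * K + 2)).
  { rewrite <- S_INR. apply le_INR. lia. }
  pose proof (pos_INR N) as HN0.
  set (t := INR (2 * K + 2)) in *.
  assert (HBt : B <= eps * (t * a)).
  { apply Rmult_le_reg_r with (/ (eps * a)); [apply Rinv_0_lt_compat; nra|].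
    replace (eps * (t * a) * / (eps * a)) with t by (field; lra).
    change (B * / (eps * a)) with (B / (eps * a)). pose proof (Rmax_r 0 (B / (eps * a))). lra. }
  apply Rle_trans with (B * exp (- (t * a))).
  - apply Rmult_le_compat.
    + apply Rmult_le_pos; [lra | apply Rlt_le, Rinv_0_lt_compat; lra].
    + apply Rlt_le, exp_pos.
    + apply Rmult_le_compat_l; [lra|]. apply Rinv_le_contravar; lra.
    + apply exp_le_compat. nra.
  - rewrite exp_Ropp. pose proof (exp_ineq1_le (t * a)) as He. pose proof (exp_pos (t * a)).
    apply Rmult_le_reg_r with (exp (t * a)); [lra|].
    rewrite Rmult_assoc, Rinv_l, Rmult_1_r by lra. nra.
Qed.

End Muntz.

(* The Dirichlet series of zeta does not converge in the strip; its alternating version does, and it corresponds to Theta(x) - 2 Theta(2x),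
   in which the singular term I/x cancels. *)
Lemma muntz (zeta : C -> C) (G : R -> C) (B : R) (I w M : C) :
  is_riemann_zeta zeta -> decaying G B ->
  filterlim (fun b => CRInt G 0 b) (Rbar_locally p_infty) (@locally C_UniformSpace I) ->
  0 < Re w < 1 -> is_CI (fun x => G x * mellin_kernel w x)%C M ->
  is_CI (fun x => theta_reduced G I x * mellin_kernel w x)%C (zeta w * M)%C.
Proof.
  intros Hzeta HG HI Hw HM.
  pose proof (decaying_nonneg G B HG) as HB.
  destruct (dominated_is_CI _ _ _ (theta_reduced_dominated G B HG I HI w Hw)) as [J HJ].
  (* Scaling by 2 multiplies the transform by 2^(-w), so subtracting twice the scaled copy produces
     [eta_factor w]; the two multiples of I/x cancel. *)
  assert (HA : is_CI (fun x => alt_theta G x * mellin_kernel w x)%C (eta_factor w * J)%C).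
  { pose proof (is_CI_mellin_scale (theta_reduced G I) w J 2 ltac:(lra) HJ) as H2.
    pose proof (is_CI_minus _ _ _ _ HJ (is_CI_scal _ _ 2 H2)) as H3.
    replace (eta_factor w * J)%C with (J - 2 * (Cexp (- w * RtoC (ln 2)) * J))%C by (unfold eta_factor; ring).
    eapply is_CI_ext; [|exact H3]. intros x Hx. cbv beta. unfold theta_reduced, alt_theta.
    rewrite RtoC_mult. field. apply RtoC_neq_0. lra. }
  destruct (decaying_mellin_dominated w (proj1 Hw)) as [K [HK Hdom]].
  set (d := Rmin (Re w) 1).
  assert (Hd : 0 < d) by (apply Rmin_pos; lra).
  assert (Hterm : forall k x, 0 < x -> Ccontinuous (alt_theta_term G k) x).
  { intros k x Hx. apply Ccontinuous_minus; apply Ccontinuous_comp_scale, HG. }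
  assert (Hpart : forall n x, 0 < x -> Ccontinuous (fun y => Csum (fun k => alt_theta_term G k y) n) x).
  { intros n x Hx. apply Ccontinuous_Csum. intros k. now apply Hterm. }
  (* The transforms of the partial sums are the partial sums of the eta series times [M]. Their
     limit is computed twice, as the integral of [alt_theta] and as [M * eta w]; [eta_factor w] then
     cancels. *)
  assert (Hlim : filterlim (fun n => (Csum (eta_term w) n * M)%C) eventually (@locally C_UniformSpace (eta_factor w * J)%C)).
  { apply (CI_dominated_convergence
      (fun n x => Csum (fun k => alt_theta_term G k x) n * mellin_kernel w x)%C
      (fun x => alt_theta G x * mellin_kernel w x)%C (B * K) d).
    - intros n. apply Hdom; trivial; [apply Rmin_l | apply Rmin_r | now apply Hpart | ].
      intros x Hx. now apply alt_theta_bound.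
    - apply Hdom; trivial; [apply Rmin_l | apply Rmin_r | | ].
      + intros x Hx. apply Ccontinuous_minus; [now apply (Ccontinuous_theta_sum G B HG)|].
        apply Ccontinuous_mult; [eapply Cderive_continuous, Cderive_const|].
        apply Ccontinuous_comp_scale, (Ccontinuous_theta_sum G B HG). lra.
      + intros x Hx. apply le_epsilon. intros eps Heps.
        destruct (alt_theta_error_uniform G B HG x eps Hx Heps) as [N HN].
        specialize (HN N (Nat.le_refl N) x (Rle_refl x)).
        pose proof (alt_theta_bound G B HG N x Hx) as HBd.
        revert HN HBd. generalize (Csum (fun k => alt_theta_term G k x) N). intros u HN HBd.
        replace (alt_theta G x) with (u + - (u - alt_theta G x))%C by ring.
        eapply Rle_trans; [apply Cmod_triangle|]. rewrite Cmod_opp. lra.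
    - intros n.
      eapply is_CI_ext; [|replace (Csum (eta_term w) n * M)%C with (Csum (fun k => eta_term w k * M)%C n)
        by apply Csum_mult_r; apply (is_CI_Csum (fun k x => alt_theta_term G k x * mellin_kernel w x)%C)].
      + intros x _. apply Csum_mult_r.
      + intros k. unfold eta_term.
        assert (Hs : forall m, (0 < m)%nat -> is_CI (fun x => G (INR m * x)%R * mellin_kernel w x)%C (Cexp (- w * RtoC (ln (INR m))) * M)%C).
        { intros m Hm. apply is_CI_mellin_scale; [now apply lt_0_INR | exact HM]. }
        pose proof (is_CI_minus _ _ _ _ (Hs (2 * k + 1)%nat ltac:(lia)) (Hs (2 * k + 2)%nat ltac:(lia))) as H.
        match goal with |- is_CI _ ?l => match type of H with is_CI _ ?l' => replace l with l' by ring end end.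
        eapply is_CI_ext; [|exact H]. intros x _. unfold alt_theta_term. cbv beta. ring.
    - exact HA.
    - intros a b eps Ha Heps.
      set (S := exp ((Re w - 1) * ln a) + exp ((Re w - 1) * ln b)).
      assert (HS : 0 < S) by (unfold S; pose proof (exp_pos ((Re w - 1) * ln a)); pose proof (exp_pos ((Re w - 1) * ln b)); lra).
      generalize (alt_theta_error_uniform G B HG a (eps / S) Ha ltac:(now apply Rdiv_lt_0_compat)).
      apply filter_imp. intros n Hn x Hx. specialize (Hn x (proj1 Hx)).
      revert Hn. generalize (Csum (fun k => alt_theta_term G k x) n). intros u Hn.
      replace (u * mellin_kernel w x - alt_theta G x * mellin_kernel w x)%C
        with ((u - alt_theta G x) * mellin_kernel w x)%C by ring.
      rewrite Cmod_mult, Cmod_mellin_kernel.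
      replace eps with (eps / S * S) by (field; lra).
      apply Rmult_le_compat; [apply Cmod_ge_0 | apply Rlt_le, exp_pos | exact Hn|].
      unfold S. apply Rle_trans with (exp ((Re w - 1) * ln a)).
      + apply exp_le_compat. assert (ln a <= ln x) by (apply ln_le_compat; lra). nra.
      + pose proof (exp_pos ((Re w - 1) * ln b)). lra. }
  assert (Heta : is_Cseries (eta_term w) (eta w)).
  { replace w with (w + 0)%C by ring. apply eta_correct; [lra | rewrite Cmod_0; lra]. }
  assert (Hlim2 : filterlim (fun n => (Csum (eta_term w) n * M)%C) eventually (@locally C_UniformSpace (M * eta w)%C)).
  { apply (filterlim_ext (fun n => scal M (Csum (eta_term w) n))).
    - intros n. apply Cmult_comm.
    - eapply filterlim_comp; [exact Heta | apply (filterlim_scal_r (V := C_NormedModule))]. }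
  pose proof (Clim_unique _ _ _ Hlim Hlim2) as E.
  rewrite (eta_zeta zeta w Hzeta Hw) in E.
  assert (EJ : J = (zeta w * M)%C).
  { pose proof (eta_factor_neq_0 w (proj2 Hw)) as Hne.
    replace J with (/ eta_factor w * (eta_factor w * J))%C by (field; exact Hne).
    rewrite E. field. exact Hne. }
  rewrite <- EJ. exact HJ.
Qed.

(** * The functional equation of the theta series *)

(* [walk n k] is C(2n, n+k) / 4^n. *)
Fixpoint walk (n : nat) (k : Z) : R :=
  match n with
  | O => if Z.eq_dec k 0 then 1 else 0
  | S n => (walk n (k - 1) + 2 * walk n k + walk n (k + 1)) / 4
  end.

Lemma walk_nonneg n k : 0 <= walk n k.
Proof.
  revert k. induction n as [|n IH]; intros k; cbn [walk].
  - destruct Z.eq_dec; lra.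
  - pose proof (IH (k - 1)%Z). pose proof (IH k). pose proof (IH (k + 1)%Z). lra.
Qed.

Lemma walk_opp n k : walk n (- k) = walk n k.
Proof.
  revert k. induction n as [|n IH]; intros k; cbn [walk].
  - destruct (Z.eq_dec (- k) 0), (Z.eq_dec k 0); lia || reflexivity.
  - replace (- k - 1)%Z with (- (k + 1))%Z by lia. replace (- k + 1)%Z with (- (k - 1))%Z by lia.
    rewrite !IH. lra.
Qed.

Lemma walk_support n k : (Z.of_nat n < Z.abs k)%Z -> walk n k = 0.
Proof.
  revert k. induction n as [|n IH]; intros k Hk; cbn [walk].
  - destruct Z.eq_dec; [lia | reflexivity].
  - rewrite !IH by lia. lra.
Qed.

(** The quotient rule for neighbouring binomial coefficients, with denominators cleared so that the
    recurrence proves it without factorials. *)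
Lemma walk_ratio n k : walk n (k + 1) * (INR n + IZR k + 1) = walk n k * (INR n - IZR k).
Proof.
  revert k. induction n as [|n IH]; intros k.
  - cbn [walk]. destruct (Z.eq_dec (k + 1) 0), (Z.eq_dec k 0); try lia; cbn [INR].
    + replace k with (-1)%Z by lia. lra.
    + subst k. lra.
    + lra.
  - cbn [walk]. rewrite S_INR.
    pose proof (IH (k - 1)%Z) as H1. pose proof (IH k) as H2. pose proof (IH (k + 1)%Z) as H3.
    replace (k - 1 + 1)%Z with k in H1 by lia. rewrite minus_IZR in H1. rewrite plus_IZR in H3.
    replace (k + 1 - 1)%Z with k by lia. cbn [IZR] in *. lra.
Qed.

Lemma walk_center_pos n : 0 < walk n 0.
Proof.
  induction n as [|n IH]; cbn [walk].
  - destruct Z.eq_dec; [lra | lia].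
  - pose proof (walk_nonneg n (0 - 1)). pose proof (walk_nonneg n (0 + 1)). lra.
Qed.

Lemma walk_center_S n : walk (S n) 0 * (2 * INR n + 2) = walk n 0 * (2 * INR n + 1).
Proof.
  pose proof (walk_ratio n 0) as H. cbn [walk]. change (0 + 1)%Z with 1%Z in *.
  replace (0 - 1)%Z with (- (1))%Z by lia. rewrite walk_opp. lra.
Qed.

(** Multiply the ratios (n-i)/(n+i+1) = 1 - (2i+1)/(n+i+1) <= exp(-(2i+1)/(n+K)) over i < k; the
    first k odd numbers add up to k^2. *)
Lemma walk_upper n (k : nat) (K : R) :
  (forall i, (i < k)%nat -> INR i + 1 <= K) ->
  walk n (Z.of_nat k) <= walk n 0 * exp (- (INR k ^ 2 / (INR n + K))) \/ k = 0%nat.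
Proof.
  destruct k as [|k]; [now right|]. intros HK. left. revert HK.
  generalize (S k) as i. clear k. induction i as [|k IH]; intros HK.
  - cbn [Z.of_nat INR]. replace (- (0 ^ 2 / (INR n + K))) with 0 by (unfold Rdiv; ring). rewrite exp_0. lra.
  - assert (IH' := IH (fun i Hi => HK i ltac:(lia))). specialize (HK k ltac:(lia)).
    pose proof (walk_ratio n (Z.of_nat k)) as H.
    rewrite <- INR_IZR_INZ in H.
    replace (Z.of_nat k + 1)%Z with (Z.of_nat (S k)) in H by lia.
    pose proof (pos_INR n) as Hn. pose proof (pos_INR k) as Hk.
    pose proof (walk_nonneg n (Z.of_nat k)) as Hw.
    assert (Hd : 0 < INR n + INR k + 1) by lra.
    set (y := (2 * INR k + 1) / (INR n + K)).
    assert (Hy : (2 * INR k + 1) / (INR n + INR k + 1) >= y).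
    { apply Rle_ge. apply Rmult_le_compat_l; [lra|]. apply Rinv_le_contravar; lra. }
    assert (Hstep : walk n (Z.of_nat (S k)) <= walk n (Z.of_nat k) * exp (- y)).
    { apply Rmult_le_reg_r with (INR n + INR k + 1); [exact Hd|]. rewrite H.
      rewrite Rmult_assoc. apply Rmult_le_compat_l; [exact Hw|].
      pose proof (exp_ineq1_le (- y)).
      apply Rle_trans with ((1 - (2 * INR k + 1) / (INR n + INR k + 1)) * (INR n + INR k + 1)).
      - apply Req_le. field. lra.
      - apply Rmult_le_compat_r; lra. }
    apply Rle_trans with (1 := Hstep).
    replace (- (INR (S k) ^ 2 / (INR n + K))) with (- (INR k ^ 2 / (INR n + K)) + - y).
    + rewrite exp_plus, <- Rmult_assoc. apply Rmult_le_compat_r; [apply Rlt_le, exp_pos | exact IH'].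
    + unfold y. rewrite S_INR. field. lra.
Qed.

(** The same product from below: (n-i)/(n+i+1) is the inverse of 1 + (2i+1)/(n-i), which is at most
    exp((2i+1)/(n-K+1)). *)
Lemma walk_lower n (k : nat) (K : R) :
  (forall i, (i < k)%nat -> INR i + 1 <= K) -> K <= INR n ->
  walk n 0 * exp (- (INR k ^ 2 / (INR n - K + 1))) <= walk n (Z.of_nat k).
Proof.
  intros HK HKn. induction k as [|k IH].
  - cbn [Z.of_nat INR]. replace (- (0 ^ 2 / (INR n - K + 1))) with 0 by (unfold Rdiv; ring). rewrite exp_0. lra.
  - assert (IH' := IH (fun i Hi => HK i ltac:(lia))). specialize (HK k ltac:(lia)).
    pose proof (walk_ratio n (Z.of_nat k)) as H.
    rewrite <- INR_IZR_INZ in H.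
    replace (Z.of_nat k + 1)%Z with (Z.of_nat (S k)) in H by lia.
    pose proof (pos_INR k) as Hk.
    pose proof (walk_nonneg n (Z.of_nat k)) as Hw.
    set (y := (2 * INR k + 1) / (INR n - K + 1)).
    assert (Hy : (2 * INR k + 1) / (INR n - INR k) <= y).
    { apply Rmult_le_compat_l; [lra|]. apply Rinv_le_contravar; lra. }
    assert (Hstep : walk n (Z.of_nat k) * exp (- y) <= walk n (Z.of_nat (S k))).
    { apply Rmult_le_reg_r with (INR n + INR k + 1); [lra|]. rewrite H.
      rewrite Rmult_assoc. apply Rmult_le_compat_l; [exact Hw|].
      rewrite exp_Ropp. pose proof (exp_ineq1_le y). pose proof (exp_pos y).
      apply Rmult_le_reg_l with (exp y); [lra|]. rewrite <- Rmult_assoc, Rinv_r, Rmult_1_l by lra.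
      apply Rle_trans with ((1 + (2 * INR k + 1) / (INR n - INR k)) * (INR n - INR k)).
      - apply Req_le. field. lra.
      - apply Rmult_le_compat_r; lra. }
    apply Rle_trans with (2 := Hstep).
    replace (- (INR (S k) ^ 2 / (INR n - K + 1))) with (- (INR k ^ 2 / (INR n - K + 1)) + - y).
    + rewrite exp_plus, <- Rmult_assoc. apply Rmult_le_compat_r; [apply Rlt_le, exp_pos | exact IH'].
    + unfold y. rewrite S_INR. field. lra.
Qed.

(** * Poisson summation on a finite cycle *)

Fixpoint psum (f : nat -> R) (N : nat) : R :=
  match N with O => 0 | S k => psum f k + f k end.

Lemma psum_ext f g N : (forall k, (k < N)%nat -> f k = g k) -> psum f N = psum g N.
Proof.
  induction N as [|N IH]; intros H; [reflexivity|]. cbn [psum]. rewrite IH, H; auto with arith.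
Qed.

Lemma psum_lin3 f g h N :
  psum (fun k => (f k + 2 * g k + h k) / 4) N = (psum f N + 2 * psum g N + psum h N) / 4.
Proof. induction N as [|N IH]; cbn [psum]; [lra|]. rewrite IH. lra. Qed.

Lemma psum_scal c f N : psum (fun k => c * f k) N = c * psum f N.
Proof. induction N as [|N IH]; cbn [psum]; [ring|]. rewrite IH. ring. Qed.

Lemma psum_is_series f N : (forall k, (N <= k)%nat -> f k = 0) -> is_series f (psum f N).
Proof.
  intros H.
  assert (E : forall n, sum_n f n = psum f (S n)).
  { induction n as [|n IH]; [rewrite sum_O; exact (eq_sym (Rplus_0_l (f 0%nat)))|]. rewrite sum_n_S_R, IH. reflexivity. }
  assert (E2 : psum f (S N) = psum f N) by (cbn [psum]; rewrite H by lia; ring).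
  rewrite <- E2, <- E. apply (is_series_finite (V := R_NormedModule)). intros j Hj. apply H. lia.
Qed.

Section Finite_poisson.

Variable p : nat.
(** For an odd length the nonzero frequencies pair up as l and -l, which gives the form 1 + 2 (sum
    of [p] cosines). *)
Let m : nat := 2 * p + 1.

(** The walk projected to the cycle of length [m], with [J] windings kept in each direction. *)
Definition wrapped_walk (J n : nat) (r : Z) : R :=
  walk n r + psum (fun j => walk n (r + Z.of_nat (S j) * Z.of_nat m) + walk n (r - Z.of_nat (S j) * Z.of_nat m)) J.

(** The same walk diagonalised by the characters of the cycle: one step multiplies the frequency l
    by (1 + cos(2 PI l/m))/2 = cos(PI l/m)^2. *)
Definition wrapped_spectrum (n : nat) (r : Z) : R :=
  (1 + 2 * psum (fun l => cos (PI * INR (S l) / INR m) ^ (2 * n) * cos (2 * (PI * INR (S l) / INR m) * IZR r)) p) / INR m.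

Lemma modulus_pos : 0 < INR m.
Proof. apply lt_0_INR. unfold m. lia. Qed.

Lemma wrapped_walk_step J n r :
  wrapped_walk J (S n) r = (wrapped_walk J n (r - 1) + 2 * wrapped_walk J n r + wrapped_walk J n (r + 1)) / 4.
Proof.
  unfold wrapped_walk. cbn [walk].
  rewrite (psum_ext _ (fun j =>
    ((walk n (r - 1 + Z.of_nat (S j) * Z.of_nat m) + walk n (r - 1 - Z.of_nat (S j) * Z.of_nat m)) +
     2 * (walk n (r + Z.of_nat (S j) * Z.of_nat m) + walk n (r - Z.of_nat (S j) * Z.of_nat m)) +
     (walk n (r + 1 + Z.of_nat (S j) * Z.of_nat m) + walk n (r + 1 - Z.of_nat (S j) * Z.of_nat m))) / 4)).
  - rewrite psum_lin3. lra.
  - intros j _.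
    replace (r + Z.of_nat (S j) * Z.of_nat m - 1)%Z with (r - 1 + Z.of_nat (S j) * Z.of_nat m)%Z by ring.
    replace (r + Z.of_nat (S j) * Z.of_nat m + 1)%Z with (r + 1 + Z.of_nat (S j) * Z.of_nat m)%Z by ring.
    replace (r - Z.of_nat (S j) * Z.of_nat m - 1)%Z with (r - 1 - Z.of_nat (S j) * Z.of_nat m)%Z by ring.
    replace (r - Z.of_nat (S j) * Z.of_nat m + 1)%Z with (r + 1 - Z.of_nat (S j) * Z.of_nat m)%Z by ring.
    lra.
Qed.

Lemma wrapped_spectrum_step n r :
  wrapped_spectrum (S n) r =
  (wrapped_spectrum n (r - 1) + 2 * wrapped_spectrum n r + wrapped_spectrum n (r + 1)) / 4.
Proof.
  unfold wrapped_spectrum. pose proof modulus_pos.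
  rewrite (psum_ext (fun l => cos (PI * INR (S l) / INR m) ^ (2 * S n) * cos (2 * (PI * INR (S l) / INR m) * IZR r))
   (fun l =>
    (cos (PI * INR (S l) / INR m) ^ (2 * n) * cos (2 * (PI * INR (S l) / INR m) * IZR (r - 1)) +
     2 * (cos (PI * INR (S l) / INR m) ^ (2 * n) * cos (2 * (PI * INR (S l) / INR m) * IZR r)) +
     cos (PI * INR (S l) / INR m) ^ (2 * n) * cos (2 * (PI * INR (S l) / INR m) * IZR (r + 1))) / 4)).
  - rewrite psum_lin3. field. lra.
  - intros l _. set (x := PI * INR (S l) / INR m). rewrite minus_IZR, plus_IZR.
    replace (2 * x * (IZR r - 1)) with (2 * x * IZR r - 2 * x) by ring.
    replace (2 * x * (IZR r + 1)) with (2 * x * IZR r + 2 * x) by ring.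
    rewrite cos_minus, cos_plus, cos_2a_cos.
    replace (2 * S n)%nat with (S (S (2 * n))) by lia. cbn [pow]. field.
Qed.

Lemma wrapped_walk_0_other J r : (forall q, r <> q * Z.of_nat m)%Z -> wrapped_walk J 0 r = 0.
Proof.
  intros H. unfold wrapped_walk. cbn [walk].
  rewrite (psum_ext _ (fun _ => 0 * 0)), psum_scal.
  - destruct Z.eq_dec as [E|E]; [exfalso; apply (H 0%Z); lia | lra].
  - intros j _. destruct Z.eq_dec as [E|E]; [exfalso; apply (H (- Z.of_nat (S j))%Z); lia|].
    destruct Z.eq_dec as [E'|E']; [exfalso; apply (H (Z.of_nat (S j))%Z); lia | lra].
Qed.

Lemma wrapped_walk_0_multiple J q : (Z.abs q <= Z.of_nat J)%Z -> wrapped_walk J 0 (q * Z.of_nat m) = 1.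
Proof.
  intros Hq. unfold wrapped_walk. cbn [walk].
  assert (Hm : (0 < Z.of_nat m)%Z) by (unfold m; lia).
  assert (Hz : forall a, (if Z.eq_dec (a * Z.of_nat m) 0 then 1 else 0) = if Z.eq_dec a 0 then 1 else 0).
  { intros a. destruct (Z.eq_dec (a * Z.of_nat m) 0), (Z.eq_dec a 0); nia || reflexivity. }
  rewrite Hz.
  rewrite (psum_ext _ (fun j => (if Z.eq_dec (q + Z.of_nat (S j)) 0 then 1 else 0) + (if Z.eq_dec (q - Z.of_nat (S j)) 0 then 1 else 0))).
  2: { intros j _. rewrite <- Z.mul_add_distr_r, <- Z.mul_sub_distr_r, !Hz. reflexivity. }
  assert (Hgen : forall N, (if Z.eq_dec q 0 then 1 else 0) +
     psum (fun j => (if Z.eq_dec (q + Z.of_nat (S j)) 0 then 1 else 0) + (if Z.eq_dec (q - Z.of_nat (S j)) 0 then 1 else 0)) N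
     = if Z_le_dec (Z.abs q) (Z.of_nat N) then 1 else 0).
  { induction N as [|N IH]; cbn [psum].
    - destruct (Z.eq_dec q 0), (Z_le_dec (Z.abs q) (Z.of_nat 0)); lia || lra.
    - rewrite <- Rplus_assoc, IH.
      destruct (Z_le_dec (Z.abs q) (Z.of_nat N)), (Z_le_dec (Z.abs q) (Z.of_nat (S N))),
        (Z.eq_dec (q + Z.of_nat (S N)) 0), (Z.eq_dec (q - Z.of_nat (S N)) 0); lia || lra. }
  rewrite Hgen. destruct Z_le_dec; [reflexivity | lia].
Qed.

Lemma dirichlet_kernel x N :
  sin x * (1 + 2 * psum (fun l => cos (2 * (INR (S l) * x))) N) = sin (INR (2 * N + 1) * x).
Proof.
  induction N as [|N IH].
  - cbn [psum Nat.mul Nat.add INR]. rewrite Rmult_0_r, Rplus_0_r, Rmult_1_r, Rmult_1_l. reflexivity.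
  - cbn [psum].
    replace (sin x * (1 + 2 * (psum (fun l => cos (2 * (INR (S l) * x))) N + cos (2 * (INR (S N) * x)))))
      with (sin x * (1 + 2 * psum (fun l => cos (2 * (INR (S l) * x))) N) + 2 * (sin x * cos (2 * (INR (S N) * x)))) by ring.
    rewrite IH.
    replace (INR (2 * N + 1) * x) with (2 * (INR (S N) * x) - x)
      by (rewrite plus_INR, mult_INR, S_INR; change (INR 2) with (1 + 1); change (INR 1) with 1; ring).
    replace (INR (2 * S N + 1) * x) with (2 * (INR (S N) * x) + x)
      by (rewrite plus_INR, mult_INR; change (INR 2) with (1 + 1); change (INR 1) with 1; ring).
    rewrite sin_minus, sin_plus. ring.
Qed.

Lemma wrapped_spectrum_0_other r : (forall q, r <> q * Z.of_nat m)%Z -> wrapped_spectrum 0 r = 0.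
Proof.
  intros H. unfold wrapped_spectrum. pose proof modulus_pos as Hm.
  set (x := PI * IZR r / INR m).
  rewrite (psum_ext _ (fun l => cos (2 * (INR (S l) * x)))).
  - assert (Hs : sin x <> 0).
    { intros E. apply sin_eq_0_0 in E. destruct E as [k E]. apply (H k).
      apply eq_IZR. rewrite mult_IZR, <- INR_IZR_INZ. unfold x in E.
      assert (HPI := PI_RGT_0).
      apply Rmult_eq_reg_l with (PI / INR m); [|apply Rgt_not_eq, Rdiv_lt_0_compat; lra].
      replace (PI / INR m * IZR r) with (PI * IZR r / INR m) by (field; lra). rewrite E. field. lra. }
    pose proof (dirichlet_kernel x p) as D. fold m in D.
    assert (E : sin (INR m * x) = 0).
    { apply sin_eq_0_1. exists r. unfold x. field. lra. }
    rewrite E in D. apply Rmult_integral in D. destruct D as [D|D]; [contradiction|].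
    rewrite D. unfold Rdiv. ring.
  - intros l _. replace (2 * 0)%nat with 0%nat by lia. rewrite pow_O, Rmult_1_l. f_equal. unfold x. field. lra.
Qed.

Lemma wrapped_spectrum_0_multiple q : wrapped_spectrum 0 (q * Z.of_nat m) = 1.
Proof.
  unfold wrapped_spectrum. pose proof modulus_pos as Hm.
  rewrite (psum_ext _ (fun l => 1 * 1)).
  - assert (E : forall N, psum (fun _ => 1 * 1) N = INR N).
    { induction N as [|N IH]; [reflexivity|]. cbn [psum]. rewrite IH, S_INR. ring. }
    rewrite E. assert (Em : INR m = 2 * INR p + 1).
    { unfold m. rewrite plus_INR, mult_INR. change (INR 2) with (1 + 1). change (INR 1) with 1. ring. }
    rewrite Em. rewrite Em in Hm. field. lra.
  - intros l _. replace (2 * 0)%nat with 0%nat by lia. rewrite pow_O. f_equal.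
    rewrite mult_IZR, <- INR_IZR_INZ.
    replace (2 * (PI * INR (S l) / INR m) * (IZR q * INR m)) with (2 * (IZR (Z.of_nat (S l) * q) * PI))
      by (rewrite mult_IZR, <- INR_IZR_INZ; field; lra).
    rewrite cos_2a_sin. rewrite (sin_eq_0_1 (IZR (Z.of_nat (S l) * q) * PI)); [ring | now eexists].
Qed.

(** Both sides obey the same recurrence in [n], and at [n = 0] both are the indicator of the
    multiples of [m]. The hypothesis keeps every index that the recursion meets within the [J]
    retained windings. *)
Lemma finite_poisson J n r : (Z.abs r + Z.of_nat n <= Z.of_nat J * Z.of_nat m)%Z ->
  wrapped_walk J n r = wrapped_spectrum n r.
Proof.
  revert r. induction n as [|n IH]; intros r Hr.
  - assert (Hm : (0 < Z.of_nat m)%Z) by (unfold m; lia).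
    destruct (Z.eq_dec (r mod Z.of_nat m) 0) as [E|E].
    + apply Z.mod_divide in E; [|lia]. destruct E as [q ->].
      rewrite wrapped_walk_0_multiple, wrapped_spectrum_0_multiple; [reflexivity|].
      rewrite Z.abs_mul, (Z.abs_eq (Z.of_nat m)) in Hr by lia. nia.
    + assert (H : forall q, (r <> q * Z.of_nat m)%Z).
      { intros q ->. apply E. now rewrite Z.mod_mul by lia. }
      now rewrite wrapped_walk_0_other, wrapped_spectrum_0_other.
  - rewrite wrapped_walk_step, wrapped_spectrum_step, !IH by lia. reflexivity.
Qed.

(** [finite_poisson] at [r = 0]. The central term is factored out because the side terms have
    positive limits only relative to it. *)
Lemma polya_identity n :
  INR m * walk n 0 * (1 + 2 * psum (fun j => walk n (Z.of_nat (S j * m)) / walk n 0) n) =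
  1 + 2 * psum (fun l => cos (PI * INR (S l) / INR m) ^ (2 * n)) p.
Proof.
  pose proof (finite_poisson n n 0) as H. pose proof modulus_pos as Hm. pose proof (walk_center_pos n) as Hw.
  rewrite psum_ext with (g := fun j => / (2 * walk n 0) * (walk n (0 + Z.of_nat (S j) * Z.of_nat m) + walk n (0 - Z.of_nat (S j) * Z.of_nat m))).
  - rewrite psum_scal.
    rewrite (psum_ext (fun l => cos (PI * INR (S l) / INR m) ^ (2 * n)) (fun l => cos (PI * INR (S l) / INR m) ^ (2 * n) * cos (2 * (PI * INR (S l) / INR m) * IZR 0))).
    + unfold wrapped_walk, wrapped_spectrum in H.
      replace (INR m * walk n 0 * (1 + 2 * (/ (2 * walk n 0) *
          psum (fun j => walk n (0 + Z.of_nat (S j) * Z.of_nat m) + walk n (0 - Z.of_nat (S j) * Z.of_nat m)) n)))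
        with (INR m * (walk n 0 + psum (fun j => walk n (0 + Z.of_nat (S j) * Z.of_nat m) + walk n (0 - Z.of_nat (S j) * Z.of_nat m)) n))
        by (field; lra).
      rewrite H by (unfold m; lia). field. lra.
    + intros l _. rewrite Rmult_0_r, cos_0. ring.
  - intros j _. rewrite Z.add_0_l, Z.sub_0_l, walk_opp, <- Nat2Z.inj_mul. field. lra.
Qed.

End Finite_poisson.

(** * Bounds for the cosine, and Gaussian series *)

Lemma is_lim_seq_squeeze (u v w : nat -> R) (l : R) :
  (forall n, u n <= v n <= w n) -> is_lim_seq u l -> is_lim_seq w l -> is_lim_seq v l.
Proof. intros H Hu Hw. exact (is_lim_seq_le_le u v w l H Hu Hw). Qed.

Lemma deriv_nonneg_le (f f' : R -> R) (a b : R) :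
  a <= b -> (forall x, a <= x <= b -> is_derive f x (f' x)) -> (forall x, a <= x <= b -> 0 <= f' x) -> f a <= f b.
Proof.
  intros [Hab| ->] Hf H; [|lra].
  destruct (MVT_gen f a b f') as [c [Hc E]].
  - intros x Hx. rewrite Rmin_left, Rmax_right in Hx by lra. apply Hf. lra.
  - intros x Hx. rewrite Rmin_left, Rmax_right in Hx by lra.
    apply continuity_pt_filterlim, (ex_derive_continuous f). exists (f' x). apply Hf. lra.
  - rewrite Rmin_left, Rmax_right in Hc by lra. specialize (H c ltac:(lra)). nra.
Qed.

Lemma cos_ge_quadratic (x : R) : 0 <= x -> 1 - x ^ 2 / 2 <= cos x.
Proof.
  intros Hx.
  assert (H : cos 0 - 1 + 0 ^ 2 / 2 <= cos x - 1 + x ^ 2 / 2).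
  { apply (deriv_nonneg_le (fun x => cos x - 1 + x ^ 2 / 2) (fun x => x - sin x)); [exact Hx| |].
    - intros y _. auto_derive; [easy|]. field.
    - intros y Hy. destruct (proj1 Hy) as [Hy0|Hy0].
      + pose proof (sin_lt_x y Hy0). lra.
      + subst y. rewrite sin_0. lra. }
  rewrite cos_0 in H. lra.
Qed.

(** exp(x^2/2) cos x decreases on this interval, since x cos x <= sin x there. *)
Lemma cos_le_gaussian (x : R) : 0 <= x <= PI / 2 -> cos x <= exp (- (x ^ 2 / 2)).
Proof.
  intros Hx. pose proof PI2_3_2 as HPI.
  assert (Ht : forall y, 0 <= y <= PI / 2 -> y * cos y <= sin y).
  { intros y Hy.
    assert (H : sin 0 - 0 * cos 0 <= sin y - y * cos y).
    { apply (deriv_nonneg_le (fun x => sin x - x * cos x) (fun x => x * sin x)); [lra| |].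
      - intros z _. auto_derive; [easy|]. ring.
      - intros z Hz. apply Rmult_le_pos; [lra|]. apply sin_ge_0; lra. }
    rewrite sin_0, Rmult_0_l in H. lra. }
  assert (H : - (exp (0 ^ 2 / 2) * cos 0) <= - (exp (x ^ 2 / 2) * cos x)).
  { apply (deriv_nonneg_le (fun x => - (exp (x ^ 2 / 2) * cos x)) (fun x => exp (x ^ 2 / 2) * (sin x - x * cos x))); [lra| |].
    - intros z _. auto_derive; [easy|].
      replace (z * (z * 1)) with (z ^ 2) by ring. unfold Rdiv. field.
    - intros z Hz. apply Rmult_le_pos; [apply Rlt_le, exp_pos|]. pose proof (Ht z ltac:(lra)). lra. }
  rewrite cos_0, pow_i in H by lia. unfold Rdiv at 1 in H. rewrite Rmult_0_l, exp_0 in H.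
  rewrite exp_Ropp. apply Rmult_le_reg_l with (exp (x ^ 2 / 2)); [apply exp_pos|].
  rewrite Rinv_r by (apply Rgt_not_eq, exp_pos). lra.
Qed.

Lemma ex_series_gaussian (c : R) : 0 < c -> ex_series (fun j => exp (- (INR (S j) ^ 2 * c))).
Proof.
  intros Hc.
  apply (@ex_series_le R_AbsRing R_CompleteNormedModule _ (fun j => exp (- c) ^ j)).
  - intros j. change norm with Rabs. rewrite Rabs_pos_eq by apply Rlt_le, exp_pos.
    rewrite exp_pow_INR. apply exp_le_compat. rewrite S_INR. pose proof (pos_INR j). nra.
  - apply ex_series_geom. rewrite Rabs_pos_eq by apply Rlt_le, exp_pos.
    rewrite <- exp_0. apply exp_increasing. lra.
Qed.

Definition gauss_series (c : R) : R := Series (fun j => exp (- (INR (S j) ^ 2 * c))).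

Lemma gauss_series_correct c : 0 < c -> is_series (fun j => exp (- (INR (S j) ^ 2 * c))) (gauss_series c).
Proof. intros Hc. now apply Series_correct, ex_series_gaussian. Qed.

Lemma gauss_series_pos c : 0 < c -> 0 < gauss_series c.
Proof.
  intros Hc. apply Rlt_le_trans with (sum_n (fun j => exp (- (INR (S j) ^ 2 * c))) 0).
  - rewrite sum_O. apply exp_pos.
  - apply sum_n_le_series; [intros; apply Rlt_le, exp_pos | now apply gauss_series_correct].
Qed.

Lemma tannery_R (a : nat -> nat -> R) (b l S : nat -> R) (S0 : R) :
  (forall m n, Rabs (a m n) <= b n) -> ex_series b ->
  (forall n, is_lim_seq (fun m => a m n) (l n)) ->
  (forall m, is_series (a m) (S m)) -> is_series l S0 -> is_lim_seq S S0.
Proof. exact (@tannery R_AbsRing R_NormedModule a b l S S0). Qed.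

Definition nat_floor (r : R) : nat := Z.to_nat (up r - 1).

Lemma nat_floor_bounds (r : R) : 0 <= r -> INR (nat_floor r) <= r < INR (nat_floor r) + 1.
Proof.
  intros Hr. destruct (archimed r) as [H1 H2]. unfold nat_floor.
  assert (Hu : (0 <= up r - 1)%Z).
  { apply le_IZR. apply Rnot_lt_le. intros H. rewrite minus_IZR in H.
    assert (K : (up r < 1)%Z) by (apply lt_IZR; lra). assert (K2 : (up r <= 0)%Z) by lia. apply IZR_le in K2. lra. }
  rewrite INR_IZR_INZ, Z2Nat.id, minus_IZR by exact Hu. lra.
Qed.

(* An odd modulus m tending to infinity with p, and a number of steps n asymptotic to m^2 / t. *)
Definition walk_modulus (q p : nat) : nat := 2 * (p + q) + 1.
Definition walk_steps (t : R) (q p : nat) : nat := nat_floor (INR (walk_modulus q p) ^ 2 / t).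

(** * The limit of the finite identity *)

Section Polya_limit.

Variable t : R.
Hypothesis Ht : 0 < t.

(** Shifting the moduli by [q] gives m^2 >= 2t from the first index on, hence n >= 1 and n >=
    m^2/(2t). The dominating bounds then hold for all indices, as [tannery_R] demands, and not just
    eventually. *)
Lemma shift_exists : exists q : nat, 2 * t <= INR (2 * q + 1) ^ 2.
Proof.
  destruct (nfloor_ex (2 * t) ltac:(lra)) as [q [_ Hq]]. exists q.
  rewrite plus_INR, mult_INR. change (INR 2) with (1 + 1). change (INR 1) with 1.
  pose proof (pos_INR q). nra.
Qed.

Variable q : nat.
Hypothesis Hq : 2 * t <= INR (2 * q + 1) ^ 2.

Notation mod_seq := (walk_modulus q).
Notation step_seq := (walk_steps t q).

Lemma mod_seq_ge p : INR p + 1 <= INR (mod_seq p).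
Proof. unfold walk_modulus. rewrite <- S_INR. apply le_INR. lia. Qed.

Lemma mod_seq_sq p : 2 * t <= INR (mod_seq p) ^ 2.
Proof.
  apply Rle_trans with (1 := Hq). apply pow_incr. split; [apply pos_INR|]. apply le_INR. unfold walk_modulus. lia.
Qed.

Lemma step_seq_bounds p : INR (step_seq p) <= INR (mod_seq p) ^ 2 / t < INR (step_seq p) + 1.
Proof.
  apply nat_floor_bounds. apply Rlt_le, Rdiv_lt_0_compat; [apply pow_lt, lt_0_INR; unfold walk_modulus; lia | exact Ht].
Qed.

Lemma inv_mod_seq_lim : is_lim_seq (fun p => / INR (mod_seq p)) 0.
Proof.
  apply (is_lim_seq_squeeze (fun _ => 0) _ (fun p => / (INR p + 1))).
  - intros p. pose proof (mod_seq_ge p). pose proof (pos_INR p). split.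
    + apply Rlt_le, Rinv_0_lt_compat. lra.
    + apply Rinv_le_contravar; lra.
  - apply is_lim_seq_const.
  - apply (is_lim_seq_ext (fun p => / INR (S p))); [intros p; now rewrite S_INR|].
    apply (is_lim_seq_incr_1 (fun p => / INR p)).
    replace (Finite 0) with (Rbar_inv p_infty) by reflexivity.
    apply is_lim_seq_inv; [apply is_lim_seq_INR | easy].
Qed.

Lemma ratio_lim : is_lim_seq (fun p => INR (step_seq p) / INR (mod_seq p) ^ 2) (/ t).
Proof.
  assert (Hi2 : is_lim_seq (fun p => / t - / INR (mod_seq p) * / INR (mod_seq p)) (/ t)).
  { replace (Finite (/ t)) with (Finite (/ t - 0 * 0)) by (f_equal; ring).
    apply is_lim_seq_minus'; [apply is_lim_seq_const | apply is_lim_seq_mult'; apply inv_mod_seq_lim]. }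
  apply (is_lim_seq_squeeze _ _ (fun _ => / t)) with (2 := Hi2); [|apply is_lim_seq_const].
  intros p. pose proof (step_seq_bounds p) as [H1 H2]. pose proof (mod_seq_ge p). pose proof (pos_INR p).
  assert (Hm : 0 < INR (mod_seq p)) by lra.
  set (M := INR (mod_seq p)) in *. set (n := INR (step_seq p)) in *.
  assert (HM2 : 0 < M ^ 2) by now apply pow_lt.
  split; apply Rmult_le_reg_r with (M ^ 2); trivial.
  - replace ((/ t - / M * / M) * M ^ 2) with (M ^ 2 / t - 1) by (field; lra).
    replace (n / M ^ 2 * M ^ 2) with n by (field; lra). lra.
  - replace (/ t * M ^ 2) with (M ^ 2 / t) by (field; lra).
    replace (n / M ^ 2 * M ^ 2) with n by (field; lra). lra.
Qed.

Lemma step_seq_pos p : 1 <= INR (step_seq p).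
Proof.
  pose proof (step_seq_bounds p) as [H1 H2]. pose proof (mod_seq_sq p) as H3.
  assert (2 <= INR (mod_seq p) ^ 2 / t).
  { apply Rmult_le_reg_r with t; [exact Ht|]. unfold Rdiv. rewrite Rmult_assoc, Rinv_l by lra. lra. }
  assert (H0 : 0 < INR (step_seq p)) by lra.
  apply (le_INR 1). apply (INR_lt 0) in H0. exact H0.
Qed.

Lemma walk_side_term_lim (j : nat) :
  is_lim_seq (fun p => walk (step_seq p) (Z.of_nat (S j * mod_seq p)) / walk (step_seq p) 0) (exp (- (INR (S j) ^ 2 * t))).
Proof.
  set (x := fun p => INR (step_seq p) / INR (mod_seq p) ^ 2).
  set (i := fun p => / INR (mod_seq p)).
  (* With j for [S j], the denominators in [walk_lower] and [walk_upper] are n - jm + 1 and n + jm.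
     Divided by m^2 they take the form x + c/m + d/m^2, so one limit handles both bounds. *)
  assert (Hexp : forall c d : R, is_lim_seq (fun p => exp (- (INR (S j) ^ 2 / (x p + c * i p + d * (i p * i p))))) (exp (- (INR (S j) ^ 2 * t)))).
  { intros c d. apply (is_lim_seq_continuous (fun y => exp (- y))); [apply derivable_continuous_pt; reg|].
    replace (INR (S j) ^ 2 * t) with (INR (S j) ^ 2 * / (/ t + c * 0 + d * (0 * 0))) by (field; lra).
    apply (is_lim_seq_scal_l _ _ (Finite (/ (/ t + c * 0 + d * (0 * 0))))).
    apply (is_lim_seq_inv _ (Finite (/ t + c * 0 + d * (0 * 0)))).
    - apply is_lim_seq_plus'; [apply is_lim_seq_plus'|].
      + apply ratio_lim.
      + apply (is_lim_seq_scal_l _ c 0), inv_mod_seq_lim.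
      + apply (is_lim_seq_scal_l _ d (0 * 0)), is_lim_seq_mult'; apply inv_mod_seq_lim.
    - intros E. injection E as E. pose proof (Rinv_0_lt_compat t Ht). nra. }
  (* The lower bound needs j m <= n, which holds eventually since n is of order m^2. *)
  assert (Hev : eventually (fun p => INR (S j * mod_seq p) <= INR (step_seq p))).
  { assert (L : is_lim_seq (fun p => x p + (- INR (S j)) * i p) (/ t)).
    { replace (Finite (/ t)) with (Finite (/ t + (- INR (S j)) * 0)) by (f_equal; ring).
      apply is_lim_seq_plus'; [apply ratio_lim | apply (is_lim_seq_scal_l _ _ 0), inv_mod_seq_lim]. }
    assert (Hit : 0 < / t) by now apply Rinv_0_lt_compat.
    destruct (proj2 (is_lim_seq_spec _ _) L (mkposreal _ Hit)) as [N HN]. exists N. intros p Hp.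
    specialize (HN p Hp). cbn beta iota in HN. change (pos (mkposreal (/ t) Hit)) with (/ t) in HN.
    apply Rabs_def2 in HN. destruct HN as [_ HN].
    pose proof (mod_seq_ge p). pose proof (pos_INR p).
    assert (HM : 0 < INR (mod_seq p)) by lra.
    assert (K : 0 < x p + - INR (S j) * i p) by lra.
    apply Rmult_lt_compat_r with (r := INR (mod_seq p) ^ 2) in K; [|now apply pow_lt].
    unfold x, i in K. rewrite mult_INR.
    replace ((INR (step_seq p) / INR (mod_seq p) ^ 2 + - INR (S j) * / INR (mod_seq p)) * INR (mod_seq p) ^ 2)
      with (INR (step_seq p) - INR (S j) * INR (mod_seq p)) in K by (field; lra). lra. }
  apply (is_lim_seq_le_le_loc (fun p => exp (- (INR (S j) ^ 2 / (x p + - INR (S j) * i p + 1 * (i p * i p))))) _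
     (fun p => exp (- (INR (S j) ^ 2 / (x p + INR (S j) * i p + 0 * (i p * i p)))))); [|apply Hexp|apply Hexp].
  revert Hev. apply filter_imp. intros p Hp.
  pose proof (walk_center_pos (step_seq p)) as Hw.
  pose proof (mod_seq_ge p). pose proof (pos_INR p). pose proof (step_seq_pos p) as Hn.
  assert (HM : 0 < INR (mod_seq p)) by lra.
  assert (HK : forall k, (k < S j * mod_seq p)%nat -> INR k + 1 <= INR (S j * mod_seq p)).
  { intros k Hk. rewrite <- S_INR. apply le_INR. lia. }
  pose proof (lt_0_INR (S j) ltac:(lia)) as Hj.
  split; apply Rmult_le_reg_r with (walk (step_seq p) 0); trivial; unfold Rdiv at 1 2;
    rewrite ?(Rmult_assoc (walk _ (Z.of_nat _))), ?Rinv_l, ?Rmult_1_r by lra.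
  - rewrite Rmult_comm. pose proof (walk_lower (step_seq p) (S j * mod_seq p) _ HK Hp) as L.
    rewrite mult_INR in L.
    rewrite mult_INR in Hp.
    replace (INR (S j) ^ 2 * / (x p + - INR (S j) * i p + 1 * (i p * i p)))
      with ((INR (S j) * INR (mod_seq p)) ^ 2 / (INR (step_seq p) - INR (S j) * INR (mod_seq p) + 1)); [exact L|].
    unfold x, i. field. repeat split; lra.
  - rewrite (Rmult_comm (exp _)).
    destruct (walk_upper (step_seq p) (S j * mod_seq p) _ HK) as [L|L].
    + rewrite mult_INR in L.
      replace (INR (S j) ^ 2 * / (x p + INR (S j) * i p + 0 * (i p * i p)))
        with ((INR (S j) * INR (mod_seq p)) ^ 2 / (INR (step_seq p) + INR (S j) * INR (mod_seq p))); [exact L|].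
      unfold x, i. field. repeat split; try lra. nra.
    + exfalso. unfold walk_modulus in L. lia.
Qed.

(** Within reach of the walk, [walk_upper] with [K] equal to the number of steps gives the
    denominator 2n, hence the halved exponent; beyond reach the term is 0. *)
Lemma walk_side_term_bound (j p : nat) :
  Rabs (walk (step_seq p) (Z.of_nat (S j * mod_seq p)) / walk (step_seq p) 0) <= exp (- (INR (S j) ^ 2 * (t / 2))).
Proof.
  pose proof (walk_center_pos (step_seq p)) as Hw. pose proof (walk_nonneg (step_seq p) (Z.of_nat (S j * mod_seq p))) as Hw'.
  rewrite Rabs_pos_eq by (apply Rmult_le_pos; [exact Hw' | now apply Rlt_le, Rinv_0_lt_compat]).
  apply Rmult_le_reg_r with (walk (step_seq p) 0); [exact Hw|].
  unfold Rdiv at 1. rewrite Rmult_assoc, Rinv_l, Rmult_1_r by lra. rewrite Rmult_comm.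
  destruct (le_lt_dec (S j * mod_seq p) (step_seq p)) as [Hle|Hlt].
  - destruct (walk_upper (step_seq p) (S j * mod_seq p) (INR (step_seq p))) as [L|L].
    + intros k Hk. rewrite <- S_INR. apply le_INR. lia.
    + apply Rle_trans with (1 := L). apply Rmult_le_compat_l; [lra|]. apply exp_le_compat, Ropp_le_contravar.
      rewrite mult_INR, Rpow_mult_distr.
      pose proof (step_seq_bounds p) as [H1 _]. pose proof (step_seq_pos p).
      set (n := INR (step_seq p)) in *. set (M := INR (mod_seq p)) in *.
      replace (INR (S j) ^ 2 * M ^ 2 / (n + n)) with (INR (S j) ^ 2 * (M ^ 2 / n / 2)) by (field; lra).
      apply Rmult_le_compat_l; [apply pow2_ge_0|].
      assert (t <= M ^ 2 / n); [|lra].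
      apply Rmult_le_reg_r with n; [lra|]. replace (M ^ 2 / n * n) with (M ^ 2) by (field; lra).
      apply Rmult_le_compat_l with (r := t) in H1; [|lra].
      replace (t * (M ^ 2 / t)) with (M ^ 2) in H1 by (field; lra). exact H1.
    + exfalso. unfold walk_modulus in L. lia.
  - rewrite walk_support by lia. apply Rmult_le_pos; [lra | apply Rlt_le, exp_pos].
Qed.

Lemma walk_side_lim :
  is_lim_seq (fun p => psum (fun j => walk (step_seq p) (Z.of_nat (S j * mod_seq p)) / walk (step_seq p) 0) (step_seq p)) (gauss_series t).
Proof.
  apply (tannery_R (fun p j => walk (step_seq p) (Z.of_nat (S j * mod_seq p)) / walk (step_seq p) 0)
    (fun j => exp (- (INR (S j) ^ 2 * (t / 2)))) (fun j => exp (- (INR (S j) ^ 2 * t)))).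
  - intros p j. apply walk_side_term_bound.
  - apply ex_series_gaussian. lra.
  - apply walk_side_term_lim.
  - intros p. apply psum_is_series. intros k Hk. rewrite walk_support; [unfold Rdiv; ring|].
    assert (1 <= mod_seq p)%nat by (unfold walk_modulus; lia). nia.
  - now apply gauss_series_correct.
Qed.

Lemma angle_bounds (p l : nat) : (l < p + q)%nat -> 0 <= PI * INR (S l) / INR (mod_seq p) <= PI / 2.
Proof.
  intros Hl. pose proof PI_RGT_0 as HP. pose proof (mod_seq_ge p). pose proof (pos_INR p).
  assert (HM : 0 < INR (mod_seq p)) by lra.
  assert (Hl2 : 2 * INR (S l) <= INR (mod_seq p)).
  { replace 2 with (INR 2) by reflexivity. rewrite <- mult_INR. apply le_INR. unfold walk_modulus. lia. }
  split.
  - apply Rmult_le_pos; [|now apply Rlt_le, Rinv_0_lt_compat]. apply Rmult_le_pos; [lra | apply pos_INR].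
  - apply Rmult_le_reg_r with (INR (mod_seq p)); [exact HM|].
    replace (PI * INR (S l) / INR (mod_seq p) * INR (mod_seq p)) with (PI * INR (S l)) by (field; lra). nra.
Qed.

Lemma cos_side_upper (p l : nat) : (l < p + q)%nat ->
  cos (PI * INR (S l) / INR (mod_seq p)) ^ (2 * step_seq p) <=
  exp (- (INR (S l) ^ 2 * (PI ^ 2 * (INR (step_seq p) / INR (mod_seq p) ^ 2)))).
Proof.
  intros Hl. pose proof (angle_bounds p l Hl) as Ha.
  pose proof (mod_seq_ge p). pose proof (pos_INR p).
  apply Rle_trans with (exp (- ((PI * INR (S l) / INR (mod_seq p)) ^ 2 / 2)) ^ (2 * step_seq p)).
  - apply pow_incr. split; [apply cos_ge_0; pose proof PI_RGT_0; lra | now apply cos_le_gaussian].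
  - rewrite exp_pow_INR, mult_INR. apply Req_le. f_equal. change (INR 2) with (1 + 1). field. lra.
Qed.

(** Extended by zero, so that sums of growing length become series indexed by the same [l]. *)
Definition cos_term (p l : nat) : R :=
  if le_lt_dec (p + q) l then 0 else cos (PI * INR (S l) / INR (mod_seq p)) ^ (2 * step_seq p).

Lemma cos_term_bound (p l : nat) : Rabs (cos_term p l) <= exp (- (INR (S l) ^ 2 * (PI ^ 2 / (2 * t)))).
Proof.
  unfold cos_term. destruct le_lt_dec as [H|H].
  - rewrite Rabs_R0. apply Rlt_le, exp_pos.
  - pose proof (angle_bounds p l H) as Ha.
    rewrite Rabs_pos_eq by (apply pow_le, cos_ge_0; pose proof PI_RGT_0; lra).
    apply Rle_trans with (1 := cos_side_upper p l H). apply exp_le_compat, Ropp_le_contravar.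
    apply Rmult_le_compat_l; [apply pow2_ge_0|]. unfold Rdiv at 1.
    apply Rmult_le_compat_l; [apply pow2_ge_0|].
    pose proof (mod_seq_ge p). pose proof (pos_INR p).
    pose proof (step_seq_bounds p) as [_ H2]. pose proof (mod_seq_sq p) as H3.
    set (n := INR (step_seq p)) in *. set (M := INR (mod_seq p)) in *.
    assert (HM2 : 0 < M ^ 2) by (apply pow_lt; lra).
    apply Rmult_le_reg_r with (M ^ 2); [exact HM2|].
    replace (n / M ^ 2 * M ^ 2) with n by (field; lra).
    replace (/ (2 * t) * M ^ 2) with (M ^ 2 / t / 2) by (field; lra).
    assert (2 <= M ^ 2 / t); [|lra].
    apply Rmult_le_reg_r with t; [exact Ht|]. replace (M ^ 2 / t * t) with (M ^ 2) by (field; lra). lra.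
Qed.

(** Squeeze, with y the angle and v = y^2/2. From above [cos_le_gaussian]; from below cos y >= 1 - v
    >= exp(-v/(1-v)), where 1 - v tends to 1. *)
Lemma cos_term_lim (l : nat) : is_lim_seq (fun p => cos_term p l) (exp (- (INR (S l) ^ 2 * (PI ^ 2 / t)))).
Proof.
  set (x := fun p => INR (step_seq p) / INR (mod_seq p) ^ 2).
  set (i := fun p => / INR (mod_seq p)).
  set (a := PI * INR (S l)).
  assert (Hcont : forall u, is_lim_seq u (INR (S l) ^ 2 * (PI ^ 2 / t)) ->
     is_lim_seq (fun p => exp (- u p)) (exp (- (INR (S l) ^ 2 * (PI ^ 2 / t))))).
  { intros u Hu. apply (is_lim_seq_continuous (fun y => exp (- y))); [apply derivable_continuous_pt; reg | exact Hu]. }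
  assert (Hden : is_lim_seq (fun p => 1 - a ^ 2 / 2 * (i p * i p)) 1).
  { replace (Finite 1) with (Finite (1 - a ^ 2 / 2 * (0 * 0))) by (f_equal; ring).
    apply is_lim_seq_minus'; [apply is_lim_seq_const|].
    apply (is_lim_seq_scal_l _ (a ^ 2 / 2) (0 * 0)), is_lim_seq_mult'; apply inv_mod_seq_lim. }
  apply (is_lim_seq_le_le_loc (fun p => exp (- (INR (S l) ^ 2 * (PI ^ 2 * (x p)) * / (1 - a ^ 2 / 2 * (i p * i p))))) _
     (fun p => exp (- (INR (S l) ^ 2 * (PI ^ 2 * (x p)))))).
  - assert (H12 : 0 < 1 / 2) by lra.
    destruct (proj2 (is_lim_seq_spec _ _) Hden (mkposreal _ H12)) as [N HN].
    exists (N + l + 1)%nat. intros p Hp. specialize (HN p ltac:(lia)). cbn beta iota in HN.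
    change (pos (mkposreal (1 / 2) H12)) with (1 / 2) in HN. apply Rabs_def2 in HN. destruct HN as [_ HN].
    unfold cos_term. destruct le_lt_dec as [H|H]; [exfalso; lia|].
    split; [|now apply cos_side_upper].
    pose proof (angle_bounds p l H) as Ha. set (y := PI * INR (S l) / INR (mod_seq p)) in *.
    pose proof (mod_seq_ge p). pose proof (pos_INR p).
    assert (Ey : a ^ 2 / 2 * (i p * i p) = y ^ 2 / 2) by (unfold a, i, y; field; lra).
    rewrite Ey in *.
    set (v := y ^ 2 / 2) in *.
    assert (Hv : 0 < 1 - v) by lra.
    apply Rle_trans with ((1 - v) ^ (2 * step_seq p)).
    + replace (- (INR (S l) ^ 2 * (PI ^ 2 * x p) * / (1 - v))) with (INR (2 * step_seq p) * (- (v / (1 - v)))).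
      * rewrite <- exp_pow_INR. apply pow_incr. split; [apply Rlt_le, exp_pos|].
        rewrite exp_Ropp. pose proof (exp_ineq1_le (v / (1 - v))) as Hex.
        replace (1 + v / (1 - v)) with (/ (1 - v)) in Hex by (field; lra).
        apply Rle_trans with (/ / (1 - v)); [|rewrite Rinv_inv; lra].
        apply Rinv_le_contravar; [now apply Rinv_0_lt_compat | exact Hex].
      * rewrite mult_INR. unfold v at 1, y, x. change (INR 2) with (1 + 1). field. split; lra.
    + apply pow_incr. split; [lra|]. apply cos_ge_quadratic. lra.
  - apply Hcont.
    replace (INR (S l) ^ 2 * (PI ^ 2 / t)) with (INR (S l) ^ 2 * (PI ^ 2 * / t) * / 1) by (field; lra).
    apply is_lim_seq_mult'.
    + apply (is_lim_seq_scal_l _ _ (Finite (PI ^ 2 * / t))), (is_lim_seq_scal_l _ _ (Finite (/ t))), ratio_lim.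
    + apply (is_lim_seq_inv _ (Finite 1)); [exact Hden|]. intros E. injection E as E. lra.
  - apply Hcont.
    apply (is_lim_seq_scal_l _ _ (Finite (PI ^ 2 * / t))), (is_lim_seq_scal_l _ _ (Finite (/ t))), ratio_lim.
Qed.

Lemma cos_side_lim :
  is_lim_seq (fun p => psum (fun l => cos (PI * INR (S l) / INR (mod_seq p)) ^ (2 * step_seq p)) (p + q)) (gauss_series (PI ^ 2 / t)).
Proof.
  assert (HP : 0 < PI ^ 2) by (apply pow_lt, PI_RGT_0).
  apply (tannery_R cos_term (fun l => exp (- (INR (S l) ^ 2 * (PI ^ 2 / (2 * t)))))
    (fun l => exp (- (INR (S l) ^ 2 * (PI ^ 2 / t))))).
  - apply cos_term_bound.
  - apply ex_series_gaussian. apply Rdiv_lt_0_compat; lra.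
  - apply cos_term_lim.
  - intros p. rewrite (psum_ext _ (cos_term p)).
    + apply psum_is_series. intros k Hk. unfold cos_term. destruct le_lt_dec; [reflexivity | lia].
    + intros k Hk. unfold cos_term. destruct le_lt_dec; [lia | reflexivity].
  - apply gauss_series_correct. now apply Rdiv_lt_0_compat.
Qed.

(** Both sums in the identity converge by themselves, so the asymptotic size of the central term is
    read off from it instead of being computed by Stirling's formula. *)
Lemma polya_limit :
  is_lim_seq (fun p => INR (mod_seq p) * walk (step_seq p) 0) ((1 + 2 * gauss_series (PI ^ 2 / t)) / (1 + 2 * gauss_series t)).
Proof.
  pose proof (gauss_series_pos t Ht) as Hpos.
  apply (is_lim_seq_ext (fun p =>
     (1 + 2 * psum (fun l => cos (PI * INR (S l) / INR (mod_seq p)) ^ (2 * step_seq p)) (p + q)) *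
     / (1 + 2 * psum (fun j => walk (step_seq p) (Z.of_nat (S j * mod_seq p)) / walk (step_seq p) 0) (step_seq p)))).
  - intros p. unfold walk_modulus. rewrite <- polya_identity.
    set (A := psum _ _).
    assert (HA : 0 <= A).
    { unfold A. generalize (step_seq p) at 3. intros N. induction N as [|N IH]; cbn [psum]; [lra|].
      apply Rplus_le_le_0_compat; [exact IH|]. apply Rmult_le_pos; [apply walk_nonneg | apply Rlt_le, Rinv_0_lt_compat, walk_center_pos]. }
    field. lra.
  - apply is_lim_seq_mult'.
    + apply is_lim_seq_plus'; [apply is_lim_seq_const|]. apply (is_lim_seq_scal_l _ 2 (Finite (gauss_series (PI ^ 2 / t)))), cos_side_lim.
    + apply (is_lim_seq_inv _ (Finite (1 + 2 * gauss_series t))).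
      * apply is_lim_seq_plus'; [apply is_lim_seq_const|]. apply (is_lim_seq_scal_l _ 2 (Finite (gauss_series t))), walk_side_lim.
      * intros E. injection E as E. lra.
Qed.

Lemma step_seq_infty : filterlim step_seq eventually eventually.
Proof.
  intros P [N HN].
  destruct (nfloor_ex (INR (S N) * t) ltac:(apply Rmult_le_pos; [apply pos_INR | lra])) as [N2 [_ HN2]].
  exists N2. intros p Hp. apply HN.
  pose proof (step_seq_bounds p) as [_ H2]. pose proof (mod_seq_ge p) as H1. apply le_INR in Hp. pose proof (pos_INR p).
  assert (H3 : INR (S N) <= INR (mod_seq p) ^ 2 / t).
  { apply Rmult_le_reg_r with t; [exact Ht|]. replace (INR (mod_seq p) ^ 2 / t * t) with (INR (mod_seq p) ^ 2) by (field; lra). nra. }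
  rewrite S_INR in H3. apply INR_le. lra.
Qed.

End Polya_limit.

(** From (2n+1)^2 >= 4n(n+1). With the bound below, this product converges; the limit is the Wallis
    constant, whose value 1/PI is found only through the symmetry of the theta series. *)
Lemma walk_sq_incr (n : nat) : INR n * walk n 0 ^ 2 <= INR (S n) * walk (S n) 0 ^ 2.
Proof.
  pose proof (walk_center_S n) as H. pose proof (pos_INR n) as Hn.
  assert (E : walk (S n) 0 = walk n 0 * ((2 * INR n + 1) / (2 * INR n + 2))).
  { apply Rmult_eq_reg_r with (2 * INR n + 2); [|lra]. rewrite H. field. lra. }
  rewrite E, S_INR.
  replace ((INR n + 1) * (walk n 0 * ((2 * INR n + 1) / (2 * INR n + 2))) ^ 2)
    with (walk n 0 ^ 2 * ((INR n + 1) * ((2 * INR n + 1) / (2 * INR n + 2)) ^ 2)) by ring.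
  rewrite Rmult_comm. apply Rmult_le_compat_l; [apply pow2_ge_0|].
  apply Rmult_le_reg_r with ((2 * INR n + 2) ^ 2); [apply pow_lt; lra|].
  replace ((INR n + 1) * ((2 * INR n + 1) / (2 * INR n + 2)) ^ 2 * (2 * INR n + 2) ^ 2)
    with ((INR n + 1) * (2 * INR n + 1) ^ 2) by (field; lra). nra.
Qed.

Lemma walk_sq_bound (n : nat) : (2 * INR n + 1) * walk n 0 ^ 2 <= 1.
Proof.
  induction n as [|n IH].
  - cbn [walk INR]. destruct Z.eq_dec; [lra | lia].
  - pose proof (walk_center_S n) as H. pose proof (pos_INR n) as Hn.
    assert (E : walk (S n) 0 = walk n 0 * ((2 * INR n + 1) / (2 * INR n + 2))).
    { apply Rmult_eq_reg_r with (2 * INR n + 2); [|lra]. rewrite H. field. lra. }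
    apply Rle_trans with (2 := IH). rewrite E, S_INR.
    replace ((2 * (INR n + 1) + 1) * (walk n 0 * ((2 * INR n + 1) / (2 * INR n + 2))) ^ 2)
      with (walk n 0 ^ 2 * ((2 * INR n + 3) * ((2 * INR n + 1) / (2 * INR n + 2)) ^ 2)) by ring.
    rewrite (Rmult_comm (2 * INR n + 1) (walk n 0 ^ 2)). apply Rmult_le_compat_l; [apply pow2_ge_0|].
    apply Rmult_le_reg_r with ((2 * INR n + 2) ^ 2); [apply pow_lt; lra|].
    replace ((2 * INR n + 3) * ((2 * INR n + 1) / (2 * INR n + 2)) ^ 2 * (2 * INR n + 2) ^ 2)
      with ((2 * INR n + 3) * (2 * INR n + 1) ^ 2) by (field; lra). nra.
Qed.

Lemma walk_sq_lim : exists L : R, is_lim_seq (fun n => INR n * walk n 0 ^ 2) L.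
Proof.
  destruct (ex_finite_lim_seq_incr (fun n => INR n * walk n 0 ^ 2) 1) as [L HL].
  - intros n. apply walk_sq_incr.
  - intros n. pose proof (walk_sq_bound n). pose proof (pos_INR n).
    pose proof (pow2_ge_0 (walk n 0)). nra.
  - now exists L.
Qed.

(** With m the modulus and n the number of steps, (m * walk n 0)^2 is the product of m^2/n, which
    tends to t, and n * (walk n 0)^2, which tends to [L]. *)
Lemma polya_ratio (L t : R) : is_lim_seq (fun n => INR n * walk n 0 ^ 2) L -> 0 < t ->
  ((1 + 2 * gauss_series (PI ^ 2 / t)) / (1 + 2 * gauss_series t)) ^ 2 = t * L.
Proof.
  intros HL Ht.
  destruct (shift_exists t Ht) as [q Hq].
  pose proof (polya_limit t Ht q Hq) as H1.
  set (c := (1 + 2 * gauss_series (PI ^ 2 / t)) / (1 + 2 * gauss_series t)) in *.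
  pose proof (is_lim_seq_mult' _ _ _ _ H1 H1) as H2.
  pose proof (is_lim_seq_subseq _ L (walk_steps t q) (step_seq_infty t Ht q) HL) as H3.
  pose proof (ratio_lim t Ht q) as H4.
  pose proof (is_lim_seq_mult' _ _ _ _ H4 H2) as H5.
  assert (E : Finite (/ t * (c * c)) = Finite L).
  { rewrite <- (is_lim_seq_unique _ _ H5), <- (is_lim_seq_unique _ _ H3).
    apply Lim_seq_ext. intros p.
    assert (0 < INR (walk_modulus q p)) by (apply lt_0_INR; unfold walk_modulus; lia).
    field. lra. }
  injection E as E. rewrite <- E. field. lra.
Qed.

(** At the fixed point t = PI of t -> PI^2/t the quotient in [polya_ratio] is 1, so [L = / PI];
    every other t then follows. *)
Lemma gauss_series_functional (t : R) : 0 < t ->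
  1 + 2 * gauss_series (PI ^ 2 / t) = sqrt (t / PI) * (1 + 2 * gauss_series t).
Proof.
  intros Ht. destruct walk_sq_lim as [L HL].
  pose proof PI_RGT_0 as HP.
  pose proof (polya_ratio L PI HL HP) as H1.
  replace (PI ^ 2 / PI) with PI in H1 by (field; lra).
  pose proof (gauss_series_pos PI HP) as G0.
  assert (HL2 : L = / PI).
  { apply Rmult_eq_reg_l with PI; [|lra]. rewrite <- H1. field. lra. }
  pose proof (polya_ratio L t HL Ht) as H2. rewrite HL2 in H2.
  pose proof (gauss_series_pos t Ht) as G1.
  assert (HPt : 0 < PI ^ 2 / t) by (apply Rdiv_lt_0_compat; [apply pow_lt|]; lra).
  pose proof (gauss_series_pos _ HPt) as G2.
  change (t * / PI) with (t / PI) in H2. rewrite <- H2.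
  rewrite sqrt_pow2 by (apply Rlt_le, Rdiv_lt_0_compat; lra). field. lra.
Qed.

Definition theta0 (x : R) : R := gauss_series (PI * x ^ 2).

Lemma theta0_functional (x : R) : 0 < x -> 1 + 2 * theta0 (/ x) = x * (1 + 2 * theta0 x).
Proof.
  intros Hx. pose proof PI_RGT_0 as HP. unfold theta0.
  assert (Hx2 : 0 < PI * x ^ 2) by (apply Rmult_lt_0_compat; [lra | now apply pow_lt]).
  pose proof (gauss_series_functional (PI * x ^ 2) Hx2) as H.
  replace (PI ^ 2 / (PI * x ^ 2)) with (PI * (/ x) ^ 2) in H by (field; lra).
  replace (PI * x ^ 2 / PI) with (x ^ 2) in H by (field; lra).
  rewrite sqrt_pow2 in H by lra. exact H.
Qed.

(** * The shifted Gaussian *)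

Definition shifted_gauss (z u : R) : C := Cexp ((alpha * RtoC z - Ci * RtoC (sqrt PI) * RtoC u) ^ 2)%C.

Definition sym_gauss (z u : R) : C := (shifted_gauss z u + shifted_gauss z (- u))%C.

Lemma alpha_val : alpha = (/ sqrt 2, - / sqrt 2).
Proof.
  assert (E : (- Ci * RtoC PI / RtoC 4)%C = (0, - (PI / 4))).
  { replace (- Ci * RtoC PI / RtoC 4)%C with (- Ci * RtoC (PI / 4))%C.
    - unfold Ci, RtoC, Cmult, Copp. cbn. f_equal; ring.
    - rewrite RtoC_div by lra. field. }
  unfold alpha, Cexp. rewrite E. cbn [Re Im fst snd]. rewrite exp_0, cos_neg, sin_neg, cos_PI4, sin_PI4.
  f_equal; field; apply Rgt_not_eq, sqrt_lt_R0; lra.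
Qed.

Lemma alpha_sq : (alpha * alpha)%C = (- Ci)%C.
Proof.
  rewrite alpha_val. unfold Cmult, Copp, Ci. cbn.
  assert (H : / sqrt 2 * / sqrt 2 = / 2) by (rewrite <- Rinv_mult, sqrt_sqrt; lra).
  f_equal; nra.
Qed.

Lemma sqrt_PI_sq : sqrt PI * sqrt PI = PI.
Proof. apply sqrt_sqrt. pose proof PI_RGT_0. lra. Qed.

Lemma sqrt_PI_pos : 0 < sqrt PI.
Proof. apply sqrt_lt_R0, PI_RGT_0. Qed.

(** This is sqrt(2 PI), the coefficient of [z * u] in both components of the exponent. *)
Definition gauss_slope : R := 2 * sqrt PI * / sqrt 2.

Lemma shifted_gauss_exponent (z u : R) :
  ((alpha * RtoC z - Ci * RtoC (sqrt PI) * RtoC u) ^ 2)%C =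
  (- (PI * u ^ 2) - gauss_slope * (z * u), - (z ^ 2 + gauss_slope * (z * u))).
Proof.
  replace ((alpha * RtoC z - Ci * RtoC (sqrt PI) * RtoC u) ^ 2)%C
    with (alpha * alpha * RtoC z ^ 2 - 2 * Ci * alpha * RtoC (sqrt PI) * RtoC z * RtoC u + Ci * Ci * RtoC (sqrt PI * sqrt PI) * RtoC u ^ 2)%C
    by (rewrite RtoC_mult; ring).
  rewrite alpha_sq, sqrt_PI_sq, alpha_val. rewrite <- !RtoC_pow.
  unfold gauss_slope, Ci, RtoC, Cmult, Cminus, Cplus, Copp. cbn. f_equal; ring.
Qed.

Lemma shifted_gauss_val (z u : R) :
  shifted_gauss z u =
  (exp (- (PI * u ^ 2) - gauss_slope * (z * u)) * cos (z ^ 2 + gauss_slope * (z * u)),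
   - (exp (- (PI * u ^ 2) - gauss_slope * (z * u)) * sin (z ^ 2 + gauss_slope * (z * u)))).
Proof.
  unfold shifted_gauss. rewrite shifted_gauss_exponent. unfold Cexp. cbn [Re Im fst snd].
  rewrite cos_neg, sin_neg. f_equal. ring.
Qed.

Lemma Cderive_linear (a b : C) (t : R) : Cderive (fun u => a + b * RtoC u)%C t b.
Proof.
  eapply Cderive_ext_val; [|exact (Cderive_plus _ _ t _ _ (Cderive_const a t)
    (Cderive_mult _ _ t _ _ (Cderive_const b t) (Cderive_RtoC _ t 1 (is_derive_id t))))]. cbv beta. ring.
Qed.

Lemma Cderive_eq_fun (f g : R -> C) t l : (forall u, f u = g u) -> Cderive f t l -> Cderive g t l.
Proof.
  intros E [H1 H2]. split.
  - eapply is_derive_ext; [|exact H1]. intros u. cbv beta. now rewrite E.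
  - eapply is_derive_ext; [|exact H2]. intros u. cbv beta. now rewrite E.
Qed.

Lemma Cderive_Cexp_sq (a b : C) (t : R) :
  Cderive (fun u => Cexp ((a + b * RtoC u) ^ 2)) t (2 * b * (a + b * RtoC t) * Cexp ((a + b * RtoC t) ^ 2))%C.
Proof.
  eapply Cderive_ext_val; [|apply Cderive_Cexp;
    apply (Cderive_eq_fun (fun u => (a + b * RtoC u) * (a + b * RtoC u))%C);
    [intros u; cbv beta; ring | exact (Cderive_mult _ _ t _ _ (Cderive_linear a b t) (Cderive_linear a b t))]].
  cbv beta. ring.
Qed.

Definition gauss_lin (z u : R) : C := (alpha * RtoC z - Ci * RtoC (sqrt PI) * RtoC u)%C.

Lemma Cderive_shifted_gauss_u (z u : R) :
  Cderive (shifted_gauss z) u (-2 * Ci * RtoC (sqrt PI) * gauss_lin z u * shifted_gauss z u)%C.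
Proof.
  apply (Cderive_eq_fun (fun u => Cexp ((alpha * RtoC z + (- (Ci * RtoC (sqrt PI))) * RtoC u) ^ 2))).
  - intros v. unfold shifted_gauss. f_equal. ring.
  - eapply Cderive_ext_val; [|apply Cderive_Cexp_sq]. unfold shifted_gauss, gauss_lin.
    replace (alpha * RtoC z + - (Ci * RtoC (sqrt PI)) * RtoC u)%C
      with (alpha * RtoC z - Ci * RtoC (sqrt PI) * RtoC u)%C by ring.
    generalize (Cexp ((alpha * RtoC z - Ci * RtoC (sqrt PI) * RtoC u) ^ 2)). intros e.
    replace (RtoC (-2)) with (- RtoC 2)%C by (now rewrite <- RtoC_opp). ring.
Qed.

Lemma Cderive_shifted_gauss_opp_u (z u : R) :
  Cderive (fun u => shifted_gauss z (- u)) u (2 * Ci * RtoC (sqrt PI) * gauss_lin z (- u) * shifted_gauss z (- u))%C.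
Proof.
  apply (Cderive_eq_fun (fun u => Cexp ((alpha * RtoC z + (Ci * RtoC (sqrt PI)) * RtoC u) ^ 2))).
  - intros v. unfold shifted_gauss. f_equal. rewrite RtoC_opp. ring.
  - eapply Cderive_ext_val; [|apply Cderive_Cexp_sq]. unfold shifted_gauss, gauss_lin.
    replace (alpha * RtoC z + Ci * RtoC (sqrt PI) * RtoC u)%C
      with (alpha * RtoC z - Ci * RtoC (sqrt PI) * RtoC (- u))%C by (rewrite RtoC_opp; ring). ring.
Qed.

Lemma Cderive_shifted_gauss_z (z u : R) :
  Cderive (fun z => shifted_gauss z u) z (2 * alpha * gauss_lin z u * shifted_gauss z u)%C.
Proof.
  apply (Cderive_eq_fun (fun z => Cexp ((- (Ci * RtoC (sqrt PI) * RtoC u) + alpha * RtoC z) ^ 2))).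
  - intros v. unfold shifted_gauss. f_equal. ring.
  - eapply Cderive_ext_val; [|apply Cderive_Cexp_sq]. unfold shifted_gauss, gauss_lin.
    replace (- (Ci * RtoC (sqrt PI) * RtoC u) + alpha * RtoC z)%C
      with (alpha * RtoC z - Ci * RtoC (sqrt PI) * RtoC u)%C by ring. ring.
Qed.

Lemma Cmod_alpha : Cmod alpha = 1.
Proof.
  unfold alpha. rewrite Cmod_Cexp.
  replace (Re (- Ci * RtoC PI / RtoC 4)%C) with 0; [apply exp_0|].
  unfold Cdiv. rewrite <- RtoC_inv by lra. unfold Re. cbn. ring.
Qed.

Lemma Cmod_shifted_gauss (z u : R) : Cmod (shifted_gauss z u) = exp (- (PI * u ^ 2) - gauss_slope * (z * u)).
Proof. unfold shifted_gauss. rewrite Cmod_Cexp, shifted_gauss_exponent. reflexivity. Qed.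

(** The maximum of exp(-PI v^2 + (gauss_slope |z| + 2) v), by completing the square. The 2 pays for
    a decay exp(-2|u|), one half of which later absorbs the linear factor of the derivative. *)
Definition gauss_const (z : R) : R := exp ((gauss_slope * Rabs z + 2) ^ 2 / (4 * PI)).

Lemma gauss_slope_pos : 0 < gauss_slope.
Proof.
  unfold gauss_slope. pose proof sqrt_PI_pos.
  assert (0 < / sqrt 2) by (apply Rinv_0_lt_compat, sqrt_lt_R0; lra). nra.
Qed.

Lemma shifted_gauss_bound (z u : R) : Cmod (shifted_gauss z u) <= gauss_const z * exp (- (2 * Rabs u)).
Proof.
  rewrite Cmod_shifted_gauss. unfold gauss_const. rewrite <- exp_plus. apply exp_le_compat.
  pose proof PI_RGT_0 as HP. pose proof gauss_slope_pos as Hs.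
  set (v := Rabs u). set (y := Rabs z).
  assert (Hv : 0 <= v) by apply Rabs_pos. assert (Hy : 0 <= y) by apply Rabs_pos.
  assert (E1 : u ^ 2 = v ^ 2) by (unfold v; now rewrite pow2_abs).
  assert (E2 : - (z * u) <= y * v).
  { unfold y, v. rewrite <- Rabs_mult, <- Rabs_Ropp. apply Rle_abs. }
  rewrite E1.
  assert (E3 : 0 <= PI * (v - (gauss_slope * y + 2) / (2 * PI)) ^ 2) by (apply Rmult_le_pos; [lra | apply pow2_ge_0]).
  replace (PI * (v - (gauss_slope * y + 2) / (2 * PI)) ^ 2)
    with (PI * v ^ 2 - (gauss_slope * y + 2) * v + (gauss_slope * y + 2) ^ 2 / (4 * PI)) in E3 by (field; lra).
  assert (E4 : gauss_slope * - (z * u) <= gauss_slope * (y * v)) by (apply Rmult_le_compat_l; lra).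
  lra.
Qed.

Lemma Cmod_gauss_lin (z u : R) : Cmod (gauss_lin z u) <= Rabs z + sqrt PI * Rabs u.
Proof.
  unfold gauss_lin. replace (alpha * RtoC z - Ci * RtoC (sqrt PI) * RtoC u)%C
    with (alpha * RtoC z + - (Ci * RtoC (sqrt PI) * RtoC u))%C by ring.
  eapply Rle_trans; [apply Cmod_triangle|].
  rewrite Cmod_opp, !Cmod_mult, Cmod_alpha, Cmod_Ci, !Cmod_R.
  pose proof sqrt_PI_pos. rewrite (Rabs_pos_eq (sqrt PI)) by lra. lra.
Qed.

Lemma shifted_gauss_deriv_bound (z u v : R) : 0 <= v -> Rabs u = v ->
  2 * sqrt PI * Cmod (gauss_lin z u) * Cmod (shifted_gauss z u) <=
  2 * sqrt PI * (Rabs z + sqrt PI) * gauss_const z * exp (- v).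
Proof.
  intros Hv Huv. pose proof sqrt_PI_pos as Hp.
  pose proof (Cmod_gauss_lin z u) as H1. pose proof (shifted_gauss_bound z u) as H2. rewrite Huv in *.
  pose proof (exp_pos (- v)) as He. pose proof (Rabs_pos z) as Hz.
  assert (Hg : 0 < gauss_const z) by apply exp_pos.
  assert (H3 : (Rabs z + sqrt PI * v) * exp (- v) <= Rabs z + sqrt PI).
  { assert (K1 : exp (- v) <= 1) by (rewrite <- exp_0; apply exp_le_compat; lra).
    assert (K2 : v * exp (- v) <= 1).
    { rewrite exp_Ropp. apply Rmult_le_reg_r with (exp v); [apply exp_pos|].
      rewrite Rmult_assoc, Rinv_l, Rmult_1_r, Rmult_1_l by (apply Rgt_not_eq, exp_pos).
      pose proof (exp_ineq1_le v). lra. }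
    nra. }
  apply Rle_trans with (2 * sqrt PI * (Rabs z + sqrt PI * v) * (gauss_const z * exp (- (2 * v)))).
  - apply Rmult_le_compat; [|apply Cmod_ge_0| |exact H2].
    + apply Rmult_le_pos; [lra | apply Cmod_ge_0].
    + apply Rmult_le_compat_l; lra.
  - replace (- (2 * v)) with (- v + - v) by ring. rewrite exp_plus.
    replace (2 * sqrt PI * (Rabs z + sqrt PI * v) * (gauss_const z * (exp (- v) * exp (- v))))
      with (2 * sqrt PI * gauss_const z * exp (- v) * ((Rabs z + sqrt PI * v) * exp (- v))) by ring.
    replace (2 * sqrt PI * (Rabs z + sqrt PI) * gauss_const z * exp (- v))
      with (2 * sqrt PI * gauss_const z * exp (- v) * (Rabs z + sqrt PI)) by ring.
    apply Rmult_le_compat_l; [|exact H3]. apply Rmult_le_pos; [|lra]. apply Rmult_le_pos; lra.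
Qed.

Definition sym_gauss_const (z : R) : R := 2 * ((2 * sqrt PI * (Rabs z + sqrt PI) + 1) * gauss_const z).

Lemma Cmod_2Ci_sqrt_PI (a b : C) :
  Cmod (2 * Ci * RtoC (sqrt PI) * a * b)%C = 2 * sqrt PI * Cmod a * Cmod b.
Proof.
  pose proof sqrt_PI_pos. rewrite !Cmod_mult, Cmod_Ci, !Cmod_R, !Rabs_pos_eq by lra. ring.
Qed.

Lemma Ccontinuous_shifted_gauss (z u : R) : Ccontinuous (shifted_gauss z) u.
Proof. eapply Cderive_continuous, Cderive_shifted_gauss_u. Qed.

Lemma Ccontinuous_sym_gauss (z u : R) : Ccontinuous (sym_gauss z) u.
Proof.
  eapply Cderive_continuous, Cderive_plus; [apply Cderive_shifted_gauss_u | apply Cderive_shifted_gauss_opp_u].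
Qed.

Lemma decaying_sym_gauss (z : R) : decaying (sym_gauss z) (sym_gauss_const z).
Proof.
  pose proof sqrt_PI_pos as Hp. pose proof (Rabs_pos z) as Hz.
  assert (Hg : 0 < gauss_const z) by apply exp_pos.
  set (K := 2 * sqrt PI * (Rabs z + sqrt PI) * gauss_const z).
  assert (HK : 0 <= K) by (apply Rmult_le_pos; [|lra]; apply Rmult_le_pos; lra).
  assert (EK : sym_gauss_const z = 2 * K + 2 * gauss_const z) by (unfold sym_gauss_const, K; ring).
  split; [apply Ccontinuous_sym_gauss|]. split.
  - intros a b Hab.
    replace (sym_gauss z a - sym_gauss z b)%C with (- (sym_gauss z b - sym_gauss z a))%C by ring.
    rewrite Cmod_opp.
    replace (sym_gauss_const z * (exp (- a) - exp (- b)))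
      with ((- sym_gauss_const z * exp (- b)) - (- sym_gauss_const z * exp (- a))) by ring.
    apply (Cmean_value (sym_gauss z) (fun u =>
      -2 * Ci * RtoC (sqrt PI) * gauss_lin z u * shifted_gauss z u +
      2 * Ci * RtoC (sqrt PI) * gauss_lin z (- u) * shifted_gauss z (- u))%C
      (fun u => - sym_gauss_const z * exp (- u)) (fun u => sym_gauss_const z * exp (- u))); [lra| | |].
    + intros t _. apply Cderive_plus; [apply Cderive_shifted_gauss_u | apply Cderive_shifted_gauss_opp_u].
    + intros t _. auto_derive; [easy|]. ring.
    + intros t Ht. eapply Rle_trans; [apply Cmod_triangle|].
      replace (-2 * Ci * RtoC (sqrt PI) * gauss_lin z t * shifted_gauss z t)%C
        with (- (2 * Ci * RtoC (sqrt PI) * gauss_lin z t * shifted_gauss z t))%C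
        by (replace (RtoC (-2)) with (- RtoC 2)%C by (now rewrite <- RtoC_opp); ring).
      rewrite Cmod_opp, !Cmod_2Ci_sqrt_PI.
      pose proof (shifted_gauss_deriv_bound z t t ltac:(lra) ltac:(apply Rabs_pos_eq; lra)) as B1.
      pose proof (shifted_gauss_deriv_bound z (- t) t ltac:(lra) ltac:(rewrite Rabs_Ropp; apply Rabs_pos_eq; lra)) as B2.
      fold K in B1, B2. rewrite EK. pose proof (exp_pos (- t)). nra.
  - intros a Ha. unfold sym_gauss. eapply Rle_trans; [apply Cmod_triangle|].
    pose proof (shifted_gauss_bound z a) as B1. pose proof (shifted_gauss_bound z (- a)) as B2.
    rewrite Rabs_Ropp in B2. rewrite Rabs_pos_eq in B1, B2 by lra.
    assert (B3 : exp (- (2 * a)) <= exp (- a)) by (apply exp_le_compat; lra).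
    rewrite EK. pose proof (exp_pos (- a)). nra.
Qed.

Lemma sym_gauss_0 (u : R) : sym_gauss 0 u = RtoC (2 * exp (- (PI * u ^ 2))).
Proof.
  unfold sym_gauss. rewrite !shifted_gauss_val.
  replace (0 ^ 2 + gauss_slope * (0 * u)) with 0 by ring.
  replace (0 ^ 2 + gauss_slope * (0 * - u)) with 0 by ring.
  replace (gauss_slope * (0 * u)) with 0 by ring.
  replace (gauss_slope * (0 * - u)) with 0 by ring.
  replace ((- u) ^ 2) with (u ^ 2) by ring.
  rewrite cos_0, sin_0, Rminus_0_r. unfold RtoC, Cplus. cbn. f_equal; ring.
Qed.

(** * The integral of the shifted Gaussian *)

Lemma is_Cseries_RtoC (a : nat -> R) (l : R) : is_series a l -> is_Cseries (fun n => RtoC (a n)) (RtoC l).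
Proof.
  intros H. apply Clim_eps; [apply eventually_filter|]. intros eps Heps.
  destruct (proj2 (is_lim_seq_spec (sum_n a) l) H (mkposreal _ Heps)) as [N HN]. exists N. intros n Hn.
  specialize (HN n Hn). cbn beta iota in HN. change (pos (mkposreal eps Heps)) with eps in HN.
  assert (E : Csum (fun n => RtoC (a n)) n = RtoC (sum_n a n)).
  { clear. induction n as [|n IH]; [now rewrite !sum_O|].
    rewrite sum_n_S_R, RtoC_plus, <- IH. apply (sum_Sn (G := C_NormedModule)). }
  rewrite E, <- RtoC_minus, Cmod_R. exact HN.
Qed.

Lemma theta_sum_gauss_0 (x : R) : 0 < x -> theta_sum (sym_gauss 0) x = RtoC (2 * theta0 x).
Proof.
  intros Hx. apply CSeries_unique.
  apply (is_Cseries_ext (fun n => RtoC (scal 2 (exp (- (INR (S n) ^ 2 * (PI * x ^ 2))))))).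
  - intros n. rewrite sym_gauss_0. f_equal. change scal with Rmult. do 3 f_equal. ring.
  - apply is_Cseries_RtoC, (is_series_scal (V := R_NormedModule)), gauss_series_correct.
    apply Rmult_lt_0_compat; [apply PI_RGT_0 | now apply pow_lt].
Qed.

(** The Gaussian integral as a consequence of the theta equation: [x] times the theta series is a
    Riemann sum that tends to 1 with the mesh. Truncating at [b] costs a tail of order exp(-b), and
    all other errors are of the order of [x = b / INR (S N)]. *)
Lemma gauss_integral_error (b : R) : 0 < b ->
  Cmod (CRInt (sym_gauss 0) 0 b - 1)%C <= sym_gauss_const 0 * exp (- b).
Proof.
  intros Hb. set (A := sym_gauss_const 0).
  pose proof (decaying_sym_gauss 0) as HG. fold A in HG.
  assert (HA : 0 <= A) by exact (decaying_nonneg _ _ HG).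
  apply le_epsilon. intros eps Heps.
  destruct (nfloor_ex (b * (2 * A + 1) / eps) ltac:(apply Rmult_le_pos; [nra | apply Rlt_le, Rinv_0_lt_compat, Heps])) as [N [_ HN]].
  rewrite <- S_INR in HN.
  assert (HNp : 0 < INR (S N)) by (apply lt_0_INR; lia).
  set (x := b / INR (S N)).
  assert (Hx : 0 < x) by now apply Rdiv_lt_0_compat.
  assert (Ex : INR (S N) * x = b) by (unfold x; field; lra).
  assert (Hxe : x * (2 * A + 1) <= eps).
  { unfold x. apply Rmult_le_reg_r with (INR (S N) * / eps); [apply Rmult_lt_0_compat; [lra | now apply Rinv_0_lt_compat]|].
    replace (b / INR (S N) * (2 * A + 1) * (INR (S N) * / eps)) with (b * (2 * A + 1) / eps) by (field; lra).
    replace (eps * (INR (S N) * / eps)) with (INR (S N)) by (field; lra). lra. }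
  pose proof (riemann_sum_error (sym_gauss 0) A HG x N Hx) as B1.
  pose proof (theta_sum_tail (sym_gauss 0) A HG x N Hx) as B2.
  rewrite Ex in B1, B2.
  assert (Hex : x <= exp x - 1) by (pose proof (exp_ineq1_le x); lra).
  assert (B3 : Cmod (RtoC x * theta_sum (sym_gauss 0) x - 1)%C <= x * (A + 1)).
  { rewrite theta_sum_gauss_0 by exact Hx.
    pose proof (theta0_functional x Hx) as HF.
    assert (Hix : 0 < / x) by now apply Rinv_0_lt_compat.
    pose proof (theta_sum_bound (sym_gauss 0) A HG (/ x) Hix) as B4.
    rewrite theta_sum_gauss_0 in B4 by exact Hix. rewrite Cmod_R in B4.
    assert (B5 : A * / (exp (/ x) - 1) <= A * x).
    { apply Rmult_le_compat_l; [exact HA|]. rewrite <- (Rinv_inv x) at 2. pose proof (exp_ineq1_le (/ x)).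
      apply Rinv_le_contravar; lra. }
    rewrite <- RtoC_mult, <- RtoC_minus, Cmod_R.
    (* By the functional equation the distance to 1 is an exponentially small theta value at 1/x
       plus the mesh [x]. *)
    replace (x * (2 * theta0 x) - 1) with (2 * theta0 (/ x) + - x) by lra.
    eapply Rle_trans; [apply Rabs_triang|]. rewrite Rabs_Ropp, (Rabs_pos_eq x) by lra. lra. }
  revert B1 B2 B3. generalize (Csum (fun n => sym_gauss 0 (INR (S n) * x)) N), (CRInt (sym_gauss 0) 0 b), (theta_sum (sym_gauss 0) x).
  intros s v th B1 B2 B3.
  replace (v - 1)%C with (- (RtoC x * s - v) + (- (RtoC x * (th - s)) + (RtoC x * th - 1)))%C by ring.
  eapply Rle_trans; [apply Cmod_triangle|]. rewrite Cmod_opp.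
  eapply Rle_trans; [apply Rplus_le_compat_l, Cmod_triangle|].
  rewrite Cmod_opp, Cmod_mult, Cmod_R, Rabs_pos_eq by lra.
  pose proof (exp_pos (- b)) as Heb.
  assert (B6 : x * Cmod (th - s)%C <= A * exp (- b)).
  { apply Rle_trans with (x * (A * (exp (- b) / (exp x - 1)))); [apply Rmult_le_compat_l; lra|].
    replace (x * (A * (exp (- b) / (exp x - 1)))) with (A * exp (- b) * (x / (exp x - 1))) by (field; lra).
    rewrite <- (Rmult_1_r (A * exp (- b))) at 2. apply Rmult_le_compat_l; [nra|].
    apply Rmult_le_reg_r with (exp x - 1); [lra|]. unfold Rdiv. rewrite Rmult_assoc, Rinv_l; lra. }
  assert (B7 : x * (A * (1 - exp (- b))) <= x * A) by (apply Rmult_le_compat_l; [lra|]; nra).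
  nra.
Qed.

(* d/dz of the Gaussian is i alpha / sqrt pi times its d/du, so moving z changes the integral by boundary terms only. *)
Definition sym_gauss_dz (z u : R) : C :=
  (2 * alpha * gauss_lin z u * shifted_gauss z u + 2 * alpha * gauss_lin z (- u) * shifted_gauss z (- u))%C.

Lemma sym_gauss_dz_primitive (z b : R) :
  is_CRInt (sym_gauss_dz z) 0 b (Ci * alpha * RtoC (/ sqrt PI) * (shifted_gauss z b - shifted_gauss z (- b)))%C.
Proof.
  pose proof sqrt_PI_pos as Hp.
  set (F := fun u => (Ci * alpha * RtoC (/ sqrt PI) * (shifted_gauss z u + - shifted_gauss z (- u)))%C).
  assert (HF : forall u, Cderive F u (sym_gauss_dz z u)).
  { intros u. eapply Cderive_ext_val; [|apply Cderive_mult; [apply Cderive_const |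
      apply Cderive_plus; [apply Cderive_shifted_gauss_u | apply Cderive_opp, Cderive_shifted_gauss_opp_u]]].
    cbv beta. unfold sym_gauss_dz.
    replace (RtoC (-2)) with (- RtoC 2)%C by (now rewrite <- RtoC_opp).
    rewrite RtoC_inv by lra.
    generalize (gauss_lin z u), (gauss_lin z (- u)), (shifted_gauss z u), (shifted_gauss z (- u)). intros l1 l2 g1 g2.
    assert (E : (Ci * Ci = - (1))%C) by (unfold Ci, Cmult, Copp, RtoC; cbn; f_equal; ring).
    (* The derivative of [F] is the claimed sum times -i^2, that is 1. *)
    transitivity (- (Ci * Ci) * (2 * alpha * l1 * g1 + 2 * alpha * l2 * g2))%C; [|rewrite E; ring].
    field. apply RtoC_neq_0. lra. }
  assert (Hc : forall u, Ccontinuous (sym_gauss_dz z) u).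
  { intros u. unfold sym_gauss_dz, gauss_lin.
    assert (L1 : Ccontinuous (fun u => alpha * RtoC z - Ci * RtoC (sqrt PI) * RtoC u)%C u).
    { eapply Cderive_continuous.
      apply (Cderive_eq_fun (fun u => alpha * RtoC z + (- (Ci * RtoC (sqrt PI))) * RtoC u)%C); [intros; ring | apply Cderive_linear]. }
    assert (L2 : Ccontinuous (fun u => alpha * RtoC z - Ci * RtoC (sqrt PI) * RtoC (- u))%C u).
    { eapply Cderive_continuous.
      apply (Cderive_eq_fun (fun u => alpha * RtoC z + (Ci * RtoC (sqrt PI)) * RtoC u)%C); [intros; rewrite RtoC_opp; ring | apply Cderive_linear]. }
    assert (L3 : Ccontinuous (fun u => shifted_gauss z (- u)) u) by (eapply Cderive_continuous, Cderive_shifted_gauss_opp_u).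
    apply Ccontinuous_plus; (apply Ccontinuous_mult; [|first [apply Ccontinuous_shifted_gauss | exact L3]]);
      (apply Ccontinuous_mult; [eapply Cderive_continuous, Cderive_const | assumption]). }
  pose proof (@is_RInt_derive C_R_CompleteNormedModule F (sym_gauss_dz z) 0 b
    (fun u _ => Cderive_is_derive F u _ (HF u)) (fun u _ => Hc u)) as H.
  replace (Ci * alpha * RtoC (/ sqrt PI) * (shifted_gauss z b - shifted_gauss z (- b)))%C with (minus (F b) (F 0)); [exact H|].
  change (@eq C (F b - F 0)%C (Ci * alpha * RtoC (/ sqrt PI) * (shifted_gauss z b - shifted_gauss z (- b)))%C).
  unfold F. rewrite Ropp_0. ring.
Qed.

(** Joint continuity is what differentiation under the integral asks for. Later [e] is 1 or -1, for
    the two halves of [sym_gauss], and [phi] is cos or sin, for the two components. *)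
Lemma continuity_2d_gauss (phi : R -> R) (e z u : R) :
  (forall t, continuity_pt phi t) ->
  continuity_2d_pt (fun z u => exp (- (PI * (e * u) ^ 2) - gauss_slope * (z * (e * u))) * phi (z ^ 2 + gauss_slope * (z * (e * u)))) z u.
Proof.
  intros Hphi.
  assert (L : continuity_2d_pt (fun z u => z * (e * u)) z u).
  { apply continuity_2d_pt_mult; [apply continuity_2d_pt_id1|].
    apply continuity_2d_pt_mult; [apply continuity_2d_pt_const | apply continuity_2d_pt_id2]. }
  assert (U : continuity_2d_pt (fun z u => e * u) z u).
  { apply continuity_2d_pt_mult; [apply continuity_2d_pt_const | apply continuity_2d_pt_id2]. }
  assert (S : continuity_2d_pt (fun z u => gauss_slope * (z * (e * u))) z u).
  { apply continuity_2d_pt_mult; [apply continuity_2d_pt_const | exact L]. }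
  apply continuity_2d_pt_mult.
  - apply (continuity_1d_2d_pt_comp exp); [apply derivable_continuous_pt, derivable_pt_exp|].
    apply continuity_2d_pt_minus; [|exact S]. apply continuity_2d_pt_opp.
    apply continuity_2d_pt_mult; [apply continuity_2d_pt_const|].
    apply (continuity_1d_2d_pt_comp (fun y => y ^ 2)); [apply derivable_continuous_pt, derivable_pt_pow | exact U].
  - apply (continuity_1d_2d_pt_comp phi); [apply Hphi|].
    apply continuity_2d_pt_plus; [|exact S].
    apply (continuity_1d_2d_pt_comp (fun y => y ^ 2)); [apply derivable_continuous_pt, derivable_pt_pow | apply continuity_2d_pt_id1].
Qed.

Lemma two_alpha_gauss_lin (z u : R) :
  (2 * alpha * gauss_lin z u)%C = (- (gauss_slope * u), - (2 * z + gauss_slope * u)).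
Proof.
  unfold gauss_lin.
  replace (2 * alpha * (alpha * RtoC z - Ci * RtoC (sqrt PI) * RtoC u))%C
    with (2 * (alpha * alpha) * RtoC z - 2 * Ci * alpha * RtoC (sqrt PI) * RtoC u)%C by ring.
  rewrite alpha_sq, alpha_val. unfold gauss_slope, Ci, RtoC, Cmult, Cminus, Cplus, Copp. cbn. f_equal; ring.
Qed.

Lemma sym_gauss_dz_continuity_2d (z u : R) :
  continuity_2d_pt (fun z u => Re (sym_gauss_dz z u)) z u /\ continuity_2d_pt (fun z u => Im (sym_gauss_dz z u)) z u.
Proof.
  set (E := fun e z u => exp (- (PI * (e * u) ^ 2) - gauss_slope * (z * (e * u)))).
  set (W := fun e z u => z ^ 2 + gauss_slope * (z * (e * u))).
  set (a := fun e u : R => - (gauss_slope * (e * u))).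
  set (b := fun e z u : R => - (2 * z + gauss_slope * (e * u))).
  assert (H : forall e z u, (2 * alpha * gauss_lin z (e * u) * shifted_gauss z (e * u))%C =
    (E e z u * cos (W e z u) * a e u + E e z u * sin (W e z u) * b e z u,
     E e z u * cos (W e z u) * b e z u - E e z u * sin (W e z u) * a e u)).
  { intros e y v. rewrite two_alpha_gauss_lin, shifted_gauss_val. unfold E, W, a, b, Cmult. cbn [fst snd]. f_equal; ring. }
  assert (Hd : forall z u, sym_gauss_dz z u =
     ((2 * alpha * gauss_lin z (1 * u) * shifted_gauss z (1 * u)) + (2 * alpha * gauss_lin z (-1 * u) * shifted_gauss z (-1 * u)))%C).
  { intros y v. unfold sym_gauss_dz. now replace (1 * v) with v by ring; replace (-1 * v) with (- v) by ring. }
  assert (Cc : forall e, continuity_2d_pt (fun z u => E e z u * cos (W e z u)) z u)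
    by (intros e; apply (continuity_2d_gauss cos e z u); intros t; apply derivable_continuous_pt, derivable_pt_cos).
  assert (Cs : forall e, continuity_2d_pt (fun z u => E e z u * sin (W e z u)) z u)
    by (intros e; apply (continuity_2d_gauss sin e z u); intros t; apply derivable_continuous_pt, derivable_pt_sin).
  assert (Ce : forall e, continuity_2d_pt (fun z u => gauss_slope * (e * u)) z u).
  { intros e. apply continuity_2d_pt_mult; [apply continuity_2d_pt_const|].
    apply continuity_2d_pt_mult; [apply continuity_2d_pt_const | apply continuity_2d_pt_id2]. }
  assert (Ca : forall e, continuity_2d_pt (fun z u => a e u) z u) by (intros e; apply continuity_2d_pt_opp, Ce).
  assert (Cb : forall e, continuity_2d_pt (fun z u => b e z u) z u).
  { intros e. apply continuity_2d_pt_opp, continuity_2d_pt_plus; [|apply Ce].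
    apply continuity_2d_pt_mult; [apply continuity_2d_pt_const | apply continuity_2d_pt_id1]. }
  split.
  - apply (continuity_2d_pt_ext (fun z u =>
      (E 1 z u * cos (W 1 z u) * a 1 u + E 1 z u * sin (W 1 z u) * b 1 z u) +
      (E (-1) z u * cos (W (-1) z u) * a (-1) u + E (-1) z u * sin (W (-1) z u) * b (-1) z u))).
    + intros y v. rewrite Hd, !H. reflexivity.
    + repeat apply continuity_2d_pt_plus;
        apply (continuity_2d_pt_mult (fun z u => _ * _)); auto.
  - apply (continuity_2d_pt_ext (fun z u =>
      (E 1 z u * cos (W 1 z u) * b 1 z u - E 1 z u * sin (W 1 z u) * a 1 u) +
      (E (-1) z u * cos (W (-1) z u) * b (-1) z u - E (-1) z u * sin (W (-1) z u) * a (-1) u))).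
    + intros y v. rewrite Hd, !H. reflexivity.
    + apply continuity_2d_pt_plus; apply continuity_2d_pt_minus;
        apply (continuity_2d_pt_mult (fun z u => _ * _)); auto.
Qed.

Lemma Cderive_sym_gauss_z (z u : R) : Cderive (fun z => sym_gauss z u) z (sym_gauss_dz z u).
Proof. apply Cderive_plus; apply Cderive_shifted_gauss_z. Qed.

Lemma CRInt_components (f : R -> C) (a b : R) :
  (forall x, Ccontinuous f x) ->
  CRInt f a b = (RInt (fun x => Re (f x)) a b, RInt (fun x => Im (f x)) a b).
Proof.
  intros Hc.
  assert (H : is_CRInt f a b (CRInt f a b)).
  { apply (@RInt_correct C_R_CompleteNormedModule), (@ex_RInt_continuous C_R_CompleteNormedModule).
    intros; apply Hc. }
  rewrite (@is_RInt_unique R_CompleteNormedModule _ _ _ _ (is_CRInt_Re _ _ _ _ H)).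
  rewrite (@is_RInt_unique R_CompleteNormedModule _ _ _ _ (is_CRInt_Im _ _ _ _ H)).
  now destruct (CRInt f a b).
Qed.

(** Differentiation under the integral sign in each component; the resulting integral has the
    explicit primitive found above, leaving boundary terms. *)
Lemma Cderive_gauss_integral (z b : R) :
  Cderive (fun z => CRInt (sym_gauss z) 0 b) z
    (Ci * alpha * RtoC (/ sqrt PI) * (shifted_gauss z b - shifted_gauss z (- b)))%C.
Proof.
  pose proof (sym_gauss_dz_primitive z b) as HI.
  assert (Hex : forall y, is_CRInt (sym_gauss y) 0 b (CRInt (sym_gauss y) 0 b)).
  { intros y. apply (ex_CRInt_everywhere _ _ (decaying_sym_gauss y)). }
  apply (Cderive_eq_fun (fun y => (RInt (fun x => Re (sym_gauss y x)) 0 b, RInt (fun x => Im (sym_gauss y x)) 0 b))).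
  { intros y. symmetry. apply CRInt_components, Ccontinuous_sym_gauss. }
  split; cbn [Re Im fst snd].
  - rewrite <- (@is_RInt_unique R_CompleteNormedModule _ _ _ _ (is_CRInt_Re _ _ _ _ HI)).
    rewrite (RInt_ext _ (fun t => Derive (fun u => Re (sym_gauss u t)) z)).
    + apply is_derive_RInt_param.
      * apply filter_forall. intros y t _. exists (Re (sym_gauss_dz y t)). apply Cderive_sym_gauss_z.
      * intros t _. apply (continuity_2d_pt_ext (fun u v => Re (sym_gauss_dz u v))).
        -- intros y v. symmetry. apply is_derive_unique, Cderive_sym_gauss_z.
        -- apply sym_gauss_dz_continuity_2d.
      * apply filter_forall. intros y. eexists. apply is_CRInt_Re, Hex.
    + intros t _. symmetry. apply is_derive_unique, Cderive_sym_gauss_z.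
  - rewrite <- (@is_RInt_unique R_CompleteNormedModule _ _ _ _ (is_CRInt_Im _ _ _ _ HI)).
    rewrite (RInt_ext _ (fun t => Derive (fun u => Im (sym_gauss u t)) z)).
    + apply is_derive_RInt_param.
      * apply filter_forall. intros y t _. exists (Im (sym_gauss_dz y t)). apply Cderive_sym_gauss_z.
      * intros t _. apply (continuity_2d_pt_ext (fun u v => Im (sym_gauss_dz u v))).
        -- intros y v. symmetry. apply is_derive_unique, Cderive_sym_gauss_z.
        -- apply sym_gauss_dz_continuity_2d.
      * apply filter_forall. intros y. eexists. apply is_CRInt_Im, Hex.
    + intros t _. symmetry. apply is_derive_unique, Cderive_sym_gauss_z.
Qed.

Lemma sym_gauss_even (z u : R) : sym_gauss (- z) u = sym_gauss z u.
Proof.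
  unfold sym_gauss. rewrite Cplus_comm. f_equal; unfold shifted_gauss; f_equal;
    rewrite ?RtoC_opp; ring.
Qed.

Lemma gauss_const_incr (y z : R) : Rabs y <= Rabs z -> gauss_const y <= gauss_const z.
Proof.
  intros H. unfold gauss_const. apply exp_le_compat.
  pose proof PI_RGT_0. pose proof gauss_slope_pos. pose proof (Rabs_pos y).
  apply Rmult_le_compat_r; [apply Rlt_le, Rinv_0_lt_compat; lra|].
  apply pow_incr. nra.
Qed.

Lemma gauss_integral_shift (z b : R) : 0 <= z -> 0 <= b ->
  Cmod (CRInt (sym_gauss z) 0 b - CRInt (sym_gauss 0) 0 b)%C <= / sqrt PI * (2 * gauss_const z * exp (- (2 * b))) * z.
Proof.
  intros Hz Hb. set (K := / sqrt PI * (2 * gauss_const z * exp (- (2 * b)))).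
  replace (K * z) with (K * z - K * 0) by ring.
  apply (Cmean_value (fun y => CRInt (sym_gauss y) 0 b) (fun y => Ci * alpha * RtoC (/ sqrt PI) * (shifted_gauss y b - shifted_gauss y (- b)))%C
    (fun y => K * y) (fun _ => K)); [exact Hz| | |].
  - intros t _. apply Cderive_gauss_integral.
  - intros t _. auto_derive; [easy|]. ring.
  - intros t Ht.
    pose proof sqrt_PI_pos as Hp. assert (Hip : 0 < / sqrt PI) by now apply Rinv_0_lt_compat.
    rewrite !Cmod_mult, Cmod_Ci, Cmod_alpha, Cmod_R, (Rabs_pos_eq (/ sqrt PI)), !Rmult_1_l by lra.
    unfold K. apply Rmult_le_compat_l; [lra|].
    replace (shifted_gauss t b - shifted_gauss t (- b))%C with (shifted_gauss t b + - shifted_gauss t (- b))%C by ring.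
    eapply Rle_trans; [apply Cmod_triangle|]. rewrite Cmod_opp.
    pose proof (shifted_gauss_bound t b) as B1. pose proof (shifted_gauss_bound t (- b)) as B2.
    rewrite Rabs_Ropp in B2. rewrite (Rabs_pos_eq b) in B1, B2 by lra.
    pose proof (gauss_const_incr t z ltac:(rewrite !Rabs_pos_eq; lra)) as B3.
    pose proof (exp_pos (- (2 * b))). nra.
Qed.

Lemma sym_gauss_integral (z : R) :
  filterlim (fun b => CRInt (sym_gauss z) 0 b) (Rbar_locally p_infty) (@locally C_UniformSpace (RtoC 1)).
Proof.
  apply Clim_eps; [apply Rbar_locally_filter|]. intros eps Heps.
  (* [sym_gauss] is even in [z], which reduces everything to the range [0 <= z] of
     [gauss_integral_shift]. *)
  set (y := Rabs z).
  assert (Hy : 0 <= y) by apply Rabs_pos.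
  assert (E : forall b, CRInt (sym_gauss z) 0 b = CRInt (sym_gauss y) 0 b).
  { intros b. unfold y, Rabs. destruct Rcase_abs; [|reflexivity].
    apply (@RInt_ext C_R_CompleteNormedModule). intros x _. symmetry. apply sym_gauss_even. }
  pose proof sqrt_PI_pos as Hp. assert (Hip : 0 < / sqrt PI) by now apply Rinv_0_lt_compat.
  set (A := sym_gauss_const 0). set (B := / sqrt PI * (2 * gauss_const y) * y).
  assert (HA : 0 <= A) by exact (decaying_nonneg _ _ (decaying_sym_gauss 0)).
  assert (HB : 0 <= B).
  { apply Rmult_le_pos; [|exact Hy]. apply Rmult_le_pos; [lra|].
    apply Rmult_le_pos; [lra | apply Rlt_le, exp_pos]. }
  exists (Rmax 0 ((A + B) / eps)). intros b Hb.
  assert (Hb0 : 0 < b) by (apply Rle_lt_trans with (2 := Hb), Rmax_l).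
  assert (Hb1 : A + B < eps * b).
  { apply Rmult_lt_reg_r with (/ eps); [now apply Rinv_0_lt_compat|].
    replace (eps * b * / eps) with b by (field; lra). apply Rle_lt_trans with (2 := Hb), Rmax_r. }
  rewrite E.
  pose proof (gauss_integral_error b Hb0) as B1. fold A in B1.
  pose proof (gauss_integral_shift y b Hy ltac:(lra)) as B2.
  replace (/ sqrt PI * (2 * gauss_const y * exp (- (2 * b))) * y) with (B * exp (- (2 * b))) in B2 by (unfold B; ring).
  assert (B3 : exp (- (2 * b)) <= exp (- b)) by (apply exp_le_compat; lra).
  revert B1 B2. generalize (CRInt (sym_gauss y) 0 b), (CRInt (sym_gauss 0) 0 b). intros u v B1 B2.
  replace (u - 1)%C with ((u - v) + (v - 1))%C by ring.
  eapply Rle_lt_trans; [apply Cmod_triangle|].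
  apply Rle_lt_trans with ((A + B) * exp (- b)); [nra|].
  rewrite exp_Ropp. apply Rmult_lt_reg_r with (exp b); [apply exp_pos|].
  rewrite Rmult_assoc, Rinv_l, Rmult_1_r by (apply Rgt_not_eq, exp_pos).
  pose proof (exp_ineq1_le b). nra.
Qed.

(** * Nonvanishing of the Mellin transform of the Gaussian *)

(** Here [M] is PI^(-w/2) Gamma(w/2), the gamma factor of the completed zeta function. *)
Definition gauss_mellin (w M : C) : Prop := is_CI (fun x => sym_gauss 0 x * mellin_kernel w x)%C M.

Lemma sym_gauss_mellin_dominated (z : R) (w : C) : 0 < Re w ->
  exists K d, dominated (fun x => sym_gauss z x * mellin_kernel w x)%C K d.
Proof.
  intros Hw. pose proof (decaying_sym_gauss z) as HG.
  destruct (decaying_mellin_dominated w Hw) as [K [HK H]].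
  exists (sym_gauss_const z * K), (Rmin (Re w) 1).
  apply H.
  - exact (decaying_nonneg _ _ HG).
  - apply Rmin_pos; lra.
  - apply Rmin_l.
  - apply Rmin_r.
  - intros x _. apply HG.
  - intros x Hx. apply HG. lra.
Qed.

Lemma ex_sym_gauss_mellin (z : R) (w : C) : 0 < Re w ->
  exists M, is_CI (fun x => sym_gauss z x * mellin_kernel w x)%C M.
Proof.
  intros Hw. destruct (sym_gauss_mellin_dominated z w Hw) as [K [d H]].
  exact (dominated_is_CI _ K d H).
Qed.

Lemma mellin_kernel_succ (w : C) (x : R) : 0 < x -> mellin_kernel (w + 1) x = (RtoC x * mellin_kernel w x)%C.
Proof.
  intros Hx. unfold mellin_kernel. rewrite <- (exp_ln x Hx) at 2. rewrite <- Cexp_RtoC, <- Cexp_plus.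
  f_equal. ring.
Qed.

(** For the boundary terms of integration by parts: [x] times the majorant vanishes at both ends at
    least as fast as the tails of its primitive. *)
Lemma dom_kernel_le_primitive (d x : R) : 0 < x ->
  x * dom_kernel d x <= dom_primitive d x + 1 /\ x * dom_kernel d x <= - dom_primitive d x.
Proof.
  intros Hx. unfold dom_kernel, dom_primitive.
  pose proof (exp_pos (d * ln x)) as He. set (e := exp (d * ln x)) in *. rewrite exp_Ropp. fold e.
  assert (Hie : 0 < / e) by now apply Rinv_0_lt_compat.
  replace (x * / (x * (2 + e + / e))) with (/ (2 + e + / e)) by (field; repeat split; try lra; nra).
  split.
  - replace (- / (1 + e) + 1) with (/ (1 + / e)) by (field; lra). apply Rinv_le_contravar; lra.
  - rewrite Ropp_involutive. apply Rinv_le_contravar; lra.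
Qed.

(* Integration by parts: the derivative of e^(-pi x^2) x^w has integral 0. *)
Lemma gauss_mellin_step (w M : C) : 0 < Re w ->
  gauss_mellin w M -> gauss_mellin (w + 2) (w / RtoC (2 * PI) * M).
Proof.
  intros Hw HM. pose proof PI_RGT_0 as HP.
  set (H := fun x => (sym_gauss 0 x * mellin_kernel (w + 1) x)%C).
  set (H' := fun x => (w * (sym_gauss 0 x * mellin_kernel w x) - RtoC (2 * PI) * (sym_gauss 0 x * mellin_kernel (w + 2) x))%C).
  assert (Hd : forall x, 0 < x -> Cderive H x (H' x)).
  { intros x Hx.
    assert (D : Cderive (sym_gauss 0) x (RtoC (- (2 * PI * x)) * sym_gauss 0 x)%C).
    { apply (Cderive_eq_fun (fun u => RtoC (2 * exp (- (PI * u ^ 2))))); [intros; symmetry; apply sym_gauss_0|].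
      rewrite sym_gauss_0, <- RtoC_mult. apply Cderive_RtoC. auto_derive; [easy|].
      replace (x * (x * 1)) with (x ^ 2) by ring. ring. }
    eapply Cderive_ext_val; [|exact (Cderive_mult _ _ x _ _ D (Cderive_mellin_kernel (w + 1) x Hx))].
    unfold H'. replace (w + 2)%C with (w + 1 + 1)%C by (rewrite <- Cplus_assoc, <- RtoC_plus; do 2 f_equal; ring).
    rewrite !mellin_kernel_succ by assumption. rewrite RtoC_inv, RtoC_opp, !RtoC_mult by lra.
    field. apply RtoC_neq_0. lra. }
  assert (Hc : forall x, 0 < x -> Ccontinuous H' x).
  { intros x Hx. unfold H'. apply Ccontinuous_minus;
      (apply Ccontinuous_mult; [eapply Cderive_continuous, Cderive_const|];
       apply Ccontinuous_mult; [apply Ccontinuous_sym_gauss | now apply Ccontinuous_mellin_kernel]). }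
  assert (HH : is_CI H' 0).
  { destruct (sym_gauss_mellin_dominated 0 w Hw) as [K [d HD]].
    pose proof (dominated_nonneg _ _ _ HD) as HK. destruct HD as [Hdp [_ HD]].
    assert (HB : forall x, 0 < x -> Cmod (H x) <= K * (x * dom_kernel d x)).
    { intros x Hx. unfold H. rewrite mellin_kernel_succ by exact Hx.
      replace (sym_gauss 0 x * (RtoC x * mellin_kernel w x))%C with (RtoC x * (sym_gauss 0 x * mellin_kernel w x))%C by ring.
      rewrite Cmod_mult, Cmod_R, Rabs_pos_eq by lra.
      replace (K * (x * dom_kernel d x)) with (x * (K * dom_kernel d x)) by ring.
      apply Rmult_le_compat_l; [lra | now apply HD]. }
    apply is_CI_eps. intros eps Heps.
    set (e := eps / (2 * (K + 1))).
    assert (He : 0 < e) by (apply Rdiv_lt_0_compat; lra).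
    assert (Ee : (K + 1) * e = eps / 2) by (unfold e; field; lra).
    destruct (dom_primitive_at_0 d e Hdp He) as [h [Hh H1]].
    destruct (dom_primitive_at_infty d e Hdp He) as [M0 [HM0 H2]].
    exists h, M0. split; [exact Hh|]. split; [exact HM0|]. intros a b Ha Hb.
    exists (H b - H a)%C. split.
    - apply (@is_RInt_derive C_R_CompleteNormedModule H H').
      + intros x Hx. rewrite Rmin_left in Hx by lra. apply Cderive_is_derive, Hd. lra.
      + intros x Hx. rewrite Rmin_left in Hx by lra. apply Hc. lra.
    - replace (H b - H a - 0)%C with (H b + - H a)%C by ring.
      eapply Rle_lt_trans; [apply Cmod_triangle|]. rewrite Cmod_opp.
      pose proof (HB a ltac:(lra)) as B1. pose proof (HB b ltac:(lra)) as B2.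
      pose proof (proj1 (dom_kernel_le_primitive d a ltac:(lra))) as P1.
      pose proof (proj2 (dom_kernel_le_primitive d b ltac:(lra))) as P2.
      specialize (H1 a Ha). specialize (H2 b Hb).
      assert (K * (a * dom_kernel d a) <= K * e) by (apply Rmult_le_compat_l; lra).
      assert (K * (b * dom_kernel d b) <= K * e) by (apply Rmult_le_compat_l; lra).
      lra. }
  pose proof (is_CI_minus _ _ _ _ (is_CI_scal _ _ w HM) HH) as H1.
  apply (is_CI_scal _ _ (/ RtoC (2 * PI))%C) in H1.
  assert (Hne : RtoC (2 * PI) <> 0) by (apply RtoC_neq_0; lra).
  unfold gauss_mellin.
  replace (w / RtoC (2 * PI) * M)%C with (/ RtoC (2 * PI) * (w * M - 0))%C by (field; exact Hne).
  eapply is_CI_ext; [|exact H1]. intros x Hx. cbv beta. unfold H'. field. exact Hne.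
Qed.

(** Trades the square of a logarithm for exponentials of it, that is for powers of [x], whose Mellin
    transforms are linked by the recurrence. *)
Lemma sq_le_cosh (L : R) : L ^ 2 <= exp L + exp (- L) - 2.
Proof.
  assert (Hpos : forall L, 0 <= L -> L ^ 2 <= exp L + exp (- L) - 2).
  { clear L. intros L HL.
    assert (H1 : forall y, 0 <= y -> 0 <= exp y - exp (- y) - 2 * y).
    { intros y Hy.
      assert (H : exp 0 - exp (- 0) - 2 * 0 <= exp y - exp (- y) - 2 * y).
      { apply (deriv_nonneg_le (fun y => exp y - exp (- y) - 2 * y) (fun y => exp y + exp (- y) - 2)); [exact Hy| |].
        - intros t _. auto_derive; [easy|]. ring.
        - intros t _. rewrite exp_Ropp. pose proof (exp_pos t) as P.
          replace (exp t + / exp t - 2) with ((exp t - 1) ^ 2 * / exp t) by (field; lra).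
          apply Rmult_le_pos; [apply pow2_ge_0 | now apply Rlt_le, Rinv_0_lt_compat]. }
      rewrite Ropp_0, exp_0 in H. lra. }
    assert (H : exp 0 + exp (- 0) - 2 - 0 ^ 2 <= exp L + exp (- L) - 2 - L ^ 2).
    { apply (deriv_nonneg_le (fun y => exp y + exp (- y) - 2 - y ^ 2) (fun y => exp y - exp (- y) - 2 * y)); [exact HL| |].
      - intros t _. auto_derive; [easy|]. ring.
      - intros t Ht. apply H1. lra. }
    rewrite Ropp_0, exp_0 in H. lra. }
  destruct (Rle_lt_dec 0 L) as [H|H]; [now apply Hpos|].
  pose proof (Hpos (- L) ltac:(lra)) as K. rewrite Ropp_involutive in K. nra.
Qed.

Lemma cos_ge_quadratic_all (x : R) : 1 - x ^ 2 / 2 <= cos x.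
Proof.
  destruct (Rle_lt_dec 0 x) as [H|H]; [now apply cos_ge_quadratic|].
  rewrite <- cos_neg. replace (x ^ 2) with ((- x) ^ 2) by ring. apply cos_ge_quadratic. lra.
Qed.

Lemma gauss_mellin_iter (w M : C) (n : nat) : 0 < Re w ->
  gauss_mellin w 0 -> gauss_mellin (w + RtoC (2 * INR n)) 0.
Proof.
  intros Hw H0. induction n as [|n IH].
  - cbn [INR]. rewrite Rmult_0_r, Cplus_0_r. exact H0.
  - apply gauss_mellin_step in IH.
    + rewrite Cmult_0_r in IH. rewrite S_INR, Rmult_plus_distr_l, RtoC_plus, Cplus_assoc, Rmult_1_r. exact IH.
    + unfold Re in *. cbn. pose proof (pos_INR n). nra.
Qed.

Lemma mellin_kernel_real (s x : R) : mellin_kernel (RtoC s) x = RtoC (exp ((s - 1) * ln x)).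
Proof.
  unfold mellin_kernel. rewrite <- RtoC_minus, <- RtoC_mult. apply Cexp_RtoC.
Qed.

Lemma gauss_mellin_real_pos (s : R) (M : C) : 1 <= s -> gauss_mellin (RtoC s) M -> 0 < Re M.
Proof.
  intros Hs HM. pose proof PI_RGT_0 as HP.
  apply Rlt_le_trans with (2 * exp (- (PI * 2 ^ 2))).
  - pose proof (exp_pos (- (PI * 2 ^ 2))). lra.
  - apply (is_CI_Re_ge _ _ _) with (4 := HM).
    + intros x Hx. apply Ccontinuous_mult; [apply Ccontinuous_sym_gauss | now apply Ccontinuous_mellin_kernel].
    + intros x Hx. rewrite sym_gauss_0, mellin_kernel_real, <- RtoC_mult. cbn [Re RtoC fst].
      pose proof (exp_pos (- (PI * x ^ 2))). pose proof (exp_pos ((s - 1) * ln x)).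
      change (0 <= 2 * exp (- (PI * x ^ 2)) * exp ((s - 1) * ln x)). nra.
    + intros x Hx. rewrite sym_gauss_0, mellin_kernel_real, <- RtoC_mult.
      change (2 * exp (- (PI * 2 ^ 2)) <= 2 * exp (- (PI * x ^ 2)) * exp ((s - 1) * ln x)).
      assert (H1 : exp (- (PI * 2 ^ 2)) <= exp (- (PI * x ^ 2))).
      { apply exp_le_compat, Ropp_le_contravar, Rmult_le_compat_l; [lra|]. apply pow_incr. lra. }
      assert (H2 : 1 <= exp ((s - 1) * ln x)).
      { apply Rle_trans with (exp 0); [rewrite exp_0; lra|]. apply exp_le_compat. apply Rmult_le_pos; [lra|].
        rewrite <- ln_1. apply ln_le_compat; lra. }
      pose proof (exp_pos (- (PI * 2 ^ 2))). nra.
Qed.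

(* By the recurrence a zero w would give zeros w + 2n. There x^(i Im w) is almost constant on the bulk of
   e^(-pi x^2) x^(Re w + 2n - 1): with c = (Re w + 2n) / (2 pi) and X = x^2 / c,
   cos (Im w (ln x - ln c / 2)) >= 1 - (Im w)^2 / 8 (X - 2 + 1/X), whose integral is positive for large n. *)
Lemma gauss_mellin_neq_0 (w : C) : 0 < Re w -> ~ gauss_mellin w 0.
Proof.
  intros Hw H0. pose proof PI_RGT_0 as HP.
  set (t := Im w).
  destruct (nfloor_ex (t ^ 2 + 3) ltac:(pose proof (pow2_ge_0 t); lra)) as [n [_ Hn]].
  set (N := S n). assert (HN : t ^ 2 + 3 <= INR N) by (unfold N; rewrite S_INR; lra).
  pose proof (gauss_mellin_iter w 0 N Hw H0) as HZ.
  set (s := Re w + 2 * INR N).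
  assert (Hs : t ^ 2 + 3 < s - 2) by (unfold s; pose proof (pow2_ge_0 t); lra).
  pose proof (pow2_ge_0 t) as Ht2.
  destruct (ex_sym_gauss_mellin 0 (RtoC (s - 2)) ltac:(cbn; lra)) as [m0 Hm0].
  change (gauss_mellin (RtoC (s - 2)) m0) in Hm0.
  pose proof (gauss_mellin_step (RtoC (s - 2)) m0 ltac:(cbn; lra) Hm0) as Hm1.
  replace (RtoC (s - 2) + 2)%C with (RtoC s) in Hm1 by (rewrite <- RtoC_plus; f_equal; ring).
  set (m1 := (RtoC (s - 2) / RtoC (2 * PI) * m0)%C) in *.
  pose proof (gauss_mellin_step (RtoC s) m1 ltac:(cbn; lra) Hm1) as Hm2.
  set (m2 := (RtoC s / RtoC (2 * PI) * m1)%C) in *.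
  (* The ratio of [m2] to [m1], so that X = x^2/c has mean 1 for the weight with total mass [m1]. *)
  set (c := s / (2 * PI)). assert (Hc : 0 < c) by (apply Rdiv_lt_0_compat; lra).
  (* With Y = ln x - (ln c)/2, the loss t^2 Y^2/2 of the cosine equals k (2Y)^2, to which
     [sq_le_cosh] applies at 2Y. *)
  set (k := t ^ 2 / 8).
  pose proof (is_CI_scal _ _ (Cexp (- Ci * RtoC (t * (ln c / 2)))) HZ) as I1.
  pose proof (is_CI_scal _ _ (RtoC (1 + 2 * k)) Hm1) as I2.
  pose proof (is_CI_scal _ _ (RtoC (k / c)) Hm2) as I3.
  pose proof (is_CI_scal _ _ (RtoC (k * c)) Hm0) as I4.
  pose proof (is_CI_plus _ _ _ _ (is_CI_minus _ _ _ _ I1 I2) (is_CI_plus _ _ _ _ I3 I4)) as I.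
  assert (Hpos : 0 < Re m1) by (apply (gauss_mellin_real_pos s m1); [lra | exact Hm1]).
  set (l := (Cexp (- Ci * RtoC (t * (ln c / 2))) * 0 - RtoC (1 + 2 * k) * m1 + (RtoC (k / c) * m2 + RtoC (k * c) * m0))%C) in *.
  assert (Hpt : forall x, 0 < x -> 0 <= Re (Cexp (- Ci * RtoC (t * (ln c / 2))) * (sym_gauss 0 x * mellin_kernel (w + RtoC (2 * INR N)) x)
      - RtoC (1 + 2 * k) * (sym_gauss 0 x * mellin_kernel (RtoC s) x)
      + (RtoC (k / c) * (sym_gauss 0 x * mellin_kernel (RtoC s + 2) x)
         + RtoC (k * c) * (sym_gauss 0 x * mellin_kernel (RtoC (s - 2)) x)))%C).
  { intros x Hx. set (Y := ln x - ln c / 2).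
    set (r := 2 * exp (- (PI * x ^ 2)) * exp ((s - 1) * ln x)).
    assert (E1 : (Cexp (- Ci * RtoC (t * (ln c / 2))) * mellin_kernel (w + RtoC (2 * INR N)) x)%C
       = (RtoC (exp ((s - 1) * ln x)) * Cexp (Ci * RtoC (t * Y)))%C).
    { unfold mellin_kernel. rewrite <- Cexp_RtoC, <- !Cexp_plus. f_equal.
      replace (w + RtoC (2 * INR N))%C with (RtoC s + Ci * RtoC t)%C.
      - unfold Y. rewrite !RtoC_mult, !RtoC_minus. ring_simplify.
        rewrite ?RtoC_mult. ring.
      - unfold s, t. destruct w as [w1 w2]. unfold RtoC, Ci, Cplus, Cmult, Re, Im. cbn. f_equal; ring. }
    assert (E2 : k / c * exp ((s + 2 - 1) * ln x) = exp ((s - 1) * ln x) * (k * exp (2 * Y))).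
    { unfold Rdiv. rewrite <- (exp_ln c Hc) at 1. rewrite <- exp_Ropp.
      replace (exp ((s - 1) * ln x) * (k * exp (2 * Y))) with (k * (exp ((s - 1) * ln x) * exp (2 * Y))) by ring.
      rewrite Rmult_assoc, <- !exp_plus. do 2 f_equal. unfold Y. field. }
    assert (E3 : k * c * exp ((s - 2 - 1) * ln x) = exp ((s - 1) * ln x) * (k * exp (- (2 * Y)))).
    { rewrite <- (exp_ln c Hc) at 1.
      replace (exp ((s - 1) * ln x) * (k * exp (- (2 * Y)))) with (k * (exp ((s - 1) * ln x) * exp (- (2 * Y)))) by ring.
      rewrite Rmult_assoc, <- !exp_plus. do 2 f_equal. unfold Y. field. }
    match goal with |- 0 <= Re ?v => replace v with
      (RtoC r * (Cexp (Ci * RtoC (t * Y)) + RtoC (- (1 + 2 * k) + k * exp (2 * Y) + k * exp (- (2 * Y)))))%C end.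
    - assert (Er : forall v : C, Re (RtoC r * v)%C = r * Re v) by (intros v; unfold Re; cbn; ring).
      rewrite Er. apply Rmult_le_pos.
      + unfold r. pose proof (exp_pos (- (PI * x ^ 2))). pose proof (exp_pos ((s - 1) * ln x)). nra.
      + assert (Ec : Re (Cexp (Ci * RtoC (t * Y)) + RtoC (- (1 + 2 * k) + k * exp (2 * Y) + k * exp (- (2 * Y))))%C
           = cos (t * Y) + (- (1 + 2 * k) + k * exp (2 * Y) + k * exp (- (2 * Y)))).
        { unfold Cexp. cbn. replace (0 * (t * Y) - 1 * 0) with 0 by ring. rewrite exp_0.
          replace (0 * 0 + 1 * (t * Y)) with (t * Y) by ring. ring. }
        rewrite Ec. pose proof (cos_ge_quadratic_all (t * Y)) as C1. pose proof (sq_le_cosh (2 * Y)) as C2.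
        assert (Hk : 0 <= k) by (unfold k; lra).
        apply Rmult_le_compat_l with (r := k) in C2; [|exact Hk].
        unfold k in *. nra.
    - replace (RtoC s + 2)%C with (RtoC (s + 2)) by (now rewrite RtoC_plus).
      rewrite !mellin_kernel_real, sym_gauss_0.
      set (e := exp ((s - 1) * ln x)) in *. set (g := 2 * exp (- (PI * x ^ 2))) in *.
      transitivity (RtoC g * (Cexp (- Ci * RtoC (t * (ln c / 2))) * mellin_kernel (w + RtoC (2 * INR N)) x)
         - RtoC (1 + 2 * k) * RtoC g * RtoC e + (RtoC g * RtoC (k / c * exp ((s + 2 - 1) * ln x)) + RtoC g * RtoC (k * c * exp ((s - 2 - 1) * ln x))))%C.
      + rewrite E1, E2, E3. unfold r. rewrite !RtoC_plus, !RtoC_mult, !RtoC_opp, !RtoC_plus, !RtoC_mult. ring.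
      + rewrite !RtoC_mult. ring. }
  assert (Hre : 0 <= Re l).
  { apply (is_CI_Re_ge _ _ 0) with (4 := I).
    - intros x Hx.
      assert (Q : forall a v, Ccontinuous (fun x => a * (sym_gauss 0 x * mellin_kernel v x))%C x).
      { intros a v. apply Ccontinuous_mult; [eapply Cderive_continuous, Cderive_const|].
        apply Ccontinuous_mult; [apply Ccontinuous_sym_gauss | now apply Ccontinuous_mellin_kernel]. }
      apply Ccontinuous_plus; [apply Ccontinuous_minus | apply Ccontinuous_plus]; apply Q.
    - exact Hpt.
    - intros x Hx. apply Hpt. lra. }
  (* The recurrence expresses all moments through [m1]: [k / c * m2] is k m1, and [k * c * m0] is k
     s/(s-2) m1. With -(1 + 2k) this leaves -1 + 2k/(s-2), negative since 2k = t^2/4 < s - 2,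
     although [l] has nonnegative real part. *)
  assert (El : l = (RtoC (-1 + 2 * k / (s - 2)) * m1)%C).
  { assert (E0 : m0 = (RtoC (2 * PI / (s - 2)) * m1)%C).
    { unfold m1. rewrite RtoC_div by lra. field. split; apply RtoC_neq_0; lra. }
    assert (E2 : m2 = (RtoC c * m1)%C) by (unfold m2, c; rewrite RtoC_div by lra; ring).
    unfold l. rewrite E0, E2, Cmult_0_r.
    replace (-1 + 2 * k / (s - 2)) with (- (1 + 2 * k) + (k / c * c + k * c * (2 * PI / (s - 2))))
      by (unfold c; field; lra).
    rewrite !RtoC_plus, RtoC_opp, !RtoC_plus, !RtoC_mult. ring. }
  assert (Er : Re (RtoC (-1 + 2 * k / (s - 2)) * m1)%C = (-1 + 2 * k / (s - 2)) * Re m1) by (unfold Re; cbn; ring).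
  rewrite El, Er in Hre.
  assert (Hk1 : 2 * k / (s - 2) < 1).
  { apply Rmult_lt_reg_r with (s - 2); [lra|]. unfold Rdiv. rewrite Rmult_assoc, Rinv_l by lra. unfold k. lra. }
  nra.
Qed.

(** * Zeta in the critical strip *)

(** Both one-sided series converge absolutely, so the two values chosen by [CSeries] are genuine
    sums and may be added term by term. *)
Lemma CSeries_nonzero_gauss (z x : R) : 0 < x ->
  CSeries_nonzero (fun n : Z =>
    Cexp ((alpha * RtoC z - Ci * RtoC (sqrt PI) * RtoC (IZR n) * RtoC x) ^ 2)%C)
  = theta_sum (sym_gauss z) x.
Proof.
  intros Hx.
  assert (E : forall u : nat -> R, (forall k, Rabs (u k) = INR (S k) * x) ->
    exists l, is_Cseries (fun k => shifted_gauss z (u k)) l).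
  { intros u Hu.
    apply (Cseries_dominated _ (fun k => gauss_const z * exp (- (INR (S k) * (2 * x))))).
    - intros k. replace (INR (S k) * (2 * x)) with (2 * Rabs (u k)) by (rewrite Hu; ring).
      apply shifted_gauss_bound.
    - apply (ex_series_scal (V := R_NormedModule)). eexists. apply is_series_exp_geom. lra. }
  assert (Hp : forall k, 0 <= INR (S k) * x) by (intros k; apply Rmult_le_pos; [apply pos_INR | lra]).
  destruct (E (fun k => INR (S k) * x)) as [l1 H1]; [intros k; now apply Rabs_pos_eq|].
  destruct (E (fun k => - (INR (S k) * x))) as [l2 H2]; [intros k; rewrite Rabs_Ropp; now apply Rabs_pos_eq|].
  assert (H3 : is_Cseries (fun n => sym_gauss z (INR (S n) * x)) (l1 + l2)%C).
  { exact (@is_series_plus C_AbsRing C_NormedModule _ _ l1 l2 H1 H2). }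
  unfold theta_sum, CSeries_nonzero. rewrite (CSeries_unique _ _ H3).
  f_equal; apply CSeries_unique.
  - revert H1. apply is_Cseries_ext. intros k. unfold shifted_gauss. f_equal.
    rewrite RtoC_mult, INR_IZR_INZ. ring.
  - revert H2. apply is_Cseries_ext. intros k. unfold shifted_gauss. f_equal.
    rewrite RtoC_opp, RtoC_mult, INR_IZR_INZ, opp_IZR, RtoC_opp. ring.
Qed.

Lemma phi_zeta_integrand_val (s : C) (z x : R) : 0 < x ->
  phi_zeta_integrand s z x = (theta_reduced (sym_gauss z) 1 x * mellin_kernel (1 - s) x)%C.
Proof.
  intros Hx. unfold phi_zeta_integrand, theta_reduced, mellin_kernel, RCpow.
  rewrite CSeries_nonzero_gauss by exact Hx. f_equal.
  - unfold Cdiv. now rewrite Cmult_1_l.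
  - f_equal. ring.
Qed.

(** Subtracting 1/x absorbs the constant term of the full theta series: the functional equation
    becomes theta_reduced(1/x) = x theta_reduced(x). The two factors [x], from here and from the
    kernel, cancel the Jacobian. *)
Lemma theta_reduced_0_inv (w : C) (x : R) : 0 < x ->
  (RtoC (/ x ^ 2) * (theta_reduced (sym_gauss 0) 1 (/ x)%R * mellin_kernel w (/ x)%R))%C =
  (theta_reduced (sym_gauss 0) 1 x * mellin_kernel (1 - w) x)%C.
Proof.
  intros Hx. assert (Hix : 0 < / x) by now apply Rinv_0_lt_compat.
  assert (E1 : theta_reduced (sym_gauss 0) 1 (/ x)%R = (RtoC x * theta_reduced (sym_gauss 0) 1 x)%C).
  { unfold theta_reduced. rewrite !theta_sum_gauss_0 by assumption.
    replace (2 * theta0 (/ x)) with (x + x * (2 * theta0 x) - 1) by (pose proof (theta0_functional x Hx); lra).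
    rewrite RtoC_inv, RtoC_minus, RtoC_plus, !RtoC_mult by lra. field. apply RtoC_neq_0. lra. }
  assert (E2 : mellin_kernel w (/ x)%R = (RtoC x * mellin_kernel (1 - w) x)%C).
  { unfold mellin_kernel. rewrite ln_Rinv by exact Hx.
    rewrite <- (exp_ln x Hx) at 2. rewrite <- Cexp_RtoC, <- Cexp_plus. f_equal. rewrite RtoC_opp. ring. }
  rewrite E1, E2, RtoC_inv, RtoC_pow by (apply pow_nonzero; lra).
  field. apply RtoC_neq_0. lra.
Qed.

Lemma theta_reduced_CI (zeta : C -> C) (w M : C) (z : R) :
  is_riemann_zeta zeta -> 0 < Re w < 1 ->
  is_CI (fun x => sym_gauss z x * mellin_kernel w x)%C M ->
  is_CI (fun x => theta_reduced (sym_gauss z) 1 x * mellin_kernel w x)%C (zeta w * M)%C.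
Proof.
  intros Hz Hw HM.
  exact (muntz zeta (sym_gauss z) _ 1 w M Hz (decaying_sym_gauss z) (sym_gauss_integral z) Hw HM).
Qed.

(** One integral evaluated twice, before and after x -> 1/x. With the gamma factors for [M] and [M']
    this is the symmetry of the completed zeta function. *)
Lemma zeta_functional_equation (zeta : C -> C) (w M M' : C) :
  is_riemann_zeta zeta -> 0 < Re w < 1 ->
  gauss_mellin w M -> gauss_mellin (1 - w) M' ->
  (zeta w * M = zeta (1 - w) * M')%C.
Proof.
  intros Hz Hw HM HM'.
  assert (Hw' : 0 < Re (1 - w)%C < 1) by (unfold Re in *; cbn; lra).
  pose proof (theta_reduced_CI zeta w M 0 Hz Hw HM) as H1.
  pose proof (theta_reduced_CI zeta (1 - w)%C M' 0 Hz Hw' HM') as H2.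
  apply is_CI_comp_inv in H1.
  - apply (is_CI_eq _ _ _ (is_CI_ext _ _ _ (theta_reduced_0_inv w) H1) H2).
  - intros x Hx.
    exact (proj1 (proj2 (theta_reduced_dominated _ _ (decaying_sym_gauss 0) 1 (sym_gauss_integral 0) w Hw)) x Hx).
Qed.

Lemma zeta_zero_reflection (zeta : C -> C) (w : C) :
  is_riemann_zeta zeta -> 0 < Re w < 1 -> zeta w = 0 -> zeta (1 - w)%C = 0.
Proof.
  intros Hz Hw H0.
  assert (Hw' : 0 < Re (1 - w)%C < 1) by (unfold Re in *; cbn; lra).
  destruct (ex_sym_gauss_mellin 0 w (proj1 Hw)) as [M HM].
  destruct (ex_sym_gauss_mellin 0 (1 - w)%C (proj1 Hw')) as [M' HM'].
  pose proof (zeta_functional_equation zeta w M M' Hz Hw HM HM') as E.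
  rewrite H0, Cmult_0_l in E.
  assert (HM0 : M' <> 0).
  { intros E0. apply (gauss_mellin_neq_0 (1 - w)%C (proj1 Hw')). rewrite <- E0. exact HM'. }
  replace (zeta (1 - w)%C) with (zeta (1 - w)%C * M' * / M')%C by (field; exact HM0).
  rewrite <- E. ring.
Qed.

Theorem mainTheorem5 (zeta : C -> C) (Hzeta : is_riemann_zeta zeta)
  (s : C) (Hs : 0 < Re s < 1) :
  (forall z : R, phi_zeta s z = RtoC 0) <-> zeta s = RtoC 0.
Proof.
  set (w := (1 - s)%C).
  assert (Hw : 0 < Re w < 1) by (unfold w, Re in *; cbn; lra).
  assert (Hval : forall z M, is_CI (fun x => sym_gauss z x * mellin_kernel w x)%C M ->
    phi_zeta s z = (Cexp (Ci * (RtoC z ^ 2 / RtoC 2)) * (zeta w * M))%C).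
  { intros z M HM. unfold phi_zeta. f_equal. apply is_CI_unique.
    eapply is_CI_ext; [|exact (theta_reduced_CI zeta w M z Hzeta Hw HM)].
    intros x Hx. symmetry. now apply phi_zeta_integrand_val. }
  split.
  - intros H.
    destruct (ex_sym_gauss_mellin 0 w (proj1 Hw)) as [M HM].
    (* [z = 0] is where the Mellin transform is known not to vanish. *)
    specialize (H 0). rewrite (Hval 0 M HM) in H.
    assert (HM0 : M <> 0).
    { intros E0. apply (gauss_mellin_neq_0 w (proj1 Hw)). rewrite <- E0. exact HM. }
    pose proof (Cexp_neq_0 (Ci * (RtoC 0 ^ 2 / RtoC 2))%C) as He.
    assert (Hzw : zeta w = 0).
    { replace (zeta w) with (/ Cexp (Ci * (RtoC 0 ^ 2 / RtoC 2)) * (Cexp (Ci * (RtoC 0 ^ 2 / RtoC 2)) * (zeta w * M)) * / M)%C.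
      - rewrite H. ring.
      - revert He. generalize (Cexp (Ci * (RtoC 0 ^ 2 / RtoC 2))%C). intros e He. field. now split. }
    replace s with (1 - w)%C by (unfold w; ring).
    now apply zeta_zero_reflection.
  - intros H0 z.
    destruct (ex_sym_gauss_mellin z w (proj1 Hw)) as [M HM].
    rewrite (Hval z M HM).
    unfold w at 1. rewrite (zeta_zero_reflection zeta s Hzeta Hs H0). ring.
Qed.
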